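(* Assume the Markovian noise setting and the ergodicity assumption. Consider the AMDP with an $\omega$-strongly convex regularizer, $\omega>0$. Suppose the SPMD algorithm is run with stepsizes $$\lambda_k=\min\Big\{\frac{1-\Gamma}{\omega\Gamma},\frac{q\log K}{\omega K}\Big\},\quad q=2\Big(1+\log\Big(\frac{8\Gamma(1-\Gamma)\omega^2D(\pi_0,\pi^* )+8\Gamma(1-\Gamma)\omega(\rho(\pi_0)-\rho(\pi^* ))}{\sigma^2}\Big)\Big)$$ ($K$ the number of SPMD iterations), and that each policy $\pi_k$ is evaluated by the EVRTD algorithm, with parameters chosen as described in the context, for $\log(1/\epsilon)$ epochs. Then a solution $\widehat\pi$ satisfying $\mathbb E[D(\widehat\pi,\pi^* )]\le\mathcal O(1)\frac{\varepsilon_{\mathrm{approx}}}{\omega\Gamma}+\epsilon$ can be found in at most $\widetilde{\mathcal O}\big(\frac{\sigma^2}{\omega^2(1-\Gamma)\epsilon}\big)$ SPMD iterations, and the total number of state-action transition samples can be bounded by $$\widetilde{\mathcal O}\Big(\frac{\sigma^2t_{\mathrm{mix}}^3}{\omega^2(1-\Gamma)\bar\mu\,\epsilon}\Big).$$ Moreover, $$\sigma^2\le\mathcal O\Big(\frac{\bar\mu^{-1}t_{\mathrm{mix}}^2+(\bar\mu^{-1}+1)\varepsilon_{\mathrm{approx}}^2}{\min_\pi\{\lambda_{\min}(\widetilde D^\pi)\}}\Big).$$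
   Context: **AMDP.** Finite state space $\mathcal S$ and action space $\mathcal A$, kernel $\mathsf P(s'|s,a)$, cost $c$. Ergodicity assumption: for every policy $\pi$ the chain $P_\pi(s,s')=\sum_a\pi(a|s)\mathsf P(s'|s,a)$ is irreducible and aperiodic, with stationary distribution $\nu^\pi>0$; hence there are $C_P>0,\varrho\in(0,1)$ with $\max_s\|(P_\pi)^t_{(s,\cdot)}-\nu^\pi\|_1\le C_P\varrho^t$ for all $\pi$, $t\ge1$, and there is $\Gamma\in(0,1)$, fixed, with $\min_s\nu^\pi(s)\ge1-\Gamma$ for all $\pi$. $t_{\mathrm{mix}}:=\max_\pi\min\{t\ge1:\max_{q\in\Delta_{|\mathcal S|}}\|((P_\pi)^t)^\top q-\nu^\pi\|_1\le\frac12\}$. $D_{\pi'}^\pi(s)=\sum_a\pi(a|s)\log\frac{\pi(a|s)}{\pi'(a|s)}$. The regularizer $h^\pi(s)$ is a closed convex function of $\pi(\cdot|s)$ with $h^\pi(s)-[h^{\pi'}(s)+\langle\nabla h^{\pi'}(s,\cdot),\pi(\cdot|s)-\pi'(\cdot|s)\rangle]\ge\omega D_{\pi'}^\pi(s)$ and $|c(s,a)+h^\pi(s)|\le\bar c$. $\rho(\pi)=\sum_s\nu^\pi(s)[\sum_a\pi(a|s)c(s,a)+h^\pi(s)]$, minimized by $\pi^*$; $\nu^*=\nu^{\pi^*}$; $D(\pi,\pi')=\mathbb E_{s\sim\nu^*}[D_\pi^{\pi'}(s)]$; $\bar Q^\pi(s,a)=\mathbb E_\pi[\sum_{t\ge0}(c(s_t,a_t)+h^\pi(s_t)-\rho(\pi))\mid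 s_0=s,a_0=a]$; $\|x\|_{\mathrm{sp}}=\max_ix_i-\min_ix_i$. Markovian noise: data are observed along a single trajectory. **SPMD.** $\pi_0$ uniform; at iteration $k$ compute a random estimator $\mathcal Q^{\pi_k,\zeta_k}$ of $\bar Q^{\pi_k}$ and set $\pi_{k+1}(\cdot|s)=\arg\min_{p(\cdot|s)\in\Delta_{|\mathcal A|}}\{\lambda_k[\langle\mathcal Q^{\pi_k,\zeta_k}(s,\cdot),p(\cdot|s)\rangle+h^p(s)]+D_{\pi_k}^p(s)\}$, $0\le k\le K$; output $\widehat\pi=\pi_{K+1}$. $\sigma$ is such that $\mathbb E_{\zeta_k}[\|\mathcal Q^{\pi_k,\zeta_k}-\bar Q^{\pi_k}\|_{\mathrm{sp}}^2]\le\sigma^2$ for all $k$ (expectation over $\zeta_k$ given the past). **Features and perturbed quantities.** (In policy evaluation, $c$ stands for $c(s,a)+h^\pi(s)$.) $\Psi=[\psi_1,\dots,\psi_d]\in\mathbb R^{|\mathcal S||\mathcal A|\times d}$ is fixed, with linearly independent columns spanning $\mathbb S$, rows $\psi(s,a)$ with $\|\psi(s,a)\|_2\le1$, and for each policy $\pi$, $\mathbb S$ contains no vector equal to $1$ on $\{(s,a):\pi(a|s)>0\}$. For a policy $\pi$: $P^\pi((s,a),(s',a'))=\mathsf P(s'|s,a)\pi(a'|s')$, $D^\pi=\mathrm{diag}(\nu^\pi(s)\pi(a|s))$, $1-\beta=\inf_{x\in\mathbb S,x^\top D^\pi x=1}x^\top D^\pi(I-P^\pi)x$; for $\underline\pi\in(0,1)$,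 $\mathcal A_s=\{a:\pi(a|s)>\underline\pi/2\}$, $\widetilde\pi(a|s)=\underline\pi$ for $a\notin\mathcal A_s$ and $\widetilde\pi(a|s)=\pi(a|s)\frac{1-(|\mathcal A|-|\mathcal A_s|)\underline\pi}{\sum_{a'\in\mathcal A_s}\pi(a'|s)}$ for $a\in\mathcal A_s$; $\widetilde D^\pi=\mathrm{diag}(\nu^\pi(s)\widetilde\pi(a|s))$; $\alpha(\underline\pi)=1-(|\mathcal A|-\min_s|\mathcal A_s|)\underline\pi$. Here $\underline\pi\le\frac{(1-\beta)\min_s\nu^\pi(s)}{(|\mathcal A|-\min_s|\mathcal A_s|)(8+(1-\beta)\min_s\nu^\pi(s))}$ whenever $\min_s|\mathcal A_s|\neq|\mathcal A|$. $\bar\theta_\pi$ is the solution of $\Psi^\top\widetilde D^\pi\Psi\theta=\Psi^\top\widetilde D^\pi P^\pi\Psi\theta+\Psi^\top\widetilde D^\pi(c-\rho(\pi)\mathbf 1)$; $\varepsilon_{\mathrm{approx}}:=\max_\pi\|\Psi\bar\theta_\pi-\bar Q^\pi\|_{\mathrm{sp}}$; $\bar\mu$ is a lower bound over all policies of $\mu=\lambda_{\min}(\Psi^\top\widetilde D^\pi\Psi)$. **EVRTD** for a policy $\pi$. For $\xi=\{(s,a),(s',a'),c(s,a)\}$ let $\widetilde g(\theta,\rho,\xi)=(\langle\psi(s,a)-\psi(s',a'),\theta\rangle-c(s,a)+\rho)\psi(s,a)$. In each epoch, starting from the previous output $\theta_1=\widetilde\theta$: collect $N'$ state-action pairs following $\pi$,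 each the last of $\tau'+1$ successive ones, and let $\widetilde\rho$ be their average cost; $N$ times run the chain under $\pi$ for $\tau'$ steps to reach $s$, draw $a\sim\widetilde\pi(\cdot|s)$, $s'\sim\mathsf P(\cdot|s,a)$, $a'\sim\pi(\cdot|s')$, and let $\widehat g$ be the average of $\widetilde g(\widetilde\theta,\widetilde\rho,\cdot)$ over these tuples; for $t=1,\dots,T$ obtain a tuple $\xi_t$ in the same way with $\tau$ in place of $\tau'$ and set $\theta_{t+1}=\theta_t-\eta(\widetilde g(\theta_t,\widetilde\rho,\xi_t)-\widetilde g(\widetilde\theta,\widetilde\rho,\xi_t)+\widehat g)$; output $\frac1T\sum_{t\le T}\theta_t$. The estimator is $\mathcal Q^{\pi_k,\zeta_k}=\Psi\widehat\theta$ with $\widehat\theta$ the last epoch's output. Parameters: with $1-\widetilde\beta=\min\{\frac{27\alpha(\underline\pi)(1-\beta)}{32},\frac{1-\alpha(\underline\pi)(1-\beta)}8\}$, up to universal constants $\eta\asymp1-\widetilde\beta$, $T\asymp\frac1{\mu(1-\widetilde\beta)\eta}$, $N,N'\asymp\frac1{\mu(1-\widetilde\beta)^2}$, and $\tau,\tau'$ of order $t_{\mathrm{mix}}$ times logarithmic factors in $1/\epsilon$ and problem parameters. **Conventions.** The feature subspace is assumed properly chosen so that $(1-\beta)^{-1}$ (and its perturbed analogue) is $\mathcal O(t_{\mathrm{mix}})$. $\bar c$ is treated as a constant; $\mathcal O$ hides universal constants, $\widetilde{\mathcal O}$ also logarithmic factors.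
   Formalization: The iteration and sample bounds assume the ratio inside the logarithm of q is at least 1 (else stepsizes can be negative) and ε ≤ σ²/ω² (else the bound can drop below one iteration); the log(1/ε) epochs are read as a constant times the logarithm of 1/ε plus problem parameters. *)

(* Defs.v *)
(* MathComp-Analysis; the reals are an arbitrary R : realType. *)
From Stdlib Require List.
From mathcomp Require Export all_boot all_order all_algebra.
From mathcomp Require Export all_classical all_reals all_analysis.
Export Order.TTheory GRing.Theory Num.Theory.
Export numFieldNormedType.Exports.

Set Implicit Arguments.
Unset Strict Implicit.
Unset Printing Implicit Defensive.

Local Open Scope classical_set_scope.
Local Open Scope ring_scope.

(** * Functions on a finite type as vectors and matrices *)

Section FiniteVectors.
Variables (R : realType).

Definition vec_of (T : finType) (f : T -> R) : 'cV[R]_#|T| :=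
  \col_i f (enum_val i).

Definition mx_of (T : finType) (f : T -> T -> R) : 'M[R]_#|T| :=
  \matrix_(i, j) f (enum_val i) (enum_val j).

Definition diag_of (T : finType) (f : T -> R) : 'M[R]_#|T| :=
  diag_mx (\row_i f (enum_val i)).

Definition coord (T : finType) (v : 'cV[R]_#|T|) (x : T) : R :=
  v (enum_rank x) 0.

Definition l1norm n (v : 'cV[R]_n) : R := \sum_i `|v i 0|.
Definition l2norm n (v : 'cV[R]_n) : R := Num.sqrt (\sum_i v i 0 ^+ 2).

Definition spnorm (T : finType) (f : T -> R) : R :=
  sup (range f) - inf (range f).

Definition lambda_min n (X : 'M[R]_n) : R := inf [set a | eigenvalue X a].

Definition simplex (T : finType) (p : T -> R) : Prop :=
  (forall x, 0 <= p x) /\ \sum_x p x = 1.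

(* [0 * ln (0 / y) = 0], as usual.  If [p' x = 0 < p x] the true value is
   [+oo] while the formula returns a real; it is only used below with a
   strictly positive second argument. *)
Definition kl (T : finType) (p p' : T -> R) : R :=
  \sum_x p x * ln (p x / p' x).

Definition natceil (x : R) : nat := `|Num.ceil x|%N.

End FiniteVectors.

(** * Finitely supported random variables

   The state and action spaces are finite, so the law of everything observed
   up to a given iteration is finitely supported.  A random variable is a
   list of (weight, value) pairs, built by successive conditional draws. *)

Section FiniteLaws.
Variables (R : realType).

Definition law (X : Type) : Type := seq (R * X).

Definition ret (X : Type) (x : X) : law X := [:: (1, x)].

Definition bind (X Y : Type) (m : law X) (k : X -> law Y) : law Y :=
  flatten [seq [seq (w.1 * v.1, v.2) | v <- k w.2] | w <- m].

Definition draw (T : finType) (p : T -> R) : law T :=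
  [seq (p x, x) | x <- enum T].

Definition expect (X : Type) (m : law X) (f : X -> R) : R :=
  \sum_(w <- m) w.1 * f w.2.

Definition almost_surely (X : Type) (m : law X) (Q : X -> Prop) : Prop :=
  List.Forall (fun w => 0 < w.1 -> Q w.2) m.

End FiniteLaws.

Notation "x <~ m ;; k" := (bind m (fun x => k))
  (at level 100, m at next level, right associativity).

(** * Average-reward MDP *)

(* [reg M s p] is the value of the regularizer at state [s] for a policy
   whose action distribution at [s] is [p]. *)
Record amdp (R : realType) (S A : finType) := Amdp {
  trans : S -> A -> S -> R;
  cost : S -> A -> R;
  reg : S -> (A -> R) -> R
}.

Section AMDP.
Variables (R : realType) (S A : finType) (M : amdp R S A).
Implicit Types (pi : S -> A -> R) (f : S * A -> R).

Definition is_amdp : Prop := forall s a, simplex (trans M s a).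

Definition is_policy pi : Prop := forall s, simplex (pi s).

Definition uniform_policy : S -> A -> R := fun _ _ => #|A|%:R^-1.

Definition state_mx pi : 'M[R]_#|S| :=
  mx_of (fun s s' => \sum_a pi s a * trans M s a s').

Definition pair_mx pi : 'M[R]_#|{: S * A}| :=
  mx_of (fun z z' => trans M z.1 z.2 z'.1 * pi z'.1 z'.2).

Definition irreducible pi : Prop :=
  forall i j, exists t, 0 < (state_mx pi ^+ t) i j.

Definition aperiodic pi : Prop :=
  forall i (m : nat),
    (forall t, (0 < t)%N -> 0 < (state_mx pi ^+ t) i i -> (m %| t)%N) ->
    m = 1%N.

Definition is_stationary pi (nu : S -> R) : Prop :=
  simplex nu /\ (state_mx pi)^T *m vec_of nu = vec_of nu.

(* Uniquely determined when the chain is irreducible. *)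
Definition stationary pi : S -> R := xget (fun=> 0) [set nu | is_stationary pi nu].

(* The uniform geometric rate is a consequence of the pointwise conditions
   (by compactness of the set of policies); it is recorded for convenience. *)
Definition ergodic : Prop :=
  (forall pi, is_policy pi ->
     [/\ irreducible pi, aperiodic pi, is_stationary pi (stationary pi)
       & forall s, 0 < stationary pi s]) /\
  (exists C_P varrho : R, [/\ 0 < C_P, 0 < varrho, varrho < 1
     & forall pi t, is_policy pi -> (1 <= t)%N -> forall i,
         \sum_j `|(state_mx pi ^+ t) i j - vec_of (stationary pi) j 0|
           <= C_P * varrho ^+ t]).

(* A least element in [nat], computed as an infimum in [R]. *)
Definition mixing_time_of pi : R :=
  inf [set t%:R | t in [set t : nat | (1 <= t)%N /\
    forall q : S -> R, simplex q ->
      l1norm ((state_mx pi ^+ t)^T *m vec_of q - vec_of (stationary pi))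
        <= 2^-1]].

Definition t_mix : R := sup [set mixing_time_of pi | pi in is_policy].

Definition stage_cost pi (z : S * A) : R := cost M z.1 z.2 + reg M z.1 (pi z.1).

Definition rho pi : R :=
  \sum_s stationary pi s * (\sum_a pi s a * cost M s a + reg M s (pi s)).

(* [((P^pi)^t (c + h^pi - rho 1)) (z)] is the expected relative cost at time
   [t] for the trajectory started at the state-action pair [z]. *)
Definition Qbar pi (z : S * A) : R :=
  limn (series (fun t : nat =>
    coord (pair_mx pi ^+ t *m vec_of (fun y => stage_cost pi y - rho pi)) z)).

(* Closedness is lower semicontinuity of the extension by [+oo] outside the
   simplex. *)
Definition closed_convex (h : (A -> R) -> R) : Prop :=
  (forall p p' (t : R), simplex p -> simplex p' -> 0 <= t -> t <= 1 ->
     h (fun a => t * p a + (1 - t) * p' a) <= t * h p + (1 - t) * h p') /\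
  @lower_semicontinuous {ptws A -> R} R
    (fun p : A -> R => if `[< simplex p >] then (h p)%:E else +oo%E).

(* The slope [g] is the (sub)gradient [\nabla h^{pi'}(s, .)].  It is required
   at the strictly positive [p'] only: elsewhere the divergence may be [+oo]
   and, as for the entropy, no finite slope need exist. *)
Definition strongly_convex (omega : R) (h : (A -> R) -> R) : Prop :=
  forall p' : A -> R, simplex p' -> (forall a, 0 < p' a) ->
  exists g : A -> R, forall p, simplex p ->
    omega * kl p p' <= h p - (h p' + \sum_a g a * (p a - p' a)).

Definition is_regularizer (omega : R) : Prop :=
  forall s, closed_convex (reg M s) /\ strongly_convex omega (reg M s).

Definition cost_bounded (cbar : R) : Prop :=
  forall s a p, simplex p -> `|cost M s a + reg M s p| <= cbar.

Definition optimal pistar : Prop :=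
  is_policy pistar /\ forall pi, is_policy pi -> rho pistar <= rho pi.

(* [D(pi, pi')]; the state weights are stationary for [pistar]. *)
Definition divergence pistar pi pi' : R :=
  \sum_s stationary pistar s * kl (pi' s) (pi s).

Definition min_stationary pi : R := \big[Num.min/1]_s stationary pi s.

(** ** Features and perturbed quantities *)

Variables (d : nat) (Psi : 'M[R]_(#|{: S * A}|, d)) (u : R).

Definition psi (z : S * A) : 'cV[R]_d := (row (enum_rank z) Psi)^T.

Definition features_ok : Prop :=
  [/\ (0 < d)%N, \rank Psi = d, forall z, l2norm (psi z) <= 1
    & forall pi, is_policy pi -> forall theta : 'cV[R]_d,
        ~ (forall s a, 0 < pi s a -> coord (Psi *m theta) (s, a) = 1)].

Definition pair_diag pi : 'M[R]_#|{: S * A}| :=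
  diag_of (fun z => stationary pi z.1 * pi z.1 z.2).

(* [1 - beta] *)
Definition beta_gap pi : R :=
  inf [set (x^T *m pair_diag pi *m (1%:M - pair_mx pi) *m x) 0 0 | x in
    [set x : 'cV[R]_#|{: S * A}| | (exists theta : 'cV[R]_d, x = Psi *m theta) /\
             (x^T *m pair_diag pi *m x) 0 0 = 1]].

Definition kept pi s : {set A} := [set a | u / 2 < pi s a]%SET.

(* [min_s |A_s|] *)
Definition min_kept pi : nat := \big[minn/#|A|]_s #|kept pi s|.

Definition perturbed pi : S -> A -> R := fun s a =>
  if a \in kept pi s
  then pi s a * (1 - (#|A| - #|kept pi s|)%:R * u) / \sum_(b in kept pi s) pi s b
  else u.

Definition alpha pi : R := 1 - (#|A| - min_kept pi)%:R * u.

Definition floor_ok : Prop :=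
  [/\ 0 < u, u < 1 & forall pi, is_policy pi -> min_kept pi <> #|A| ->
    u <= beta_gap pi * min_stationary pi /
         ((#|A| - min_kept pi)%:R * (8 + beta_gap pi * min_stationary pi))].

Definition perturbed_diag pi : 'M[R]_#|{: S * A}| :=
  diag_of (fun z => stationary pi z.1 * perturbed pi z.1 z.2).

(* [1 - \widetilde\beta] *)
Definition tbeta_gap pi : R :=
  Num.min (27 * alpha pi * beta_gap pi / 32) ((1 - alpha pi * beta_gap pi) / 8).

Definition mu pi : R := lambda_min (Psi^T *m perturbed_diag pi *m Psi).

Definition projected_solution pi (theta : 'cV[R]_d) : Prop :=
  Psi^T *m perturbed_diag pi *m Psi *m theta =
  Psi^T *m perturbed_diag pi *m pair_mx pi *m Psi *m theta +
  Psi^T *m perturbed_diag pi *m vec_of (fun z => stage_cost pi z - rho pi).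

Definition eps_approx : R :=
  sup [set e | exists pi theta, [/\ is_policy pi, projected_solution pi theta
    & e = spnorm (fun z => coord (Psi *m theta) z - Qbar pi z)]].

Definition min_lambda_perturbed : R :=
  inf [set lambda_min (perturbed_diag pi) | pi in is_policy].

(** ** EVRTD along a single trajectory *)

(* Current state, action already selected there, and number of transitions
   observed so far. *)
Definition position : Type := (S * A * nat)%type.

Definition step pi (x : position) : law R position :=
  s' <~ draw (trans M x.1.1 x.1.2) ;;
  a' <~ draw (pi s') ;;
  ret R (s', a', x.2.+1).

Fixpoint walk pi (n : nat) (x : position) : law R position :=
  if n is m.+1 then y <~ step pi x ;; walk pi m y else ret R x.

Fixpoint cost_sum pi (tau n : nat) (x : position) : law R (R * position) :=
  if n is m.+1 then
    y <~ walk pi tau.+1 x ;;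
    r <~ cost_sum pi tau m y ;;
    ret R (stage_cost pi y.1 + r.1, r.2)
  else ret R (0, x).

(* After [tau] transitions the pending action is replaced by a draw from the
   perturbed policy. *)
Definition sample pi (tau : nat) (x : position) :
    law R ((S * A) * (S * A) * position) :=
  y <~ walk pi tau x ;;
  a <~ draw (perturbed pi y.1.1) ;;
  z <~ step pi (y.1.1, a, y.2) ;;
  ret R ((y.1.1, a), z.1, z).

Definition td_op pi (theta : 'cV[R]_d) (r : R) (xi : (S * A) * (S * A)) : 'cV[R]_d :=
  (((psi xi.1 - psi xi.2)^T *m theta) 0 0 - stage_cost pi xi.1 + r) *: psi xi.1.

Fixpoint td_sum pi (tau : nat) (theta : 'cV[R]_d) (r : R) (n : nat) (x : position) :
    law R ('cV[R]_d * position) :=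
  if n is m.+1 then
    z <~ sample pi tau x ;;
    g <~ td_sum pi tau theta r m z.2 ;;
    ret R (td_op pi theta r z.1 + g.1, g.2)
  else ret R (0, x).

(* Sum of the [n] successive iterates starting with [theta]. *)
Fixpoint td_iterates pi (tau : nat) (eta r : R) (ttheta ghat : 'cV[R]_d) (n : nat)
    (theta : 'cV[R]_d) (x : position) : law R ('cV[R]_d * position) :=
  if n is m.+1 then
    z <~ sample pi tau x ;;
    y <~ td_iterates pi tau eta r ttheta ghat m
           (theta - eta *: (td_op pi theta r z.1 - td_op pi ttheta r z.1 + ghat))
           z.2 ;;
    ret R (theta + y.1, y.2)
  else ret R (0, x).

Record evrtd_params := EvrtdParams {
  p_eta : R;
  p_T : nat;
  p_N : nat;
  p_N' : nat;
  p_tau : nat;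
  p_tau' : nat;
  p_epochs : nat
}.

Definition epoch pi (prm : evrtd_params) (ttheta : 'cV[R]_d) (x : position) :
    law R ('cV[R]_d * position) :=
  y <~ cost_sum pi (p_tau' prm) (p_N' prm) x ;;
  let r := y.1 / (p_N' prm)%:R in
  g <~ td_sum pi (p_tau' prm) ttheta r (p_N prm) y.2 ;;
  z <~ td_iterates pi (p_tau prm) (p_eta prm) r ttheta ((p_N prm)%:R^-1 *: g.1)
         (p_T prm) ttheta g.2 ;;
  ret R ((p_T prm)%:R^-1 *: z.1, z.2).

Fixpoint epochs pi (prm : evrtd_params) (n : nat) (theta : 'cV[R]_d) (x : position) :
    law R ('cV[R]_d * position) :=
  if n is m.+1 then y <~ epoch pi prm theta x ;; epochs pi prm m y.1 y.2
  else ret R (theta, x).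

Definition evrtd pi (prm : evrtd_params) (theta0 : 'cV[R]_d) (x : position) :
    law R ('cV[R]_d * position) :=
  epochs pi prm (p_epochs prm) theta0 x.

(* Mean-square span error of the estimator, conditionally on the past; the
   past enters only through the policy and the current position. *)
Definition evrtd_mse pi (prm : evrtd_params) (theta0 : 'cV[R]_d) (x : position) : R :=
  expect (evrtd pi prm theta0 x)
    (fun y => spnorm (fun z => coord (Psi *m y.1) z - Qbar pi z) ^+ 2).

(** ** SPMD *)

Definition prox (lambda : R) pi f : S -> A -> R := fun s =>
  let obj p := lambda * (\sum_a f (s, a) * p a + reg M s p) + kl p (pi s) in
  xget (pi s) [set p | simplex p /\ forall p', simplex p' -> obj p <= obj p'].

(* Law of [pi_k] and of the position on the trajectory before iteration [k].
   [par pi] are the parameters with which policy [pi] is evaluated. *)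
Fixpoint spmd (lambda : R) (par : (S -> A -> R) -> evrtd_params)
    (theta0 : 'cV[R]_d) (x0 : S * A) (k : nat) : law R ((S -> A -> R) * position) :=
  if k is l.+1 then
    z <~ spmd lambda par theta0 x0 l ;;
    y <~ evrtd z.1 (par z.1) theta0 z.2 ;;
    ret R (prox lambda z.1 (coord (Psi *m y.1)), y.2)
  else ret R (uniform_policy, (x0, 0%N)).

(* [sigma^2] times the argument of the logarithm in the stepsize. *)
Definition initial_gap (omega Gamma : R) pistar : R :=
  8 * Gamma * (1 - Gamma) * omega ^+ 2
    * divergence pistar uniform_policy pistar
  + 8 * Gamma * (1 - Gamma) * omega * (rho uniform_policy - rho pistar).

Definition stepsize (omega Gamma sigma : R) pistar (K : nat) : R :=
  let q := 2 * (1 + ln (initial_gap omega Gamma pistar / sigma ^+ 2)) in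
  Num.min ((1 - Gamma) / (omega * Gamma)) (q * ln K%:R / (omega * K%:R)).

(** ** Logarithmic factors and EVRTD parameters *)

Definition problem_size (kappa cbar omega Gamma mubar eps : R) (theta0 : 'cV[R]_d) : R :=
  #|{: S * A}|%:R + t_mix + kappa + cbar + omega + omega^-1 + (1 - Gamma)^-1
  + mubar^-1 + min_lambda_perturbed^-1 + eps_approx + l2norm theta0 + eps^-1.

End AMDP.

(* The universal constants behind the orders of magnitude of the EVRTD
   parameters. *)
Record evrtd_consts (R : realType) := EvrtdConsts {
  c_eta : R;
  c_T : R;
  c_N : R;
  c_N' : R;
  c_tau : R;
  c_tau' : R;
  c_epochs : R
}.

Definition consts_pos (R : realType) (k : evrtd_consts R) : Prop :=
  [/\ 0 < c_eta k, 0 < c_T k, 0 < c_N k & 0 < c_N' k] /\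
  [/\ 0 < c_tau k, 0 < c_tau' k & 0 < c_epochs k].

(* [L] stands for the logarithmic factor in [1/eps] and the problem data. *)
Definition evrtd_choice (R : realType) (S A : finType) (M : amdp R S A) (d : nat)
    (Psi : 'M[R]_(#|{: S * A}|, d)) (u : R) (k : evrtd_consts R) (L : R)
    (pi : S -> A -> R) : evrtd_params R :=
  let b := tbeta_gap M Psi u pi in
  let m := mu M Psi u pi in
  let eta := c_eta k * b in
  EvrtdParams eta
    (natceil (c_T k / (m * b * eta)))
    (natceil (c_N k / (m * b ^+ 2)))
    (natceil (c_N' k / (m * b ^+ 2)))
    (natceil (c_tau k * (t_mix M * L)))
    (natceil (c_tau' k * (t_mix M * L)))
    (natceil (c_epochs k * L)).

(* Main.v *)
Require Import Defs.
From mathcomp Require Import ring lra.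
Set Implicit Arguments.
Unset Strict Implicit.
Unset Printing Implicit Defensive.
Local Open Scope classical_set_scope.
Local Open Scope ring_scope.

(* The perturbed policy moves little mass, so the temporal-difference operator keeps the
   coercivity of the unperturbed one up to a constant; variance reduction then makes
   each EVRTD epoch halve the mean-square error up to the noise of the [N + N'] samples
   of its first phase, while the bias contracts geometrically by itself.

   For SPMD, the three-point inequality of the proximal step, averaged over the
   stationary law of [pistar] and combined with the performance difference identity,
   shows that
   [Phi = D + lambda (R - 1) (rho - rho pistar)] satisfies
   [(1 + lambda omega) E Phi' <= Phi + R lambda^2 sigma^2 + lambda (bias)], where
   [R = Gamma / (1 - Gamma)] bounds the ratio of two stationary laws.
   The noise thus contributes [R lambda sigma^2 / omega], the bias of the estimator
   contributes [eps_approx / omega], and with [lambda omega = q ln K / K] the initial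
   potential is divided by [(1 + lambda omega)^K >= K^(q / 2)]. *)

(** * Finite laws and inner products *)

(** The samples come from one trajectory that is never stationary, so they are dependent. Every
    estimate on a stretch of the trajectory is therefore stated for an arbitrary starting position
    and proved by induction on the stretch, each draw being compared with the stationary tuple at a
    cost [delta]. The walks between samples are long enough for [delta] to be a high inverse power
    of the problem size, which outweighs every polynomial factor met later. The obstacle that shapes
    the analysis of EVRTD is the bias. A mean-square bound alone would control it by [sigma] only,
    and an error of order [sigma / omega] does not vanish. The error of the estimator enters an SPMD
    step twice. Paired with the move from the current to the next policy, on which it has an
    influence, it is absorbed through Pinsker's inequality by the divergence of the proximal step
    and leaves a term in [lambda ^+ 2]. Paired with [pistar] minus the current policy, which the
    past determines, it counts only through its conditional mean. Hence each epoch is analysed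
    twice, in mean square and in mean. *)

Section Laws.
Variables (R : realType).

(** [Q] is asked of all entries, also those of weight 0, so that it passes through [bind] by plain
    induction; it implies the almost sure statement. *)
Definition law_on (X : Type) (Q : X -> Prop) (m : law R X) : Prop :=
  List.Forall (fun w => 0 <= w.1 /\ Q w.2) m /\ \sum_(w <- m) w.1 = 1.

Lemma sum_flatten_map (X Y : Type) (F : X -> seq Y) (f : Y -> R) (s : seq X) :
  \sum_(y <- flatten [seq F x | x <- s]) f y = \sum_(x <- s) \sum_(y <- F x) f y.
Proof.
by elim: s => [|x s IH] /=; rewrite ?big_nil// big_cat big_cons IH.
Qed.

Lemma expect_bind (X Y : Type) (m : law R X) (k : X -> law R Y) (f : Y -> R) :
  expect (bind m k) f = expect m (fun x => expect (k x) f).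
Proof.
rewrite /expect /bind sum_flatten_map; apply: eq_bigr => w _.
by rewrite big_map mulr_sumr; apply: eq_bigr => v _; rewrite mulrA.
Qed.

Lemma expect_ret (X : Type) (x : X) (f : X -> R) : expect (ret R x) f = f x.
Proof. by rewrite /expect /ret big_seq1 mul1r. Qed.

Lemma expect_draw (T : finType) (p : T -> R) (f : T -> R) :
  expect (draw p) f = \sum_x p x * f x.
Proof. by rewrite /expect /draw big_map big_enum. Qed.

Lemma expectD (X : Type) (m : law R X) (f g : X -> R) :
  expect m (fun x => f x + g x) = expect m f + expect m g.
Proof.
by rewrite /expect -big_split; apply: eq_bigr => w _; rewrite mulrDr.
Qed.

Lemma expectZ (X : Type) (m : law R X) c (f : X -> R) :
  expect m (fun x => c * f x) = c * expect m f.
Proof.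
by rewrite /expect mulr_sumr; apply: eq_bigr => w _; rewrite mulrCA.
Qed.

Lemma expectN (X : Type) (m : law R X) (f : X -> R) :
  expect m (fun x => - f x) = - expect m f.
Proof. by rewrite /expect -sumrN; apply: eq_bigr => w _; rewrite mulrN. Qed.

Lemma expectB (X : Type) (m : law R X) (f g : X -> R) :
  expect m (fun x => f x - g x) = expect m f - expect m g.
Proof. by rewrite expectD expectN. Qed.

Lemma eq_expect (X : Type) (m : law R X) (f g : X -> R) :
  f =1 g -> expect m f = expect m g.
Proof. by move=> fg; apply: eq_bigr => w _; rewrite fg. Qed.

Lemma expect_cst (X : Type) Q (m : law R X) (c : R) :
  law_on Q m -> expect m (fun=> c) = c.
Proof. by case=> _ h; rewrite /expect -mulr_suml h mul1r. Qed.

(** Combines a structural predicate with one known on entries of positive weight only, the form in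
    which the mean-square error hypothesis is given. *)
Lemma expect_le_as (X : Type) Q Q' (m : law R X) (f g : X -> R) :
  law_on Q m -> almost_surely m Q' ->
  (forall x, Q x -> Q' x -> f x <= g x) -> expect m f <= expect m g.
Proof.
case=> h _ h' fg; rewrite /expect.
elim: m h h' => [|w m IH] h h'; first by rewrite !big_nil.
inversion h as [|? ? [w0 qw] hm]; inversion h' as [|? ? qw' hm']; subst.
rewrite !big_cons lerD ?IH//.
move: w0; rewrite le_eqVlt => /orP[/eqP <-|w0]; first by rewrite !mul0r.
by rewrite ler_pM2l//; apply: fg => //; exact: qw'.
Qed.

Lemma expect_le (X : Type) Q (m : law R X) (f g : X -> R) :
  law_on Q m -> (forall x, Q x -> f x <= g x) -> expect m f <= expect m g.
Proof.
move=> hm fg; apply: (@expect_le_as _ Q (fun=> True) _ _ _ hm) => [|x qx _].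
  by apply/List.Forall_forall.
exact: fg.
Qed.

Lemma expect_le_cst (X : Type) Q (m : law R X) (f : X -> R) c :
  law_on Q m -> (forall x, Q x -> f x <= c) -> expect m f <= c.
Proof. by move=> hm fc; rewrite -[leRHS](expect_cst c hm); apply: expect_le hm _. Qed.

Lemma expect_ge0 (X : Type) Q (m : law R X) (f : X -> R) :
  law_on Q m -> (forall x, Q x -> 0 <= f x) -> 0 <= expect m f.
Proof. by move=> hm fc; rewrite -(expect_cst 0 hm); apply: expect_le hm _. Qed.

Lemma eq_expect_on (X : Type) Q (m : law R X) (f g : X -> R) :
  law_on Q m -> (forall x, Q x -> f x = g x) -> expect m f = expect m g.
Proof.
move=> hm fg; apply/eqP; rewrite eq_le; apply/andP; split;
  by apply: expect_le hm _ => x qx; rewrite fg.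
Qed.

Lemma ler_norm_expect (X : Type) Q (m : law R X) (f g : X -> R) :
  law_on Q m -> (forall x, Q x -> `|f x| <= g x) -> `|expect m f| <= expect m g.
Proof.
move=> hm fg; rewrite ler_norml; apply/andP; split.
  rewrite -expectN; apply: expect_le hm _ => x qx.
  by have := fg x qx; rewrite ler_norml => /andP[].
by apply: expect_le hm _ => x qx; apply: le_trans (fg x qx); exact: ler_norm.
Qed.

Lemma ler_norm_expect_cst (X : Type) Q (m : law R X) (f : X -> R) c :
  law_on Q m -> (forall x, Q x -> `|f x| <= c) -> `|expect m f| <= c.
Proof.
by move=> hm fc; rewrite -[leRHS](expect_cst c hm); exact: ler_norm_expect hm _.
Qed.

Lemma law_onW (X : Type) (Q Q' : X -> Prop) (m : law R X) :
  (forall x, Q x -> Q' x) -> law_on Q m -> law_on Q' m.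
Proof.
move=> QQ [h s]; split=> //; apply: List.Forall_impl h => w [? ?]; split=> //.
exact: QQ.
Qed.

Lemma law_on_ret (X : Type) (Q : X -> Prop) x : Q x -> law_on Q (ret R x).
Proof.
move=> qx; split; first by constructor; [split=> //=; rewrite ler01|constructor].
by rewrite /ret big_seq1.
Qed.

Lemma law_on_bind (X Y : Type) (Q : X -> Prop) (Q' : Y -> Prop) (m : law R X)
    (k : X -> law R Y) :
  law_on Q m -> (forall x, Q x -> law_on Q' (k x)) -> law_on Q' (bind m k).
Proof.
move=> hm hk; split; last first.
  have /(eq_trans _): expect (bind m k) (fun=> 1) = 1.
    rewrite expect_bind (@eq_expect_on _ Q _ _ (fun=> 1) hm) ?(expect_cst _ hm)//.
    by move=> x /hk /expect_cst.
  by apply; apply: eq_bigr => w _; rewrite mulr1.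
case: hm => h _; rewrite /bind.
elim: m h => [|w m IH] h /=; first by constructor.
inversion h as [|? ? [w0 qw] hm]; subst.
apply/List.Forall_app; split; last exact: IH.
case: (hk _ qw) => hkw _; elim: (k w.2) hkw => [|v l IHl] hl /=; first by constructor.
inversion hl as [|? ? [v0 qv] hl']; subst.
by constructor; [split=> //=; exact: mulr_ge0|exact: IHl].
Qed.

Lemma law_on_draw (T : finType) (p : T -> R) :
  simplex p -> law_on (fun=> True) (draw p).
Proof.
case=> p0 p1; split; last by rewrite /draw big_map big_enum.
by rewrite /draw; elim: (enum T) => [|x l IH] /=; constructor=> //; split=> /=.
Qed.

Lemma almost_surely_law_on (X : Type) (Q : X -> Prop) (m : law R X) :
  law_on Q m -> almost_surely m Q.
Proof. by case=> h _; apply: List.Forall_impl h => w []. Qed.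

End Laws.

(** * Euclidean inner product *)

Section Dot.
Variables (R : realType).

Definition dot n (u v : 'cV[R]_n) : R := \sum_i u i 0 * v i 0.

Section DotTheory.
Variable n : nat.
Implicit Types u v w : 'cV[R]_n.

Lemma dotE u v : dot u v = (u^T *m v) 0 0.
Proof. by rewrite mxE; apply: eq_bigr => i _; rewrite mxE. Qed.

Lemma dotC u v : dot u v = dot v u.
Proof. by apply: eq_bigr => i _; rewrite mulrC. Qed.

Lemma dotDl u v w : dot (u + v) w = dot u w + dot v w.
Proof. by rewrite -big_split; apply: eq_bigr => i _; rewrite mxE mulrDl. Qed.

Lemma dotDr u v w : dot w (u + v) = dot w u + dot w v.
Proof. by rewrite !(dotC w) dotDl. Qed.

Lemma dotZl a u w : dot (a *: u) w = a * dot u w.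
Proof. by rewrite mulr_sumr; apply: eq_bigr => i _; rewrite mxE mulrA. Qed.

Lemma dotZr a u w : dot w (a *: u) = a * dot w u.
Proof. by rewrite !(dotC w) dotZl. Qed.

Lemma dotNl u w : dot (- u) w = - dot u w.
Proof. by rewrite -scaleN1r dotZl mulN1r. Qed.

Lemma dotNr u w : dot w (- u) = - dot w u.
Proof. by rewrite !(dotC w) dotNl. Qed.

Lemma dotBl u v w : dot (u - v) w = dot u w - dot v w.
Proof. by rewrite dotDl dotNl. Qed.

Lemma dotBr u v w : dot w (u - v) = dot w u - dot w v.
Proof. by rewrite dotDr dotNr. Qed.

Lemma dot0l w : dot 0 w = 0.
Proof. by rewrite -(scale0r w) dotZl mul0r. Qed.

Lemma dot0r w : dot w 0 = 0.
Proof. by rewrite dotC dot0l. Qed.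

Lemma dot_ge0 u : 0 <= dot u u.
Proof. by apply: sumr_ge0 => i _; rewrite -expr2 sqr_ge0. Qed.

Lemma dot_eq0 u : dot u u = 0 -> u = 0.
Proof.
move=> /eqP; rewrite psumr_eq0; last by move=> i _; rewrite -expr2 sqr_ge0.
move=> /allP h; apply/colP => i; rewrite mxE; apply/eqP.
by have := h i (mem_index_enum _); rewrite -expr2 expf_eq0.
Qed.

Lemma l2normE u : l2norm u = Num.sqrt (dot u u).
Proof. by []. Qed.

Lemma l2norm_ge0 u : 0 <= l2norm u. Proof. exact: sqrtr_ge0. Qed.

Lemma sqr_l2norm u : l2norm u ^+ 2 = dot u u.
Proof. by rewrite sqr_sqrtr// dot_ge0. Qed.

Lemma dot_sqr_le u v : dot u v ^+ 2 <= dot u u * dot v v.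
Proof.
have [v0|v0] := eqVneq (dot v v) 0.
  by rewrite (dot_eq0 v0) !dot0r expr0n mulr0.
have vp : 0 < dot v v by rewrite lt_def v0 dot_ge0.
have := dot_ge0 (dot v v *: u - dot u v *: v).
rewrite dotBl !dotBr !dotZl !dotZr (dotC v u) => h.
have : 0 <= dot v v * (dot u u * dot v v - dot u v ^+ 2).
  by apply: le_trans h _; rewrite le_eqVlt; apply/orP; left; apply/eqP; ring.
by rewrite pmulr_rge0// subr_ge0.
Qed.

Lemma normr_dot_le u v : `|dot u v| <= l2norm u * l2norm v.
Proof.
rewrite -(@ler_pXn2r _ 2) ?nnegrE ?mulr_ge0 ?l2norm_ge0//.
by rewrite exprMn !sqr_l2norm real_normK ?num_real// dot_sqr_le.
Qed.

Lemma l2normD u v : l2norm (u + v) <= l2norm u + l2norm v.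
Proof.
rewrite -(@ler_pXn2r _ 2) ?nnegrE ?addr_ge0 ?l2norm_ge0//.
rewrite sqrrD !sqr_l2norm dotDl !dotDr (dotC v u).
have := normr_dot_le u v; rewrite ler_norml => /andP[_]; lra.
Qed.

Lemma l2normZ a u : l2norm (a *: u) = `|a| * l2norm u.
Proof. by rewrite !l2normE dotZl dotZr mulrA -expr2 sqrtrM ?sqr_ge0// sqrtr_sqr. Qed.

Lemma l2normN u : l2norm (- u) = l2norm u.
Proof. by rewrite -scaleN1r l2normZ normrN1 mul1r. Qed.

Lemma l2norm0 : l2norm (0 : 'cV[R]_n) = 0.
Proof. by rewrite l2normE dot0l sqrtr0. Qed.

Lemma dotD_le u v : dot (u + v) (u + v) <= 2 * dot u u + 2 * dot v v.
Proof.
have := dot_ge0 (u - v); rewrite !dotDl !dotDr !dotNl !dotNr (dotC v u); lra.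
Qed.

Lemma dotD3_le u v w :
  dot (u + v + w) (u + v + w) <= 3 * dot u u + 3 * dot v v + 3 * dot w w.
Proof.
have := dot_ge0 (u - v); have := dot_ge0 (v - w); have := dot_ge0 (u - w).
rewrite !dotDl !dotDr !dotNl !dotNr (dotC v u) (dotC w u) (dotC w v); lra.
Qed.

Lemma dot_young s u v : 0 < s -> 2 * `|dot u v| <= s * dot u u + dot v v / s.
Proof.
move=> s0; have h1 := dot_ge0 (s *: u - v); have h2 := dot_ge0 (s *: u + v).
have hs : s != 0 by rewrite gt_eqF.
have [h|h] := ger0P (dot u v).
  move: h1; rewrite dotBl !dotBr !dotZl !dotZr (dotC v u) => h1.
  rewrite -(ler_pM2l s0) mulrDr (mulrCA s (dot v v)) mulfV// mulr1; lra.
move: h2; rewrite dotDl !dotDr !dotZl !dotZr (dotC v u) => h2.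
rewrite -(ler_pM2l s0) mulrDr (mulrCA s (dot v v)) mulfV// mulr1; lra.
Qed.

End DotTheory.

Lemma dot_mulmx m n (X : 'M[R]_(m, n)) u v : dot u (X *m v) = dot (X^T *m u) v.
Proof. by rewrite !dotE trmx_mul trmxK mulmxA. Qed.

End Dot.

(** * Mixing and relative values *)

Section FiniteSums.
Variables (R : realType) (T : finType).

Lemma sum_enum_val (F : 'I_#|T| -> R) : \sum_i F i = \sum_x F (enum_rank x).
Proof. by rewrite (reindex enum_rank) //; apply: onW_bij; exact: enum_rank_bij. Qed.

Lemma coord_vec_of (f : T -> R) x : coord (vec_of f) x = f x.
Proof. by rewrite /coord mxE enum_rankK. Qed.

Lemma coord_mx_of (k : T -> T -> R) v x :
  coord (mx_of k *m v) x = \sum_y k x y * coord v y.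
Proof.
by rewrite /coord mxE sum_enum_val; apply: eq_bigr => y _; rewrite !mxE !enum_rankK.
Qed.

Lemma vec_ofK (v : 'cV[R]_#|T|) : vec_of (coord v) = v.
Proof. by apply/colP => i; rewrite mxE /coord enum_valK. Qed.

Lemma dot_coord (v w : 'cV[R]_#|T|) : dot v w = \sum_x coord v x * coord w x.
Proof. by rewrite /dot sum_enum_val. Qed.

Lemma coord_diag_of (k : T -> R) v x : coord (diag_of k *m v) x = k x * coord v x.
Proof. by rewrite /coord /diag_of mul_diag_mx !mxE enum_rankK. Qed.

Lemma norm_wsum_le (w f : T -> R) B :
  (forall x, 0 <= w x) -> (forall x, `|f x| <= B) ->
  `|\sum_x w x * f x| <= (\sum_x w x) * B.
Proof.
move=> w0 fB; apply: le_trans (ler_norm_sum _ _ _) _; rewrite mulr_suml.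
by apply: ler_sum => x _; rewrite normrM (ger0_norm (w0 x)) ler_wpM2l.
Qed.

Lemma simplex_wsum_le (w f : T -> R) B :
  simplex w -> (forall x, `|f x| <= B) -> `|\sum_x w x * f x| <= B.
Proof. by move=> [w0 w1] fB; have := norm_wsum_le w0 fB; rewrite w1 mul1r. Qed.

Lemma simplex_le1 (w : T -> R) x : simplex w -> w x <= 1.
Proof.
by move=> [w0 <-]; rewrite (bigD1 x)//= lerDl sumr_ge0.
Qed.

(** Jensen's inequality for the square: the gap is the variance of [f] under [w]. *)
Lemma simplex_wsum_sqr_le (w f : T -> R) :
  simplex w -> (\sum_x w x * f x) ^+ 2 <= \sum_x w x * f x ^+ 2.
Proof.
move=> [w0 w1]; set m := \sum_x _.
have : 0 <= \sum_x w x * (f x - m) ^+ 2.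
  by apply: sumr_ge0 => x _; rewrite mulr_ge0// sqr_ge0.
have -> : \sum_x w x * (f x - m) ^+ 2 =
    \sum_x w x * f x ^+ 2 - 2 * m * (\sum_x w x * f x) + m ^+ 2 * \sum_x w x.
  move: m => m; rewrite (mulr_sumr _ _ _ (2 * m)) (mulr_sumr _ _ _ (m ^+ 2)) -sumrB -big_split.
  by apply: eq_bigr => x _ /=; ring.
rewrite w1 -/m; lra.
Qed.

End FiniteSums.

(** * The state chain, the pair chain and their geometric mixing *)

Section Chain.
Variables (R : realType) (S A : finType) (M : amdp R S A) (pi : S -> A -> R).

Definition pair_op (f : S * A -> R) (z : S * A) : R :=
  \sum_s trans M z.1 z.2 s * \sum_a pi s a * f (s, a).

Definition state_op (g : S -> R) (s : S) : R :=
  \sum_s' (\sum_a pi s a * trans M s a s') * g s'.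

Definition action_avg (f : S * A -> R) (s : S) : R := \sum_a pi s a * f (s, a).

Definition state_avg (g : S -> R) : R := \sum_s stationary M pi s * g s.

Lemma coord_state_mx g t s :
  coord (state_mx M pi ^+ t *m vec_of g) s = iter t state_op g s.
Proof.
elim: t s => [|t IH] s /=; first by rewrite expr0 mul1mx coord_vec_of.
rewrite exprS -mulmxE -mulmxA coord_mx_of /state_op.
by apply: eq_bigr => s' _; rewrite IH.
Qed.

Lemma pair_opE f z : coord (pair_mx M pi *m vec_of f) z = pair_op f z.
Proof.
rewrite coord_mx_of (eq_bigr (fun y => (fun s a => trans M z.1 z.2 s * (pi s a * f (s, a))) y.1 y.2)).
  rewrite -(pair_bigA _ (fun s a => trans M z.1 z.2 s * (pi s a * f (s, a)))) /=.
  by apply: eq_bigr => s _; rewrite mulr_sumr.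
by case=> s a _; rewrite coord_vec_of mulrA.
Qed.

Lemma coord_pair_mx f t z :
  coord (pair_mx M pi ^+ t *m vec_of f) z = iter t pair_op f z.
Proof.
elim: t z => [|t IH] z /=; first by rewrite expr0 mul1mx coord_vec_of.
rewrite exprS -mulmxE -mulmxA -[X in _ *m X]vec_ofK pair_opE.
by apply: eq_bigr => s _; congr (_ * _); apply: eq_bigr => a _; rewrite IH.
Qed.

Lemma action_avg_pair_op f s : action_avg (pair_op f) s = state_op (action_avg f) s.
Proof.
rewrite /action_avg /pair_op /state_op.
under eq_bigr do rewrite mulr_sumr.
rewrite exchange_big /=; apply: eq_bigr => s' _.
by rewrite mulr_suml; apply: eq_bigr => a _; rewrite mulrA.
Qed.

Lemma iter_action_avg f t s :
  action_avg (iter t pair_op f) s = iter t state_op (action_avg f) s.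
Proof.
elim: t s => [//|t IH] s; rewrite !iterS action_avg_pair_op.
by apply: eq_bigr => s' _; rewrite IH.
Qed.

(** Averaging over actions intertwines [pair_op] and [state_op], so the pair chain is the state
    chain seen after one transition; this is why mixing reaches pairs one step later. *)
Lemma iter_pair_op f t z :
  iter t.+1 pair_op f z =
  \sum_s trans M z.1 z.2 s * iter t state_op (action_avg f) s.
Proof. by rewrite iterS; apply: eq_bigr => s _; rewrite -iter_action_avg. Qed.

Hypotheses (hM : is_amdp M) (hpi : is_policy pi)
  (hst : is_stationary M pi (stationary M pi)).

Local Notation nu := (stationary M pi).

Lemma state_opE g s : state_op g s = \sum_a pi s a * \sum_s' trans M s a s' * g s'.
Proof.
rewrite /state_op; under eq_bigr do rewrite mulr_suml.
rewrite exchange_big /=; apply: eq_bigr => a _; rewrite mulr_sumr.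
by apply: eq_bigr => s' _; rewrite mulrA.
Qed.

Lemma state_op_le g B s : (forall s', `|g s'| <= B) -> `|state_op g s| <= B.
Proof.
move=> gB; rewrite state_opE; apply: simplex_wsum_le => // a.
exact: simplex_wsum_le.
Qed.

Lemma iter_state_op_le g B t s :
  (forall s', `|g s'| <= B) -> `|iter t state_op g s| <= B.
Proof.
by move=> gB; elim: t s => [|t IH] s; rewrite ?iterS//; exact: state_op_le.
Qed.

Lemma action_avg_le f B s : (forall z, `|f z| <= B) -> `|action_avg f s| <= B.
Proof. by move=> fB; apply: simplex_wsum_le. Qed.

Lemma state_avg_le g B : (forall s, `|g s| <= B) -> `|state_avg g| <= B.
Proof. by move=> gB; apply: simplex_wsum_le => //; case: hst. Qed.

Lemma stationaryE s' :
  \sum_s nu s * (\sum_a pi s a * trans M s a s') = nu s'.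
Proof.
case: hst => _ /(congr1 (fun v => coord v s')).
rewrite coord_vec_of {1}/coord mxE sum_enum_val => <-.
by apply: eq_bigr => s _; rewrite !mxE !enum_rankK mulrC.
Qed.

Lemma state_avg_op g : state_avg (state_op g) = state_avg g.
Proof.
rewrite /state_avg /state_op; under eq_bigr do rewrite mulr_sumr.
rewrite exchange_big /=; apply: eq_bigr => s' _.
rewrite -stationaryE mulr_suml; apply: eq_bigr => s _; rewrite mulrA //.
Qed.

Lemma state_avg_iter g t : state_avg (iter t state_op g) = state_avg g.
Proof. by elim: t => [//|t IH]; rewrite iterS state_avg_op. Qed.

Variable t0 : nat.
Hypotheses (t0_gt0 : (1 <= t0)%N)
  (mix : forall q : S -> R, simplex q ->
    l1norm ((state_mx M pi ^+ t0)^T *m vec_of q - vec_of nu) <= 2^-1).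

(** The row of [s] in the power minus the stationary law is a signed measure of total mass 0 and l1
    norm at most one half. Mass 0 allows [g] to be recentred at any [c], so the oscillation, not the
    size, is halved. *)
Lemma half_contraction g c r s : (forall s', `|g s' - c| <= r) ->
  `|iter t0 state_op g s - state_avg g| <= r / 2.
Proof.
move=> gr; pose q s' : R := (s' == s)%:R.
have q1 : \sum_s' q s' = 1.
  by rewrite (bigD1 s)//= big1 ?addr0 /q ?eqxx// => s' /negbTE ->.
have hq : simplex q by split=> // s'; rewrite ler0n.
have := mix hq; set w := _ - _ => hw.
have r0 : 0 <= r by apply: le_trans (gr s); exact: normr_ge0.
have wE (h : S -> R) :
    \sum_s' coord w s' * h s' = iter t0 state_op h s - state_avg h.
  rewrite /w -(coord_state_mx h t0 s) /state_avg.
  transitivity (\sum_s' ((state_mx M pi ^+ t0) (enum_rank s) (enum_rank s') * h s'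
      - nu s' * h s')).
    apply: eq_bigr => s' _; rewrite -mulrBl; congr (_ * _).
    rewrite /coord [LHS]mxE [X in _ + X]mxE [X in _ - X]mxE enum_rankK; congr (_ - _).
    rewrite mxE sum_enum_val (bigD1 s)//= big1 ?addr0.
      by rewrite !mxE enum_rankK /q eqxx mulr1.
    by move=> i /negbTE ne; rewrite !mxE enum_rankK /q ne mulr0.
  rewrite sumrB; congr (_ - _); rewrite /coord mxE sum_enum_val.
  by apply: eq_bigr => s' _; rewrite !mxE enum_rankK.
have w0 : \sum_s' coord w s' = 0.
  transitivity (\sum_s' coord w s' * 1); first by apply: eq_bigr => ? _; rewrite mulr1.
  rewrite wE /state_avg; under eq_bigr do rewrite mulr1.
  case: hst => -[_ ->] _.
  suff -> : iter t0 state_op (fun=> 1) s = 1 by rewrite subrr.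
  have H : forall t s', iter t state_op (fun=> 1) s' = 1; last exact: H.
  elim=> [//|t IH] s'; rewrite iterS state_opE.
  under eq_bigr => a _.
    under eq_bigr do rewrite IH mulr1.
    case: (hM s' a) => _ ->; over.
  by rewrite -mulr_suml mulr1; case: (hpi s').
rewrite -wE.
have -> : \sum_s' coord w s' * g s' = \sum_s' coord w s' * (g s' - c).
  rewrite [RHS](eq_bigr (fun s' => coord w s' * g s' - coord w s' * c)).
    by rewrite sumrB -mulr_suml w0 mul0r subr0.
  by move=> s' _; rewrite mulrBr.
apply: le_trans (ler_norm_sum _ _ _) _.
apply: (@le_trans _ _ (\sum_s' `|coord w s'| * r)).
  by apply: ler_sum => s' _; rewrite normrM ler_wpM2l.
rewrite -mulr_suml [r / 2]mulrC; apply: ler_wpM2r => //.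
by move: hw; rewrite /l1norm sum_enum_val.
Qed.

(** The [n %% t0] leftover steps do not increase the norm; each block of [t0] steps then halves the
    distance to the average, which is invariant and at most [2 * B] away at the start. *)
Lemma state_mixing g B n s : (forall s', `|g s'| <= B) ->
  `|iter n state_op g s - state_avg g| <= 2 * B * 2^-1 ^+ (n %/ t0).
Proof.
move=> gB; rewrite {1}(divn_eq n t0) iterD.
set g' := iter (n %% t0) state_op g.
have g'B s' : `|g' s'| <= B by apply: iter_state_op_le.
have <- : state_avg g' = state_avg g by rewrite /g' state_avg_iter.
suff H : forall k s', `|iter (k * t0) state_op g' s' - state_avg g'|
    <= 2 * B * 2^-1 ^+ k by [].
elim=> [|k IH] s'.
  rewrite mul0n /= expr0 mulr1; apply: le_trans (ler_normB _ _) _.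
  have := g'B s'; have := state_avg_le g'B; lra.
rewrite mulSn iterD -(state_avg_iter g' (k * t0)).
apply: le_trans (half_contraction s' IH) _.
by rewrite exprS; lra.
Qed.

Lemma pair_mixing f B n z : (forall z', `|f z'| <= B) ->
  `|iter n.+1 pair_op f z - state_avg (action_avg f)| <= 2 * B * 2^-1 ^+ (n %/ t0).
Proof.
move=> fB; rewrite iter_pair_op.
set g := action_avg f; set c := state_avg g.
have -> : \sum_s trans M z.1 z.2 s * iter n state_op g s - c =
    \sum_s trans M z.1 z.2 s * (iter n state_op g s - c).
  rewrite [RHS](eq_bigr (fun s => trans M z.1 z.2 s * iter n state_op g s
    - trans M z.1 z.2 s * c)); last by move=> s _; rewrite mulrBr.
  by rewrite sumrB -mulr_suml; case: (hM z.1 z.2) => _ ->; rewrite mul1r.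
apply: simplex_wsum_le => // s; apply: state_mixing => s'; exact: action_avg_le.
Qed.

End Chain.

(** * The uniform mixing time *)

Section MixingTime.
Variables (R : realType) (S A : finType) (M : amdp R S A).
Hypotheses (hM : is_amdp M) (hE : ergodic M).

(** A step count common to all policies bounds the set whose supremum is [t_mix], so that the
    supremum dominates its elements. *)
Lemma uniform_mixing_step : exists2 T : nat, (1 <= T)%N &
  forall pi, is_policy pi -> forall q : S -> R, simplex q ->
    l1norm ((state_mx M pi ^+ T)^T *m vec_of q - vec_of (stationary M pi)) <= 2^-1.
Proof.
case: hE => _ [C [r [C0 r0 r1 h]]].
have rn : `|r| < 1 by rewrite ger0_norm// ltW.
have : exists N, C * r ^+ N.+1 <= 2^-1.
  have : (fun n => C * r ^+ n) @ \oo --> C * 0.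
    by apply: cvgMr; exact: cvg_expr.
  rewrite mulr0 => /cvgrPdist_le /(_ 2^-1); rewrite invr_gt0 ltr0n => /(_ isT) [N _ hN].
  exists N; have := hN N.+1 (leqnSn N); rewrite sub0r normrN /= ger0_norm//.
  by rewrite mulr_ge0 ?exprn_ge0// ltW.
case=> N hN; exists N.+1 => // pi hpi q [q0 q1].
set P := _ ^+ _; set nu := stationary M pi.
have e i : ((P^T *m vec_of q) - vec_of nu) i 0 =
    \sum_s q s * (P (enum_rank s) i - vec_of nu i 0).
  transitivity (\sum_s (q s * P (enum_rank s) i - q s * vec_of nu i 0)).
    rewrite sumrB -mulr_suml q1 mul1r [LHS]mxE; congr (_ + _).
      rewrite mxE sum_enum_val; apply: eq_bigr => s _.
      by rewrite !mxE enum_rankK mulrC.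
    by rewrite mxE.
  by apply: eq_bigr => s _; rewrite mulrBr.
apply: (@le_trans _ _ (\sum_s q s * \sum_i `|P (enum_rank s) i - vec_of nu i 0|)).
  rewrite /l1norm; under [leRHS]eq_bigr do rewrite mulr_sumr.
  rewrite exchange_big /=; apply: ler_sum => i _; rewrite e.
  apply: le_trans (ler_norm_sum _ _ _) _; apply: ler_sum => s _.
  by rewrite normrM (ger0_norm (q0 s)).
apply: (@le_trans _ _ (\sum_s q s * 2^-1)); last by rewrite -mulr_suml q1 mul1r.
apply: ler_sum => s _; rewrite ler_wpM2l//.
by have := h pi N.+1 hpi isT (enum_rank s) => hh; apply: le_trans hh _.
Qed.

(** The infimum of [mixing_time_of] runs over natural numbers and is attained at the least
    admissible time. *)
Lemma mixing_step (pi : S -> A -> R) : is_policy pi -> exists t0 : nat,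
  [/\ (1 <= t0)%N, t0%:R <= t_mix M & forall q : S -> R, simplex q ->
    l1norm ((state_mx M pi ^+ t0)^T *m vec_of q - vec_of (stationary M pi)) <= 2^-1].
Proof.
move=> hpi; have [T T1 hT] := uniform_mixing_step.
pose X pi : set nat := [set t : nat | (1 <= t)%N /\
    forall q : S -> R, simplex q ->
      l1norm ((state_mx M pi ^+ t)^T *m vec_of q - vec_of (stationary M pi))
        <= 2^-1].
have XT (pi' : S -> A -> R) : is_policy pi' -> X pi' T by move=> h; split=> //; exact: hT.
have ex : exists t, `[< X pi t >] by exists T; apply/asboolP; exact: XT.
case: (ex_minnP ex) => t0 /asboolP [t01 ht0] tmin.
exists t0; split=> //; apply: (@le_trans _ _ (mixing_time_of M pi)).
  apply: lb_le_inf; first by exists T%:R; exists T => //; exact: XT.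
  by move=> _ [t Xt <-]; rewrite ler_nat; apply: tmin; apply/asboolP.
apply: ub_le_sup; last by exists pi.
exists T%:R => _ [pi' hpi' <-]; apply: ge_inf; last by exists T => //; exact: XT.
by exists 0 => _ [t _ <-].
Qed.

Lemma t_mix_ge1 (pi : S -> A -> R) : is_policy pi -> 1 <= t_mix M.
Proof.
move=> /mixing_step [t0 [h1 h2 _]]; apply: le_trans h2.
by rewrite ler1n.
Qed.

End MixingTime.

(** * Relative value series and its Bellman equation *)

Section RelativeValue.
Variables (R : realType) (S A : finType) (M : amdp R S A) (pi : S -> A -> R).
Hypotheses (hM : is_amdp M) (hpi : is_policy pi)
  (hst : is_stationary M pi (stationary M pi)).
Variable t0 : nat.
Hypotheses (t0_gt0 : (1 <= t0)%N)
  (mix : forall q : S -> R, simplex q ->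
    l1norm ((state_mx M pi ^+ t0)^T *m vec_of q - vec_of (stationary M pi)) <= 2^-1).

Lemma sum_halving (N : nat) :
  \sum_(0 <= n < N) 2^-1 ^+ (n %/ t0) <= 2 * t0%:R :> R.
Proof.
(* This is in fact an equality: complete blocks of length [t0] plus the block just begun. The
   induction needs the sharp form. *)
suff : \sum_(0 <= n < N) 2^-1 ^+ (n %/ t0) <=
    2 * t0%:R - 2^-1 ^+ (N %/ t0) * (2 * t0%:R - (N %% t0)%:R) :> R.
  move=> h; apply: le_trans h _; rewrite gerBl mulr_ge0 ?exprn_ge0//.
  have : (N %% t0)%:R <= t0%:R :> R by rewrite ler_nat ltnW// ltn_mod.
  by have : 0 <= t0%:R :> R by []; lra.
elim: N => [|N IH]; first by rewrite big_geq// div0n mod0n expr0; lra.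
rewrite big_nat_recr//=; apply: le_trans (lerD IH (lexx _)) _.
rewrite divnS// modnS; case: ifP => [d|_] /=; last by rewrite add0n -natr1; lra.
rewrite add1n exprS.
have : (N %% t0).+1 = t0.
  have lt := ltn_pmod N t0_gt0; apply/eqP; rewrite eqn_leq lt /=.
  apply: dvdn_leq => //; move: d; rewrite {1}(divn_eq N t0) -addnS dvdn_addr//.
  exact: dvdn_mull.
move=> /(congr1 (fun n => n%:R : R)); rewrite -natr1 => e.
have -> : (N %% t0)%:R = t0%:R - 1 :> R by rewrite -e addrK.
lra.
Qed.

Variables (f : S * A -> R) (B : R).
Hypotheses (fB : forall z, `|f z| <= B)
  (f0 : state_avg M pi (action_avg pi f) = 0).

Let B0 (z : S * A) : 0 <= B.
Proof. exact: le_trans (normr_ge0 _) (fB z). Qed.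

Let a z n := iter n (pair_op M pi) f z.

(** The term of index 0 costs [B]. The later ones decay by halves over blocks of length [t0],
    because the average of [f] is 0, and sum to at most [2 * B * (2 * t0)]. *)
Lemma norm_series_le z N : \sum_(0 <= n < N) `|a z n| <= B + 4 * t0%:R * B.
Proof.
case: N => [|N].
  by rewrite big_geq// addr_ge0 ?mulr_ge0// ?(B0 z).
rewrite big_nat_recl//= lerD ?fB//.
apply: (@le_trans _ _ (2 * B * \sum_(0 <= n < N) 2^-1 ^+ (n %/ t0))).
  rewrite mulr_sumr; apply: ler_sum => n _.
  by have := pair_mixing hM hpi hst mix n z fB; rewrite f0 subr0.
have := sum_halving N; have := B0 z; set q := \sum_(_ <= _ < _) _; nra.
Qed.

Lemma is_cvg_relative z : cvgn (series (a z)).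
Proof.
apply: normed_cvg; apply: nondecreasing_is_cvgn.
  by apply: nondecreasing_series => n _ _ /=; exact: normr_ge0.
exists (B + 4 * t0%:R * B) => _ [N _ <-]; exact: norm_series_le.
Qed.

Lemma relative_le z : `|limn (series (a z))| <= B + 4 * t0%:R * B.
Proof.
rewrite ler_norml; apply/andP.
have h N : `|series (a z) N| <= B + 4 * t0%:R * B.
  exact: le_trans (ler_norm_sum _ _ _) (norm_series_le z N).
split.
  apply: limr_ge; first exact: is_cvg_relative.
  by near=> n; have := h n; rewrite ler_norml => /andP[].
apply: limr_le; first exact: is_cvg_relative.
by near=> n; have := h n; rewrite ler_norml => /andP[].
Unshelve. all: by end_near. Qed.

Lemma relative_bellman z :
  limn (series (a z)) = f z + pair_op M pi (fun y => limn (series (a y))) z.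
Proof.
apply: cvg_lim => //.
rewrite -(cvg_shiftn 1).
have -> : (fun n => series (a z) (n + 1)%N) =
    (fun n => f z + \sum_s trans M z.1 z.2 s * \sum_b pi s b * series (a (s, b)) n).
  apply/funext => n; rewrite addn1 /series /= big_nat_recl//=; congr (_ + _).
  rewrite /pair_op exchange_big /=; apply: eq_bigr => s _.
  rewrite -mulr_sumr; congr (_ * _); rewrite exchange_big /=.
  by apply: eq_bigr => b _; rewrite mulr_sumr.
apply: cvgD; first exact: cvg_cst.
apply: cvg_big; [exact: add_continuous|move=> s _].
apply: cvgMr.
apply: cvg_big; [exact: add_continuous|move=> b _].
apply: cvgMr; exact: is_cvg_relative.
Qed.

End RelativeValue.

(** * Action values and performance difference *)

Section Qbar.
Variables (R : realType) (S A : finType) (M : amdp R S A) (cbar : R).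
Hypotheses (hM : is_amdp M) (hE : ergodic M) (hc : cost_bounded M cbar).

Implicit Types pi : S -> A -> R.

Lemma stage_cost_le pi z : is_policy pi -> `|stage_cost M pi z| <= cbar.
Proof. by move=> hpi; apply: hc. Qed.

Lemma stationary_spec pi : is_policy pi -> is_stationary M pi (stationary M pi).
Proof. by move=> hpi; case: hE => /(_ pi hpi) []. Qed.

Lemma stationary_simplex pi : is_policy pi -> simplex (stationary M pi).
Proof. by move=> /stationary_spec []. Qed.

Lemma rhoE pi : is_policy pi ->
  rho M pi = state_avg M pi (action_avg pi (stage_cost M pi)).
Proof.
move=> hpi; apply: eq_bigr => s _; congr (_ * _).
rewrite /action_avg /stage_cost /=; under [RHS]eq_bigr do rewrite mulrDr.
by rewrite big_split /= -mulr_suml; case: (hpi s) => _ ->; rewrite mul1r.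
Qed.

Lemma rho_le pi : is_policy pi -> `|rho M pi| <= cbar.
Proof.
move=> hpi; rewrite rhoE//; apply: state_avg_le (stationary_spec hpi) _ _ _ => s.
by apply: action_avg_le => // z; exact: stage_cost_le.
Qed.

Definition rel_cost pi (z : S * A) : R := stage_cost M pi z - rho M pi.

Lemma rel_cost_le pi z : is_policy pi -> `|rel_cost pi z| <= 2 * cbar.
Proof.
move=> hpi; apply: le_trans (ler_normB _ _) _.
by have := stage_cost_le z hpi; have := rho_le hpi; lra.
Qed.

Lemma rel_cost_avg pi : is_policy pi ->
  state_avg M pi (action_avg pi (rel_cost pi)) = 0.
Proof.
move=> hpi; rewrite /rel_cost.
have e s : action_avg pi (fun z => stage_cost M pi z - rho M pi) s =
    action_avg pi (stage_cost M pi) s + - rho M pi.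
  rewrite /action_avg; under eq_bigr do rewrite mulrBr.
  by rewrite sumrB -mulr_suml; case: (hpi s) => _ ->; rewrite mul1r.
rewrite /state_avg; under eq_bigr do rewrite e mulrDr.
rewrite big_split /= -mulr_suml; case: (stationary_simplex hpi) => _ ->.
by rewrite mul1r rhoE// subrr.
Qed.

Lemma QbarE pi : Qbar M pi = fun z =>
  limn (series (fun n => iter n (pair_op M pi) (rel_cost pi) z)).
Proof.
apply/funext => z; rewrite /Qbar; congr (limn (series _)).
by apply/funext => n; rewrite coord_pair_mx.
Qed.

Lemma Qbar_bellman pi z : is_policy pi ->
  Qbar M pi z = rel_cost pi z + pair_op M pi (Qbar M pi) z.
Proof.
move=> hpi; have [t0 [h1 h2 h3]] := mixing_step hE hpi.
rewrite QbarE; apply: (relative_bellman hM hpi (stationary_spec hpi) h1 h3).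
  by move=> y; exact: rel_cost_le hpi.
exact: rel_cost_avg.
Qed.

(** [10 = 2 * (1 + 4)], from a relative cost of at most [2 * cbar] and [1 <= t_mix]. *)
Lemma Qbar_le pi z : is_policy pi -> `|Qbar M pi z| <= 10 * cbar * t_mix M.
Proof.
move=> hpi; have [t0 [h1 h2 h3]] := mixing_step hE hpi.
rewrite QbarE; apply: le_trans (relative_le hM hpi (stationary_spec hpi) h1 h3 _ _ _) _.
- by move=> y; exact: rel_cost_le hpi.
- exact: rel_cost_avg.
have c0 : 0 <= cbar by apply: le_trans (normr_ge0 _) (rho_le hpi).
have := t_mix_ge1 hE hpi; nra.
Qed.

(** The Bellman equation of [pi] is averaged over the stationary law and the actions of [pi']. By
    invariance of that law the next values average to the current ones, and only the difference of
    the action choices remains. *)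
Lemma performance_difference pi pi' : is_policy pi -> is_policy pi' ->
  rho M pi' - rho M pi = \sum_s stationary M pi' s *
    (\sum_a Qbar M pi (s, a) * (pi' s a - pi s a) + reg M s (pi' s) - reg M s (pi s)).
Proof.
move=> hpi hpi'; set V := action_avg pi (Qbar M pi).
set nu := stationary M pi'.
have pv : \sum_s nu s * \sum_a pi' s a * (pair_op M pi (Qbar M pi) (s, a)) =
    \sum_s nu s * V s.
  rewrite -/(state_avg M pi' V) -(state_avg_op (stationary_spec hpi') V).
  by apply: eq_bigr => s _; rewrite state_opE.
have e s : \sum_a Qbar M pi (s, a) * (pi' s a - pi s a) =
    \sum_a pi' s a * cost M s a + reg M s (pi s) - rho M pi
    + \sum_a pi' s a * pair_op M pi (Qbar M pi) (s, a) - V s.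
  rewrite /V /action_avg -(mul1r (reg M s (pi s))) -(mul1r (rho M pi)).
  case: (hpi' s) => _ <-; rewrite !mulr_suml -!big_split /= -sumrB -big_split -sumrB /=.
  apply: eq_bigr => a _; rewrite mulrBr (mulrC _ (pi s a)); congr (_ - _).
  rewrite {1}Qbar_bellman// /rel_cost /stage_cost /=; ring.
have e' s : nu s * (\sum_a Qbar M pi (s, a) * (pi' s a - pi s a)
      + reg M s (pi' s) - reg M s (pi s)) =
    nu s * (\sum_a pi' s a * cost M s a + reg M s (pi' s)) - nu s * rho M pi
    + (nu s * (\sum_a pi' s a * pair_op M pi (Qbar M pi) (s, a)) - nu s * V s).
  by rewrite e; ring.
under [RHS]eq_bigr do rewrite e'.
rewrite big_split /= !sumrB pv subrr addr0 -mulr_suml.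
by case: (stationary_simplex hpi') => _ ->; rewrite mul1r.
Qed.

End Qbar.

(** * Smallest eigenvalues *)

Section SmallestEigenvalue.
Variables (R : realType) (n : nat).
Implicit Types (X N : 'M[R]_n) (v w : 'cV[R]_n).

Lemma dot_mulmx_le X : exists2 k : R, 1 <= k &
  forall v, dot (X *m v) (X *m v) <= k * dot v v.
Proof.
exists (1 + \sum_i dot (row i X)^T (row i X)^T).
  by rewrite lerDl// sumr_ge0// => i _; exact: dot_ge0.
move=> v; apply: (@le_trans _ _ ((\sum_i dot (row i X)^T (row i X)^T) * dot v v)).
  rewrite {1}/dot mulr_suml; apply: ler_sum => i _.
  have -> : (X *m v) i 0 = dot (row i X)^T v.
    by rewrite mxE; apply: eq_bigr => j _; rewrite !mxE.
  by rewrite -expr2 dot_sqr_le.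
by rewrite ler_wpM2r ?dot_ge0// lerDr.
Qed.

(** Discriminant of the quadratic [t ^+ 2 * p + 2 * t * s + q], which is nonnegative. When [p = 0]
    it is affine, so its slope must vanish. *)
Lemma psd_cauchy N : N^T = N -> (forall v, 0 <= dot v (N *m v)) ->
  forall u v, dot u (N *m v) ^+ 2 <= dot u (N *m u) * dot v (N *m v).
Proof.
move=> sN pN u v; set p := dot u (N *m u); set q := dot v _; set s := dot u _.
have h t : 0 <= t ^+ 2 * p + 2 * t * s + q.
  have := pN (t *: u + v); rewrite mulmxDr -scalemxAr dotDl !dotDr !dotZl !dotZr.
  have -> : dot v (N *m u) = s by rewrite dot_mulmx sN dotC.
  rewrite -/p -/q -/s; lra.
have := pN u; rewrite -/p le_eqVlt => /orP[/eqP p0|p0].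
  have s0 : s = 0.
    (* At this [t] the affine function takes the value [-1]. *)
    apply/eqP; apply: contraT => sn; have := h (- (q + 1) / s / 2).
    rewrite -p0 mulr0 add0r.
    have -> : 2 * (- (q + 1) / s / 2) * s = - (q + 1) by field.
    lra.
  by rewrite s0 expr0n /= mulr_ge0 //; [rewrite -p0|exact: pN].
have pn : p != 0 by rewrite gt_eqF.
have := h (- s / p); have -> : (- s / p) ^+ 2 * p + 2 * (- s / p) * s + q =
    (p * q - s ^+ 2) / p by field.
by rewrite pmulr_lge0 ?invr_gt0// subr_ge0.
Qed.

(** Cauchy-Schwarz for the form [N], applied to [w = N *m v] and [v], bounds [dot w w] by a multiple
    of [dot v (N *m v)]; the inverse of [N] bounds [dot v v] by a multiple of [dot w w]. *)
Lemma psd_unit_coercive N : N^T = N -> (forall v, 0 <= dot v (N *m v)) ->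
  N \in unitmx -> exists2 c : R, 0 < c & forall v, c * dot v v <= dot v (N *m v).
Proof.
move=> sN pN uN; have [k k1 hk] := dot_mulmx_le N.
have [k' k'1 hk'] := dot_mulmx_le (invmx N).
have k0 : 0 < k by apply: lt_le_trans k1.
have k'0 : 0 < k' by apply: lt_le_trans k'1.
exists (k' * k)^-1 => [|v]; first by rewrite invr_gt0 mulr_gt0.
rewrite mulrC ler_pdivrMr ?mulr_gt0//.
set w := N *m v; have vw : v = invmx N *m w by rewrite mulKmx.
have h0 : dot v v <= k' * dot w w by rewrite {1 2}vw.
apply: le_trans h0 _.
rewrite mulrCA ler_pM2l// mulrC.
have := psd_cauchy sN pN w v; rewrite -/w => h.
have [w0|w0] := eqVneq (dot w w) 0.
  by rewrite w0 mulr_ge0// ?pN// ltW.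
have wp : 0 < dot w w by rewrite lt_def w0 dot_ge0.
rewrite -(ler_pM2l wp) -expr2; apply: le_trans h _.
rewrite mulrA; apply: ler_wpM2r; first exact: pN.
rewrite mulrC -ler_sqr ?nnegrE; first last.
- by rewrite mulr_ge0 ?dot_ge0// ltW.
- exact: pN.
apply: le_trans (dot_sqr_le _ _) _; have := hk w => hw.
apply: le_trans (ler_wpM2l (ltW wp) hw) _.
rewrite exprMn mulrCA -expr2 ler_wpM2r ?sqr_ge0// expr2 ler_peMr// ltW//.
Qed.

Lemma psd_eigenvalue_ge0 X a : (forall v, 0 <= dot v (X *m v)) ->
  eigenvalue X^T a -> 0 <= a.
Proof.
move=> pX /eigenvalueP [v va v0].
have := pX v^T.
have -> : X *m v^T = a *: v^T by rewrite -linearZ /= -va trmx_mul trmxK.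
rewrite dotZr pmulr_lge0// lt_def dot_ge0 andbT.
by apply: contra v0 => /eqP/dot_eq0/(congr1 trmx); rewrite trmxK trmx0 => ->.
Qed.

(** The spectral theorem is avoided. With [r] the infimum of the Rayleigh quotients, [X - r%:M] is
    positive semidefinite; were it invertible it would be coercive and [r] could be raised. Hence
    [r] is an eigenvalue, and [lambda_min X] is at most [r]. *)
Lemma lambda_min_le X v : X^T = X -> (forall w, 0 <= dot w (X *m w)) ->
  lambda_min X * dot v v <= dot v (X *m v).
Proof.
move=> sX pX; have [->|v0] := eqVneq v 0; first by rewrite mulmx0 !dot0l mulr0.
pose E := [set dot w (X *m w) / dot w w | w in [set w : 'cV[R]_n | w != 0]].
have pos w : w != 0 -> 0 < dot w w.
  by move=> w0; rewrite lt_def dot_ge0 andbT; apply: contra w0 => /eqP/dot_eq0 ->.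
have E0 : has_lbound E by exists 0 => _ [w _ <-]; rewrite divr_ge0 ?dot_ge0.
set r := inf E.
have rE w : r * dot w w <= dot w (X *m w).
  have [->|w0] := eqVneq w 0; first by rewrite mulmx0 !dot0l mulr0.
  by rewrite -ler_pdivlMr ?pos//; apply: ge_inf => //; exists w.
apply: le_trans (rE v); apply: ler_wpM2r; first exact: dot_ge0.
apply: ge_inf; first by exists 0 => a; rewrite /= -sX; exact: psd_eigenvalue_ge0.
rewrite /= /eigenvalue /eigenspace kermx_eq0 row_free_unit; apply/negP => u.
pose N := X - r%:M.
have NE w : dot w (N *m w) = dot w (X *m w) - r * dot w w.
  by rewrite mulmxBl mul_scalar_mx dotBr dotZr.
have [||c c0 hc] := psd_unit_coercive _ _ u.
- by rewrite linearB /= sX tr_scalar_mx.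
- by move=> w; rewrite NE subr_ge0.
have : r + c <= r.
  apply: lb_le_inf; first by exists (dot v (X *m v) / dot v v), v.
  move=> _ [w /= w0 <-]; rewrite ler_pdivlMr ?pos// mulrDl.
  by have := hc w; rewrite NE; lra.
by rewrite gerDl leNgt c0.
Qed.

Lemma lambda_min_diag_le (T : finType) (k : T -> R) x :
  (forall y, 0 <= k y) -> lambda_min (diag_of k) <= k x.
Proof.
move=> k0; apply: ge_inf.
  exists 0 => a /eigenvalueP [v va v0]; case: (pselect (0 <= a)) => // /negP.
  rewrite -ltNge => a0; case/negP: v0; apply/eqP/rowP => i.
  move: va => /rowP /(_ i); rewrite /diag_of mul_mx_diag !mxE => /eqP.
  rewrite mulrC -subr_eq0 -mulrBl mulf_eq0 => /orP[|/eqP->//].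
  by rewrite subr_eq0 => /eqP h; move: a0; rewrite -h ltNge k0.
apply/eigenvalueP; exists (delta_mx 0 (enum_rank x)).
  apply/rowP => i; rewrite /diag_of mul_mx_diag !mxE eqxx /=.
  case: eqP => [->|_]; last by rewrite mul0r mulr0.
  by rewrite enum_rankK mul1r mulr1.
apply/eqP => /rowP /(_ (enum_rank x)); rewrite !mxE !eqxx => /eqP.
by rewrite oner_eq0.
Qed.

(** The point [x] provides an eigenvalue: a lower bound of the infimum requires a nonempty set. *)
Lemma le_lambda_min_diag (T : finType) (k : T -> R) (x : T) c :
  (forall y, c <= k y) -> c <= lambda_min (diag_of k).
Proof.
move=> kc; apply: lb_le_inf.
  exists (k x); apply/eigenvalueP; exists (delta_mx 0 (enum_rank x)).
    apply/rowP => i; rewrite /diag_of mul_mx_diag !mxE eqxx /=.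
    case: eqP => [->|_]; last by rewrite mul0r mulr0.
    by rewrite enum_rankK mul1r mulr1.
  apply/eqP => /rowP /(_ (enum_rank x)); rewrite !mxE !eqxx => /eqP.
  by rewrite oner_eq0.
move=> a /eigenvalueP [v va v0]; case: (pselect (c <= a)) => // /negP.
rewrite -ltNge => a0; case/negP: v0; apply/eqP/rowP => i.
move: va => /rowP /(_ i); rewrite /diag_of mul_mx_diag !mxE => /eqP.
rewrite mulrC -subr_eq0 -mulrBl mulf_eq0 => /orP[|/eqP->//].
by rewrite subr_eq0 => /eqP h; move: a0; rewrite -h ltNge kc.
Qed.

End SmallestEigenvalue.

(** * Perturbed policies and the projected equation *)

Section Perturbation.
Variables (R : realType) (S A : finType) (M : amdp R S A) (pi : S -> A -> R) (u : R).
Hypotheses (hM : is_amdp M) (hpi : is_policy pi)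
  (hst : is_stationary M pi (stationary M pi)).

Local Notation nu := (stationary M pi).
Local Notation P := (pair_op M pi).
Local Notation tpi := (perturbed u pi).
Local Notation missing s := ((#|A| - #|kept u pi s|)%:R * u).

Definition pair_weight (z : S * A) : R := nu z.1 * pi z.1 z.2.
Definition perturbed_weight (z : S * A) : R := nu z.1 * tpi z.1 z.2.

Lemma sum_pair (F : S * A -> R) : \sum_z F z = \sum_s \sum_a F (s, a).
Proof. by rewrite pair_bigA; apply: eq_bigr => -[]. Qed.

Lemma stationary_ge0 s : 0 <= nu s. Proof. by case: hst => -[]. Qed.

Lemma policy_ge0 s a : 0 <= pi s a. Proof. by case: (hpi s). Qed.

Lemma pair_weight_ge0 z : 0 <= pair_weight z.
Proof. by rewrite mulr_ge0 ?stationary_ge0 ?policy_ge0. Qed.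

Lemma pair_op_le x y z : (forall z, x z <= y z) -> P x z <= P y z.
Proof.
move=> xy; apply: ler_sum => s _; apply: ler_wpM2l; first by case: (hM z.1 z.2).
by apply: ler_sum => a _; apply: ler_wpM2l => //; exact: policy_ge0.
Qed.

Lemma pair_op_ge0 x z : (forall z, 0 <= x z) -> 0 <= P x z.
Proof.
move=> x0; apply: sumr_ge0 => s _; apply: mulr_ge0; first by case: (hM z.1 z.2).
by apply: sumr_ge0 => a _; apply: mulr_ge0 => //; exact: policy_ge0.
Qed.

Lemma pair_op_sqr x z : P x z ^+ 2 <= P (fun y => x y ^+ 2) z.
Proof.
apply: le_trans (simplex_wsum_sqr_le _ (hM z.1 z.2)) _.
apply: ler_sum => s _; apply: ler_wpM2l; first by case: (hM z.1 z.2).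
exact: (simplex_wsum_sqr_le (fun a => x (s, a)) (hpi s)).
Qed.

Lemma pair_weight_op y : \sum_z pair_weight z * P y z = \sum_z pair_weight z * y z.
Proof.
rewrite !sum_pair.
have e f : \sum_s \sum_a pair_weight (s, a) * f (s, a) = state_avg M pi (action_avg pi f).
  apply: eq_bigr => s _; rewrite mulr_sumr; apply: eq_bigr => a _.
  by rewrite /pair_weight /= mulrA.
rewrite !e -(state_avg_op hst (action_avg pi y)); apply: eq_bigr => s _.
by rewrite action_avg_pair_op.
Qed.

Definition energy (w x : S * A -> R) : R := \sum_z w z * (x z * (x z - P x z)).

Definition sqnorm (w x : S * A -> R) : R := \sum_z w z * x z ^+ 2.

Lemma sqnorm_ge0 w x : (forall z, 0 <= w z) -> 0 <= sqnorm w x.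
Proof. by move=> w0; apply: sumr_ge0 => z _; rewrite mulr_ge0 ?sqr_ge0. Qed.

Lemma pair_weight_op_sqr x :
  \sum_z pair_weight z * P x z ^+ 2 <= sqnorm pair_weight x.
Proof.
rewrite /sqnorm -(pair_weight_op (fun z => x z ^+ 2)); apply: ler_sum => z _.
by rewrite ler_wpM2l ?pair_weight_ge0 ?pair_op_sqr.
Qed.

(** Pointwise [x (x - P x)] is at least [(x ^+ 2 - (P x) ^+ 2) / 2], and by Jensen and stationarity
    [P] does not increase the weighted square norm. *)
Lemma energy_ge0 x : 0 <= energy pair_weight x.
Proof.
have h : 2^-1 * sqnorm pair_weight x - 2^-1 * (\sum_z pair_weight z * P x z ^+ 2)
    <= energy pair_weight x.
  rewrite /sqnorm !mulr_sumr -sumrB; apply: ler_sum => z _.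
  have := pair_weight_ge0 z; have := sqr_ge0 (x z - P x z); nra.
by apply: le_trans h; have := pair_weight_op_sqr x; lra.
Qed.

Lemma energy_le x : energy pair_weight x <= 2 * sqnorm pair_weight x.
Proof.
have h : energy pair_weight x <= 3/2 * sqnorm pair_weight x
    + 2^-1 * (\sum_z pair_weight z * P x z ^+ 2).
  rewrite /sqnorm !mulr_sumr -big_split; apply: ler_sum => z _ /=.
  have := pair_weight_ge0 z; have := sqr_ge0 (x z + P x z); nra.
by apply: le_trans h _; have := pair_weight_op_sqr x; lra.
Qed.

Variable gap : R.
Hypotheses (u0 : 0 < u) (gap0 : 0 < gap) (gap2 : gap <= 2)
  (small : forall s s', missing s <= gap / 8 * nu s').

Lemma missing_ge0 s : 0 <= missing s.
Proof. by rewrite mulr_ge0// ltW. Qed.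

Lemma missing_le s : missing s <= 4^-1.
Proof.
apply: le_trans (small s s) _.
have := simplex_le1 s (proj1 hst); have := ler_wpM2r (stationary_ge0 s) gap2; lra.
Qed.

Lemma card_missing s : #|~: kept u pi s| = (#|A| - #|kept u pi s|)%N.
Proof. by rewrite cardsCs finset.setCK. Qed.

Lemma kept_mass_ge s : 1 - missing s / 2 <= \sum_(b in kept u pi s) pi s b.
Proof.
rewrite lerBlDr -[leLHS](proj2 (hpi s)) (bigID (mem (kept u pi s))) /= lerD2l.
apply: (@le_trans _ _ (\sum_(a in ~: kept u pi s) u / 2)).
  rewrite [leLHS](eq_bigl (mem (~: kept u pi s))); last by move=> a; rewrite /= finset.in_setC.
  by apply: ler_sum => a /=; rewrite finset.in_setC inE -leNgt.
by rewrite sumr_const card_missing -[leLHS]mulr_natl mulrA.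
Qed.

Lemma kept_mass_gt0 s : 0 < \sum_(b in kept u pi s) pi s b.
Proof. by apply: lt_le_trans (kept_mass_ge s); have := missing_le s; lra. Qed.

(** The threshold [u / 2] is what makes kept actions only lose probability: discarded ones had at
    most half of the mass [missing s] they receive, so the kept mass exceeds [1 - missing s] and the
    rescaling factor is at most 1. *)
Lemma perturbed_kept s a : a \in kept u pi s ->
  (1 - missing s) * pi s a <= tpi s a <= pi s a.
Proof.
move=> ka; rewrite /perturbed ka; set k := \sum_(b in _) _.
have k0 : 0 < k := kept_mass_gt0 s.
have k1 : k <= 1.
  rewrite -[leRHS](proj2 (hpi s)) (bigID (mem (kept u pi s))) /= lerDl.
  by apply: sumr_ge0 => b _; exact: policy_ge0.
have := kept_mass_ge s; rewrite -/k => k2; have := missing_ge0 s => m0.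
have p0 := policy_ge0 s a; have := missing_le s => m4.
rewrite ler_pdivlMr// ler_pdivrMr//; apply/andP; split.
  rewrite -mulrA mulrCA; apply: ler_wpM2l => //.
  rewrite ler_piMr//; lra.
by apply: ler_wpM2l => //; lra.
Qed.

Lemma perturbed_missing s a : a \notin kept u pi s -> pi s a <= u / 2 /\ tpi s a = u.
Proof.
by move=> ka; rewrite /perturbed (negbTE ka); split=> //; move: ka; rewrite inE -leNgt.
Qed.

Lemma perturbed_simplex s : simplex (tpi s).
Proof.
split=> [a|].
  have [ka|ka] := boolP (a \in kept u pi s); last first.
    by rewrite (perturbed_missing ka).2 ltW.
  case/andP: (perturbed_kept ka) => h _; apply: le_trans h.
  by rewrite mulr_ge0 ?policy_ge0//; have := missing_le s; lra.
rewrite (bigID (mem (kept u pi s))) /=.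
rewrite (eq_bigr (fun a => pi s a * ((1 - missing s) / \sum_(b in kept u pi s) pi s b)));
  last by move=> a ka; rewrite /perturbed ka mulrA.
rewrite -mulr_suml [X in _ + X](eq_bigr (fun=> u)); last first.
  by move=> a ka; rewrite (perturbed_missing ka).2.
rewrite [X in _ + X](eq_bigl (mem (~: kept u pi s))); last by move=> a; rewrite /= finset.in_setC.
rewrite sumr_const card_missing mulrCA mulfV ?gt_eqF ?kept_mass_gt0//.
by rewrite mulr1 -[X in _ + X]mulr_natl; ring.
Qed.

Lemma perturbed_ge s a : Num.min u (u / 4) <= tpi s a.
Proof.
have [ka|ka] := boolP (a \in kept u pi s); last first.
  by rewrite (perturbed_missing ka).2 ge_min lexx.
case/andP: (perturbed_kept ka) => h _; apply: le_trans h.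
rewrite ge_min; apply/orP; right.
have := ler_wpM2r (policy_ge0 s a) (missing_le s).
move: ka; rewrite inE => ka; move: (missing s) (u0) => m u1 m4; lra.
Qed.

(* The perturbation shrinks the kept pairs by a relative amount at most [gap / 8] (the
   defect) and raises the mass of the other pairs (the excess). *)
Definition excess (z : S * A) : R :=
  if z.2 \in kept u pi z.1 then 0 else nu z.1 * (u - pi z.1 z.2).
Definition defect (z : S * A) : R :=
  if z.2 \in kept u pi z.1 then nu z.1 * (pi z.1 z.2 - tpi z.1 z.2) else 0.

Lemma perturbed_weightE z : perturbed_weight z = pair_weight z + excess z - defect z.
Proof.
rewrite /perturbed_weight /pair_weight /excess /defect; case: ifPn => [|k]; first by lra.
by rewrite (perturbed_missing k).2; lra.
Qed.

Lemma excess_ge0 z : 0 <= excess z.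
Proof.
rewrite /excess; case: ifPn => // k; rewrite mulr_ge0 ?stationary_ge0//.
by have := (perturbed_missing k).1; have := u0; lra.
Qed.

Lemma defect_ge0 z : 0 <= defect z.
Proof.
rewrite /defect; case: ifPn => // k; rewrite mulr_ge0 ?stationary_ge0//.
by case/andP: (perturbed_kept k); lra.
Qed.

Lemma defect_le z : defect z <= gap / 8 * pair_weight z.
Proof.
have p0 := pair_weight_ge0 z.
rewrite /defect; case: ifPn => [k|_]; last by rewrite mulr_ge0// divr_ge0// ltW.
apply: (@le_trans _ _ (missing z.1 * pair_weight z)).
  rewrite /pair_weight mulrCA; apply: ler_wpM2l; first exact: stationary_ge0.
  by case/andP: (perturbed_kept k); lra.
apply: ler_wpM2r => //; apply: le_trans (small z.1 z.1) _.
rewrite ler_piMr//; last exact: simplex_le1 z.1 (proj1 hst).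
by rewrite divr_ge0// ltW.
Qed.

(** The comparison is with an arbitrary state [s'], not with the one carrying the excess, because
    the bound has to survive a transition to any state. *)
Lemma excess_mass s' : \sum_z excess z <= gap / 8 * nu s'.
Proof.
rewrite sum_pair.
apply: (@le_trans _ _ (\sum_s nu s * missing s)).
  apply: ler_sum => s _; rewrite (bigID (mem (kept u pi s))) /= big1 ?add0r; last first.
    by move=> a ka; rewrite /excess /= ka.
  rewrite (eq_bigl (mem (~: kept u pi s))); last by move=> a; rewrite /= finset.in_setC.
  apply: (@le_trans _ _ (\sum_(a in ~: kept u pi s) nu s * u)).
    apply: ler_sum => a /=; rewrite finset.in_setC => ka; rewrite /excess /= (negbTE ka).
    apply: ler_wpM2l; first exact: stationary_ge0.
    by have := policy_ge0 s a; have := u0; lra.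
  by rewrite sumr_const card_missing -[leLHS]mulr_natl mulrCA.
apply: (@le_trans _ _ (\sum_s nu s * (gap / 8 * nu s'))).
  by apply: ler_sum => s _; rewrite ler_wpM2l ?stationary_ge0.
by rewrite -mulr_suml; case: hst => -[_ ->] _; rewrite mul1r.
Qed.

(** A transition started from the excess puts on each state at most the total excess, hence at most
    [gap / 8] of its stationary mass. *)
Lemma excess_op y : (forall z, 0 <= y z) ->
  \sum_z excess z * P y z <= gap / 8 * \sum_z pair_weight z * y z.
Proof.
move=> y0.
have av0 s : 0 <= \sum_a pi s a * y (s, a).
  by apply: sumr_ge0 => a _; rewrite mulr_ge0 ?policy_ge0.
apply: (@le_trans _ _ (\sum_z excess z * \sum_s \sum_a pi s a * y (s, a))).
  apply: ler_sum => z _; apply: ler_wpM2l; first exact: excess_ge0.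
  apply: ler_sum => s _; rewrite ler_piMl//; exact: simplex_le1 (hM _ _).
rewrite [X in _ <= gap / 8 * X]sum_pair -mulr_suml !mulr_sumr; apply: ler_sum => s _.
apply: le_trans (ler_wpM2r (av0 s) (excess_mass s)) _.
rewrite -(mulrA (gap / 8)); apply: ler_wpM2l; first by rewrite divr_ge0// ltW.
rewrite mulr_sumr; apply: ler_sum => a _; by rewrite mulrA.
Qed.

(** [11 / 16 = 1 - 1 / 4 - 1 / 16]: the defect costs [gap / 8 * (3 / 2 + 1 / 2)], and the squares
    transported from the excess cost [gap / 8 / 2]. The term in [excess] is kept because the
    perturbed norm also charges the pairs whose mass was raised, which [gap] does not control. *)
Lemma energy_perturbed x :
  gap * sqnorm pair_weight x <= energy pair_weight x ->
  11 / 16 * gap * sqnorm pair_weight x + 2^-1 * sqnorm excess x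
    <= energy perturbed_weight x.
Proof.
move=> h.
have -> : energy perturbed_weight x =
    energy pair_weight x + energy excess x - energy defect x.
  rewrite /energy -big_split -sumrB; apply: eq_bigr => z _ /=.
  by rewrite perturbed_weightE; lra.
have h1 : energy defect x <= gap / 4 * sqnorm pair_weight x.
  apply: (@le_trans _ _ (gap / 8 * (3/2 * sqnorm pair_weight x
      + 2^-1 * (\sum_z pair_weight z * P x z ^+ 2)))).
    rewrite /sqnorm !mulr_sumr -big_split mulr_sumr; apply: ler_sum => z _ /=.
    apply: (@le_trans _ _ (defect z * (3/2 * x z ^+ 2 + 2^-1 * P x z ^+ 2))).
      apply: ler_wpM2l; first exact: defect_ge0.
      by have := sqr_ge0 (x z + P x z); lra.
    have -> : gap / 8 * (3 / 2 * (pair_weight z * x z ^+ 2) +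
      2^-1 * (pair_weight z * P x z ^+ 2)) =
      gap / 8 * pair_weight z * (3/2 * x z ^+ 2 + 2^-1 * P x z ^+ 2) by lra.
    apply: ler_wpM2r; last exact: defect_le.
    by have := sqr_ge0 (x z); have := sqr_ge0 (P x z); lra.
  have := pair_weight_op_sqr x; have := gap0; nra.
have h2 : 2^-1 * sqnorm excess x - gap / 16 * sqnorm pair_weight x <= energy excess x.
  have h3 : \sum_z excess z * P x z ^+ 2 <= gap / 8 * sqnorm pair_weight x.
    apply: le_trans (excess_op (y := fun z => x z ^+ 2) _); last first.
      by move=> z; exact: sqr_ge0.
    apply: ler_sum => z _; apply: ler_wpM2l; first exact: excess_ge0.
    exact: pair_op_sqr.
  apply: (@le_trans _ _ (2^-1 * sqnorm excess x - 2^-1 * \sum_z excess z * P x z ^+ 2)).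
    by lra.
  rewrite /sqnorm !mulr_sumr -sumrB; apply: ler_sum => z _.
  have := sqr_ge0 (x z - P x z); have := excess_ge0 z; nra.
lra.
Qed.

Lemma sqnorm_perturbed_le x :
  sqnorm perturbed_weight x <= sqnorm pair_weight x + sqnorm excess x.
Proof.
rewrite /sqnorm -big_split; apply: ler_sum => z _ /=; rewrite perturbed_weightE.
by have := defect_ge0 z; have := sqr_ge0 (x z); nra.
Qed.

Lemma sqnorm_perturbed_ge x :
  3 / 4 * sqnorm pair_weight x <= sqnorm perturbed_weight x.
Proof.
rewrite /sqnorm mulr_sumr; apply: ler_sum => z _; rewrite perturbed_weightE mulrA.
apply: ler_wpM2r; first exact: sqr_ge0.
by have := defect_le z; have := excess_ge0 z; have := ler_wpM2r (pair_weight_ge0 z) gap2; lra.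
Qed.

(** [1 + gap / 8 <= 5 / 4], times the factor [4 / 3] of [sqnorm_perturbed_ge], is below 2. *)
Lemma perturbed_op x :
  \sum_z perturbed_weight z * P (fun y => x y ^+ 2) z <= 2 * sqnorm perturbed_weight x.
Proof.
apply: (@le_trans _ _ (5 / 4 * sqnorm pair_weight x)); last first.
  by have := sqnorm_perturbed_ge x; have := sqnorm_ge0 x pair_weight_ge0; lra.
have P0 z : 0 <= P (fun y => x y ^+ 2) z.
  by apply: pair_op_ge0 => y; exact: sqr_ge0.
apply: (@le_trans _ _ (\sum_z pair_weight z * P (fun y => x y ^+ 2) z +
    \sum_z excess z * P (fun y => x y ^+ 2) z)).
  rewrite -big_split; apply: ler_sum => z _ /=; rewrite perturbed_weightE.
  by have := defect_ge0 z; have := P0 z; nra.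
rewrite pair_weight_op.
have := excess_op (y := fun z => x z ^+ 2) (fun z => sqr_ge0 _).
have := ler_wpM2r (sqnorm_ge0 x pair_weight_ge0) gap2; rewrite /sqnorm; lra.
Qed.

End Perturbation.

(** * The span seminorm *)

Section SpanSeminorm.
Variables (R : realType) (T : finType) (x0 : T).
Implicit Types f g : T -> R.

Lemma range_bounded f : has_ubound (range f) /\ has_lbound (range f).
Proof.
split.
  by exists (\sum_x `|f x|) => _ [x _ <-]; rewrite (bigD1 x)//=;
    apply: le_trans (ler_norm _) _; rewrite lerDl sumr_ge0.
exists (- \sum_x `|f x|) => _ [x _ <-]; rewrite (bigD1 x)//= opprD.
apply: le_trans (lerNnormlW (lexx _)); rewrite gerDl oppr_le0 sumr_ge0//.
Qed.

Lemma le_spnorm f x y : f x - f y <= spnorm f.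
Proof.
have [h1 h2] := range_bounded f.
by apply: lerB; [apply: ub_le_sup => //; exists x|apply: ge_inf => //; exists y].
Qed.

Lemma spnorm_le f c : (forall x y, f x - f y <= c) -> spnorm f <= c.
Proof.
move=> fc; rewrite /spnorm lerBlDr.
apply: ge_sup; first by exists (f x0), x0.
move=> _ [x _ <-]; rewrite -lerBlDl; apply: lb_le_inf; first by exists (f x0), x0.
by move=> _ [y _ <-]; rewrite lerBlDl -lerBlDr.
Qed.

Lemma spnorm_ge0 f : 0 <= spnorm f.
Proof. by have := le_spnorm f x0 x0; rewrite subrr. Qed.

Lemma spnorm_le_norm f c : (forall x, `|f x| <= c) -> spnorm f <= 2 * c.
Proof.
move=> fc; apply: spnorm_le => x y.
have := fc x; have := fc y; rewrite !ler_norml => /andP[? ?] /andP[? ?]; lra.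
Qed.

Lemma spnormD f g : spnorm (fun x => f x + g x) <= spnorm f + spnorm g.
Proof.
by apply: spnorm_le => x y; have := le_spnorm f x y; have := le_spnorm g x y; lra.
Qed.

End SpanSeminorm.

Lemma projected_solutionP (R : realType) (S A : finType) (M : amdp R S A) d
    (Psi : 'M[R]_(#|{: S * A}|, d)) u pi theta :
  projected_solution M Psi u pi theta <->
  Psi^T *m perturbed_diag M u pi *m (1%:M - pair_mx M pi) *m Psi *m theta =
  Psi^T *m perturbed_diag M u pi *m vec_of (rel_cost M pi).
Proof.
rewrite /projected_solution mulmxBr mulmx1 mulmxBl mulmxBl; split=> [->|/eqP].
  by rewrite addrAC subrr add0r.
by rewrite subr_eq => /eqP ->; rewrite addrC.
Qed.

(** * Standing hypotheses, coercivity and the projected solution *)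

Section Setting.
Variables (R : realType) (S A : finType) (M : amdp R S A) (d : nat)
  (Psi : 'M[R]_(#|{: S * A}|, d)) (u Gamma mubar kappa cbar : R) (x0 : S * A).
Implicit Types (pi : S -> A -> R) (v w : 'cV[R]_d).

(** What policy evaluation rests on. Convexity of the regularizer and the optimal policy enter only
    with SPMD. *)
Record setting : Prop := Setting {
  set_amdp : is_amdp M;
  set_ergodic : ergodic M;
  set_Gamma : 0 < Gamma /\ Gamma < 1;
  set_stationary : forall pi, is_policy pi -> forall s, 1 - Gamma <= stationary M pi s;
  set_cost : cost_bounded M cbar;
  set_features : features_ok Psi;
  set_floor : floor_ok M Psi u;
  set_mubar : 0 < mubar;
  set_mu : forall pi, is_policy pi -> mubar <= mu M Psi u pi;
  set_gap : forall pi, is_policy pi ->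
     [/\ 0 < beta_gap M Psi pi, (beta_gap M Psi pi)^-1 <= kappa * t_mix M,
         0 < tbeta_gap M Psi u pi
       & (tbeta_gap M Psi u pi)^-1 <= kappa * t_mix M];
  set_pos : 0 < kappa /\ 0 < cbar
}.
Hypothesis hS : setting.

Let hM := set_amdp hS.
Let hE := set_ergodic hS.

Lemma uniform_is_policy : is_policy (uniform_policy R (S := S) (A := A)).
Proof.
move=> s; split=> [a|]; first by rewrite invr_ge0.
rewrite /uniform_policy sumr_const -[LHS]mulr_natl mulfV// pnatr_eq0 -lt0n.
by apply/card_gt0P; exists x0.2.
Qed.

Section OnePolicy.
Variable pi : S -> A -> R.
Hypothesis hpi : is_policy pi.

Let hst := stationary_spec hE hpi.
Local Notation nu := (stationary M pi).
Local Notation b := (tbeta_gap M Psi u pi).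
Local Notation m := (mu M Psi u pi).
Local Notation gap := (beta_gap M Psi pi).
Local Notation wt := (perturbed_weight M pi u).
Local Notation wd := (pair_weight M pi).
Local Notation val v := (coord (Psi *m v)).

(** Matrix of the mean temporal-difference operator when states are stationary and actions
    perturbed; in general it is not symmetric, and only its quadratic form is controlled from
    below. *)
Definition td_mx : 'M[R]_d :=
  Psi^T *m perturbed_diag M u pi *m (1%:M - pair_mx M pi) *m Psi.

Definition gram_norm v : R := sqnorm wt (val v).

Local Notation G := gram_norm.

Lemma coord_psi v z : val v z = dot (psi Psi z) v.
Proof. by rewrite /coord mxE; apply: eq_bigr => i _; rewrite !mxE. Qed.

Lemma dot_weighted k v w :
  dot v (Psi^T *m diag_of k *m (Psi *m w)) = \sum_z k z * (val v z * val w z).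
Proof.
rewrite -mulmxA dot_mulmx trmxK dot_coord; apply: eq_bigr => z _.
by rewrite coord_diag_of; ring.
Qed.

Lemma coord_idB x z :
  coord ((1%:M - pair_mx M pi) *m x) z = coord x z - pair_op M pi (coord x) z.
Proof.
rewrite -pair_opE vec_ofK mulmxBl mul1mx /coord mxE; congr (_ + _).
by rewrite mxE.
Qed.

Lemma dot_td_mx v w :
  dot v (td_mx *m w) = \sum_z wt z * (val v z * (val w z - pair_op M pi (val w) z)).
Proof.
rewrite /td_mx -!mulmxA dot_mulmx trmxK dot_coord; apply: eq_bigr => z _.
by rewrite coord_diag_of coord_idB /perturbed_weight; ring.
Qed.

Lemma dot_td_rhs v :
  dot v (Psi^T *m perturbed_diag M u pi *m vec_of (rel_cost M pi)) =
  \sum_z wt z * (val v z * rel_cost M pi z).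
Proof.
rewrite -mulmxA dot_mulmx trmxK dot_coord; apply: eq_bigr => z _.
by rewrite coord_diag_of coord_vec_of /perturbed_weight; ring.
Qed.

Lemma gram_normE v :
  G v = dot v (Psi^T *m perturbed_diag M u pi *m Psi *m v).
Proof.
rewrite -mulmxA dot_weighted; apply: eq_bigr => z _.
by rewrite /perturbed_weight expr2.
Qed.

Lemma beta_quadE x :
  (x^T *m pair_diag M pi *m x) 0 0 = sqnorm wd (coord x) /\
  (x^T *m pair_diag M pi *m (1%:M - pair_mx M pi) *m x) 0 0 = energy M pi wd (coord x).
Proof.
split.
  rewrite -mulmxA -dotE dot_coord; apply: eq_bigr => z _.
  by rewrite coord_diag_of /pair_weight; ring.
rewrite -!mulmxA -dotE dot_coord; apply: eq_bigr => z _.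
by rewrite coord_diag_of coord_idB /pair_weight; ring.
Qed.

(** The infimum [gap] runs over vectors of norm 1, the others follow by scaling. Where the seminorm
    [sqnorm wd] vanishes, nonnegativity of the energy is enough. *)
Lemma beta_gap_energy v : gap * sqnorm wd (val v) <= energy M pi wd (val v).
Proof.
have e0 x := energy_ge0 hM hpi hst x.
have qge0 : 0 <= sqnorm wd (val v) := sqnorm_ge0 (val v) (pair_weight_ge0 hpi hst).
set q := sqnorm wd (val v) in qge0 *.
have [->|qn0] := eqVneq q 0; first by rewrite mulr0 e0.
have q0 : 0 < q by rewrite lt_def qn0.
have s0 : 0 < Num.sqrt q by rewrite sqrtr_gt0.
have sn : Num.sqrt q != 0 by rewrite gt_eqF.
pose c := (Num.sqrt q)^-1.
have cc : c ^+ 2 = q^-1 by rewrite /c exprVn sqr_sqrtr// ltW.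
have cE z : val (c *: v) z = c * val v z.
  by rewrite /coord -scalemxAr mxE.
have n1 : sqnorm wd (val (c *: v)) = 1.
  rewrite /sqnorm (eq_bigr (fun z => q^-1 * (wd z * val v z ^+ 2))).
    by rewrite -mulr_sumr mulVf// gt_eqF.
  by move=> z _; rewrite cE exprMn cc; ring.
have n2 : energy M pi wd (val (c *: v)) = q^-1 * energy M pi wd (val v).
  rewrite /energy mulr_sumr; apply: eq_bigr => z _; rewrite cE.
  have -> : pair_op M pi (val (c *: v)) z = c * pair_op M pi (val v) z.
    rewrite /pair_op mulr_sumr; apply: eq_bigr => s _.
    rewrite mulrCA; congr (_ * _); rewrite mulr_sumr; apply: eq_bigr => a _.
    by rewrite cE mulrCA.
  by rewrite -cc; ring.
rewrite -ler_pdivlMr// mulrC -n2; apply: ge_inf.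
  by exists 0 => _ [x _ <-]; rewrite (beta_quadE x).2 e0.
exists (Psi *m (c *: v)); last by rewrite (beta_quadE _).2.
by split; [exists (c *: v)|rewrite (beta_quadE _).1].
Qed.

Lemma beta_gap_gt0 : 0 < gap. Proof. by case: (set_gap hS hpi). Qed.
Lemma tbeta_gt0 : 0 < b. Proof. by case: (set_gap hS hpi). Qed.
Lemma tbeta_inv_le : b^-1 <= kappa * t_mix M. Proof. by case: (set_gap hS hpi). Qed.

Lemma beta_gap_le2 : gap <= 2.
Proof.
rewrite /beta_gap; set E := [set _ | x in _].
have [E0|[_ [x [[v hx] x1] _]]] : E = set0 \/ exists y, E y.
  by have [->|/set0P] := eqVneq E set0; [left|right].
  by rewrite E0 inf0.
apply: le_trans (_ : _ <= energy M pi wd (coord x)) _.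
  apply: ge_inf; last by exists x; [split => //; exists v|rewrite (beta_quadE _).2].
  by exists 0 => _ [y _ <-]; rewrite (beta_quadE y).2; exact: (energy_ge0 hM hpi hst).
apply: le_trans (energy_le hM hpi hst _) _.
by move: x1; rewrite (beta_quadE x).1 => ->; rewrite mulr1.
Qed.

Lemma floor_gt0 : 0 < u. Proof. by case: (set_floor hS). Qed.

Lemma min_kept_le s : (min_kept u pi <= #|kept u pi s|)%N.
Proof. by have := bigmin_le #|A| s (fun s => #|kept u pi s|); rewrite leEnat. Qed.

(** With [y = gap * nm] the bound on the floor reads [n * u * (8 + y) <= y], whence
    [8 * n * u <= y]. If every action is always kept, the left side is 0. *)
Lemma floor_small s s' : (#|A| - #|kept u pi s|)%:R * u <= gap / 8 * nu s'.
Proof.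
have g0 := beta_gap_gt0; have u0 := floor_gt0.
have nu0 := stationary_ge0 hst.
have [e|ne] := eqVneq (min_kept u pi) #|A|.
  have -> : (#|A| - #|kept u pi s|)%N = 0%N.
    by apply/eqP; rewrite subn_eq0 -e min_kept_le.
  by rewrite mul0r mulr_ge0// divr_ge0// ltW.
apply: (@le_trans _ _ ((#|A| - min_kept u pi)%:R * u)).
  apply: ler_wpM2r; first exact: ltW.
  by rewrite ler_nat leq_sub2l// min_kept_le.
have lt : (min_kept u pi < #|A|)%N.
  by rewrite ltn_neqAle ne /=; apply: leq_trans (min_kept_le s) (max_card _).
have n0 : 0 < (#|A| - min_kept u pi)%:R :> R by rewrite ltr0n subn_gt0.
case: (set_floor hS) => _ _ /(_ pi hpi (elimN eqP ne)).
set n : R := _%:R in n0 *; set nm := min_stationary M pi.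
have nm0 : 0 <= nm by apply: le_bigmin.
have nm1 : nm <= nu s' by apply: bigmin_le.
have y0 : 0 <= gap * nm by rewrite mulr_ge0// ltW.
rewrite ler_pdivlMr; last by rewrite mulr_gt0//; lra.
move=> h.
have h1 : n * u * 8 <= gap * nm.
  have : 0 <= n * u * (gap * nm) by rewrite !mulr_ge0// ltW.
  by lra.
have := ler_wpM2l (ltW g0) nm1; lra.
Qed.

Let small := floor_small.
Let g0 := beta_gap_gt0.
Let g2 := beta_gap_le2.
Let u0 := floor_gt0.

Lemma alpha_le1 : alpha u pi <= 1.
Proof. by rewrite /alpha gerBl mulr_ge0// ltW// floor_gt0. Qed.

Lemma tbeta_le_gap : b <= 27 / 32 * gap.
Proof.
have g0' := g0; have := alpha_le1 => a1.
rewrite /tbeta_gap ge_min; apply/orP; left.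
by have := ler_wpM2r (ltW g0') a1; lra.
Qed.

Lemma tbeta_le : b <= 8^-1.
Proof.
have b0 := tbeta_gt0; have b2 : b <= 27 * alpha u pi * gap / 32.
  by rewrite /tbeta_gap ge_min lexx.
have : b <= (1 - alpha u pi * gap) / 8 by rewrite {1}/tbeta_gap ge_min lexx orbT.
lra.
Qed.

(** [energy_perturbed] covers both parts of the perturbed norm: [b / 2] is below [11 / 16 * gap] on
    the stationary part and below one half on the excess. *)
Lemma td_coercive v : b / 2 * G v <= dot v (td_mx *m v).
Proof.
rewrite dot_td_mx -/(energy M pi wt (val v)).
have h := energy_perturbed hM hpi hst u0 g0 g2 small (beta_gap_energy v).
apply: le_trans h.
have := sqnorm_perturbed_le hpi hst u0 g2 small (val v).
rewrite -/(G v) => h.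
have b0 := tbeta_gt0; have b1 := tbeta_le; have b2 := tbeta_le_gap.
have w0 : 0 <= sqnorm wd (val v) := sqnorm_ge0 (val v) (pair_weight_ge0 hpi hst).
have w1 : 0 <= sqnorm (excess M pi u) (val v) := sqnorm_ge0 (val v) (excess_ge0 hst u0).
have b3 : b / 2 <= 11 / 16 * gap by have := g0; lra.
have b4 : b / 2 <= 2^-1 by lra.
have := ler_wpM2r w0 b3; have := ler_wpM2r w1 b4.
have : 0 <= b / 2 by lra.
move=> /ler_wpM2l /(_ _ _ h); lra.
Qed.

Lemma perturbed_is_policy : is_policy (perturbed u pi).
Proof. by move=> s; exact: (perturbed_simplex hpi hst u0 g2 small). Qed.

Lemma wt_ge0 z : 0 <= wt z.
Proof. by rewrite mulr_ge0 ?stationary_ge0//; case: (perturbed_is_policy z.1). Qed.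

Lemma wt_sum : \sum_z wt z = 1.
Proof.
rewrite sum_pair /perturbed_weight /=; under eq_bigr do rewrite -mulr_sumr.
under eq_bigr => s _ do rewrite (proj2 (perturbed_is_policy s)) mulr1.
by case: hst => -[].
Qed.

Lemma wt_simplex : simplex wt.
Proof. by split; [exact: wt_ge0|exact: wt_sum]. Qed.

Lemma gram_ge0 v : 0 <= G v.
Proof. exact: sqnorm_ge0 wt_ge0. Qed.

Lemma l2norm_psi z : l2norm (psi Psi z) <= 1.
Proof. by case: (set_features hS). Qed.

Lemma dot_psi_le z : dot (psi Psi z) (psi Psi z) <= 1.
Proof.
by rewrite -sqr_l2norm -[leRHS](expr1n _ 2) ler_pXn2r ?nnegrE ?l2norm_ge0 ?l2norm_psi.
Qed.

Lemma val_sqr_le v z : val v z ^+ 2 <= dot v v.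
Proof.
rewrite coord_psi; apply: le_trans (dot_sqr_le _ _) _.
by rewrite ler_piMl ?dot_ge0 ?dot_psi_le.
Qed.

Lemma val_le v z : `|val v z| <= l2norm v.
Proof.
by rewrite l2normE -sqrtr_sqr ler_sqrt ?dot_ge0 ?val_sqr_le.
Qed.

Lemma gram_le v : G v <= dot v v.
Proof.
rewrite -[leRHS]mul1r -wt_sum mulr_suml; apply: ler_sum => z _.
by rewrite ler_wpM2l ?wt_ge0 ?val_sqr_le.
Qed.

Lemma mu_gram v : m * dot v v <= G v.
Proof.
rewrite gram_normE; apply: lambda_min_le => [|w]; last by rewrite -gram_normE gram_ge0.
by rewrite !trmx_mul trmxK mulmxA /perturbed_diag /diag_of tr_diag_mx.
Qed.

Lemma mu_gt0 : 0 < m.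
Proof. by apply: lt_le_trans (set_mu hS hpi); exact: set_mubar hS. Qed.

Lemma mu_le1 : m <= 1.
Proof.
case: (set_features hS) => d0 _ _ _; pose i := Ordinal d0.
pose v : 'cV[R]_d := delta_mx i 0.
have e : dot v v = 1.
  rewrite /dot (bigD1 i)//= big1 ?addr0; last by move=> j /negbTE ji; rewrite !mxE ji mul0r.
  by rewrite !mxE !eqxx mulr1.
by have := le_trans (mu_gram v) (gram_le v); rewrite e mulr1.
Qed.

(** [6 = 2 + 2 * 2], the second term by [perturbed_op]. *)
Lemma td_second_moment v :
  \sum_z wt z * pair_op M pi (fun y => (val v z - val v y) ^+ 2) z <= 6 * G v.
Proof.
have h := perturbed_op hM hpi hst u0 g0 g2 small (val v).
have P1 z c : pair_op M pi (fun=> c) z = c.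
  rewrite /pair_op; under eq_bigr do rewrite -mulr_suml (proj2 (hpi _)) mul1r.
  by rewrite -mulr_suml (proj2 (hM _ _)) mul1r.
have PD f g z : pair_op M pi (fun y => f y + g y) z = pair_op M pi f z + pair_op M pi g z.
  rewrite /pair_op -big_split; apply: eq_bigr => s _ /=; rewrite -mulrDr; congr (_ * _).
  by rewrite -big_split; apply: eq_bigr => a _ /=; rewrite mulrDr.
apply: (@le_trans _ _ (2 * G v +
    2 * \sum_z wt z * pair_op M pi (fun y => val v y ^+ 2) z)); last first.
  by rewrite -/(G v) in h; lra.
rewrite /gram_norm /sqnorm !mulr_sumr -big_split; apply: ler_sum => z _ /=.
have -> : 2 * (wt z * val v z ^+ 2) +
    2 * (wt z * pair_op M pi (fun y => val v y ^+ 2) z) =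
    wt z * (pair_op M pi (fun=> 2 * val v z ^+ 2) z + (pair_op M pi (fun y => val v y ^+ 2) z
     + pair_op M pi (fun y => val v y ^+ 2) z)) by rewrite P1; ring.
rewrite -!PD; apply: ler_wpM2l; first exact: wt_ge0.
apply: pair_op_le => // y; have := sqr_ge0 (val v z + val v y); lra.
Qed.

Lemma td_mx_unit : td_mx \in unitmx.
Proof.
rewrite unitmxE unitfE; apply/negP => /det0P [v v0 vA].
case/negP: v0; apply/eqP; apply: trmx_inj; rewrite trmx0; apply: dot_eq0.
have h : dot v^T (td_mx *m v^T) = 0 by rewrite dotE trmxK mulmxA vA mul0mx mxE.
have := td_coercive v^T; rewrite h => h1.
have := mu_gram v^T; have := dot_ge0 v^T; have := mu_gt0; have := tbeta_gt0.
set q := dot _ _ => b0 m0 q0 h2; apply/eqP; rewrite eq_le q0 andbT.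
rewrite -(ler_pM2l m0) mulr0; apply: le_trans h2 _.
by rewrite -(@ler_pM2l _ (b / 2)) ?divr_gt0// mulr0.
Qed.

(** Coercivity makes [td_mx] invertible, so the set whose supremum is [eps_approx] has exactly one
    element per policy. *)
Definition td_solution : 'cV[R]_d :=
  invmx td_mx *m (Psi^T *m perturbed_diag M u pi *m vec_of (rel_cost M pi)).

Lemma td_solution_spec : projected_solution M Psi u pi td_solution.
Proof. by apply/projected_solutionP; rewrite -/td_mx mulKVmx ?td_mx_unit. Qed.

Lemma projected_solution_uniq theta :
  projected_solution M Psi u pi theta -> theta = td_solution.
Proof.
by move/projected_solutionP; rewrite -/td_mx /td_solution => <-; rewrite mulKmx ?td_mx_unit.
Qed.

(** Coercivity tested at the solution itself. This crude bound only serves to make the supremum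
    [eps_approx] finite and to bound the initial error of EVRTD, which the epochs erase. *)
Lemma td_solution_le : l2norm td_solution <= 4 * cbar * (kappa * t_mix M) / mubar.
Proof.
have [k0 c0] := set_pos hS.
set th := td_solution; set t := l2norm th.
have tm1 := t_mix_ge1 hE hpi.
have := td_coercive th; rewrite /th /td_solution mulKVmx ?td_mx_unit// -/td_solution -/th.
rewrite dot_td_rhs => h1.
have h2 : \sum_z wt z * (val th z * rel_cost M pi z) <= t * (2 * cbar).
  apply: le_trans (ler_norm _) _; apply: (simplex_wsum_le wt_simplex) => z.
  rewrite normrM ler_pM//; first exact: val_le.
  exact: rel_cost_le (set_cost hS) _ _ hpi.
have h3 := mu_gram th; rewrite -sqr_l2norm -/t in h3.
have b0 := tbeta_gt0; have bi := tbeta_inv_le.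
have mb := set_mu hS hpi; have mb0 := set_mubar hS.
have tge0 : 0 <= t by exact: l2norm_ge0.
have [->|tn0] := eqVneq t 0.
  by rewrite !(mulr_ge0, invr_ge0)// ?ltW//; lra.
have t0 : 0 < t by rewrite lt_def tn0.
have h4 : b * mubar * t <= 4 * cbar.
  rewrite -(ler_pM2r t0).
  have : mubar * t ^+ 2 <= G th by apply: le_trans h3; rewrite ler_wpM2r ?sqr_ge0.
  move=> /(ler_wpM2l (ltW b0)); lra.
have h5 : t * mubar <= b^-1 * (4 * cbar).
  by rewrite ler_pdivlMl//; lra.
rewrite ler_pdivlMr//.
by apply: le_trans h5 _; rewrite mulrC ler_wpM2l// mulr_ge0// ltW.
Qed.

Lemma spnorm_td_solution_le :
  spnorm (fun z => val td_solution z - Qbar M pi z) <=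
  2 * (4 * cbar * (kappa * t_mix M) / mubar + 10 * cbar * t_mix M).
Proof.
apply: spnorm_le_norm => // z; apply: le_trans (ler_normB _ _) _.
apply: lerD; first exact: le_trans (val_le _ _) td_solution_le.
exact: (Qbar_le hM hE (set_cost hS)).
Qed.

End OnePolicy.

Lemma eps_approx_ge pi : is_policy pi ->
  spnorm (fun z => coord (Psi *m td_solution pi) z - Qbar M pi z) <= eps_approx M Psi u.
Proof.
move=> hpi; apply: ub_le_sup; last first.
  by exists pi, (td_solution pi); split=> //; exact: td_solution_spec.
exists (2 * (4 * cbar * (kappa * t_mix M) / mubar + 10 * cbar * t_mix M)).
move=> _ [pi' [th [hpi' hth ->]]].
rewrite (projected_solution_uniq hpi' hth); exact: spnorm_td_solution_le.
Qed.

Lemma eps_approx_ge0 : 0 <= eps_approx M Psi u.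
Proof. exact: le_trans (spnorm_ge0 x0 _) (eps_approx_ge uniform_is_policy). Qed.

Lemma min_lambda_le pi z : is_policy pi ->
  min_lambda_perturbed M u <= perturbed_weight M pi u z.
Proof.
move=> hpi; apply: (@le_trans _ _ (lambda_min (perturbed_diag M u pi))).
  apply: ge_inf; last by exists pi.
  exists 0 => _ [pi' hpi' <-]; apply: (le_lambda_min_diag x0) => y.
  exact: (wt_ge0 hpi').
apply: (lambda_min_diag_le (k := perturbed_weight M pi u)) => y; exact: wt_ge0.
Qed.

Lemma min_lambda_gt0 : 0 < min_lambda_perturbed M u.
Proof.
have [G0 G1] := set_Gamma hS.
have c0 : 0 < (1 - Gamma) * Num.min u (u / 4).
  by rewrite mulr_gt0 ?subr_gt0// lt_min floor_gt0 divr_gt0// floor_gt0.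
apply: lt_le_trans c0 _; apply: lb_le_inf.
  by exists (lambda_min (perturbed_diag M u (@uniform_policy R S A))),
    (@uniform_policy R S A) => //; exact: uniform_is_policy.
move=> _ [pi hpi <-]; apply: (le_lambda_min_diag x0) => y.
have hst := stationary_spec hE hpi.
apply: ler_pM; [by rewrite subr_ge0 ltW| |exact: (set_stationary hS)|].
  by rewrite le_min ltW ?floor_gt0// divr_ge0// ltW// floor_gt0.
exact: (perturbed_ge hpi hst (floor_gt0) (beta_gap_le2 hpi) (floor_small hpi)).
Qed.

Lemma min_lambda_le1 : min_lambda_perturbed M u <= 1.
Proof.
apply: le_trans (min_lambda_le x0 uniform_is_policy) _.
exact: simplex_le1 (wt_simplex uniform_is_policy).
Qed.

(* On a single state a deterministic policy is supported on one pair, where a nonzero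
   feature could be scaled to the value 1. *)
Lemma exists_other_state s : exists s' : S, s' != s.
Proof.
apply/existsP; apply: contraT; rewrite negb_exists => /forallP h.
have hs s' : s' = s by apply/eqP; have := h s'; rewrite negbK.
case: (set_features hS) => d0 rk _ ft.
have z0 v a : coord (Psi *m v) (s, a) = 0.
  apply/eqP; apply: contraT => c0.
  pose pi (s' : S) (a' : A) : R := (a' == a)%:R.
  have hpi : is_policy pi.
    move=> s'; split=> [a'|]; first by rewrite ler0n.
    by rewrite /pi (bigD1 a)//= big1 ?addr0 ?eqxx// => a' /negbTE ->.
  case: (ft pi hpi ((coord (Psi *m v) (s, a))^-1 *: v)) => s' a'.
  rewrite /pi; case: eqP => [->|_]; last by rewrite ltxx.
  by move=> _; rewrite (hs s') /coord -scalemxAr mxE mulVf.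
have P0 : Psi = 0.
  apply/matrixP => i j; rewrite mxE.
  have := z0 (delta_mx j 0) (enum_val i).2.
  rewrite /coord -colE mxE -[X in enum_rank (X, _)](hs (enum_val i).1).
  by rewrite -surjective_pairing enum_valK.
by move: rk d0; rewrite P0 mxrank0 => <-.
Qed.

End Setting.

(** * Sampling along a trajectory *)

Section Trajectory.
Variables (R : realType) (S A : finType) (M : amdp R S A) (pi : S -> A -> R) (u : R).
Hypotheses (hM : is_amdp M) (hpi : is_policy pi) (hpert : is_policy (perturbed u pi))
  (hst : is_stationary M pi (stationary M pi)).

Lemma expect_step x (F : position S A -> R) :
  expect (step M pi x) F =
  pair_op M pi (fun y => F (y, x.2.+1)) x.1.
Proof.
rewrite expect_bind expect_draw; apply: eq_bigr => s _; congr (_ * _).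
rewrite expect_bind expect_draw; apply: eq_bigr => a _; congr (_ * _).
by rewrite expect_ret.
Qed.

Lemma law_on_step x : law_on (fun y => y.2 = x.2.+1) (step M pi x).
Proof.
apply: (law_on_bind (Q := fun=> True)); first exact: law_on_draw.
move=> s _; apply: (law_on_bind (Q := fun=> True)); first exact: law_on_draw.
by move=> a _; exact: law_on_ret.
Qed.

Lemma expect_walk n x (f : S * A -> R) :
  expect (walk M pi n x) (fun y => f y.1) = iter n (pair_op M pi) f x.1.
Proof.
elim: n x => [|n IH] x /=; first by rewrite expect_ret.
rewrite expect_bind (eq_expect _ (g := fun y => iter n (pair_op M pi) f y.1)).
  by rewrite expect_step.
by move=> y; rewrite IH.
Qed.

Lemma law_on_walk n x : law_on (fun y => y.2 = (x.2 + n)%N) (walk M pi n x).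
Proof.
elim: n x => [|n IH] x /=; first by apply: law_on_ret; rewrite addn0.
apply: law_on_bind (law_on_step x) _ => y ey.
by apply: law_onW (IH y) => z ->; rewrite ey addnS addSn.
Qed.

(** The law of a sampled tuple if the trajectory were stationary; dependent samples are compared
    with it. *)
Definition ideal : law R ((S * A) * (S * A)) :=
  z <~ draw (perturbed_weight M pi u) ;;
  s <~ draw (trans M z.1 z.2) ;;
  a <~ draw (pi s) ;;
  ret R (z, (s, a)).

Lemma expect_ideal F : expect ideal F =
  \sum_z perturbed_weight M pi u z * pair_op M pi (fun y => F (z, y)) z.
Proof.
rewrite expect_bind expect_draw; apply: eq_bigr => z _; congr (_ * _).
rewrite expect_bind expect_draw; apply: eq_bigr => s _; congr (_ * _).
rewrite expect_bind expect_draw; apply: eq_bigr => a _; congr (_ * _).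
by rewrite expect_ret.
Qed.

Lemma law_on_ideal : simplex (perturbed_weight M pi u) -> law_on (fun=> True) ideal.
Proof.
move=> hw; apply: (law_on_bind (Q := fun=> True)); first exact: law_on_draw.
move=> z _; apply: (law_on_bind (Q := fun=> True)); first exact: law_on_draw.
move=> s _; apply: (law_on_bind (Q := fun=> True)); first exact: law_on_draw.
by move=> a _; exact: law_on_ret.
Qed.

Lemma law_on_sample tau x :
  law_on (fun z => z.2.2 = (x.2 + tau.+1)%N) (sample M u pi tau x).
Proof.
apply: law_on_bind (law_on_walk tau x) _ => y ey.
apply: (law_on_bind (Q := fun=> True)); first exact: law_on_draw.
move=> a _; apply: law_on_bind (law_on_step _) _ => z ez.
by apply: law_on_ret; rewrite /= ez /= ey addnS.
Qed.

(** Mixing in the form needed for dependent samples: uniform over the starting position, tested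
    against bounded functions. *)
Definition cost_mixed (tau : nat) (delta : R) : Prop :=
  forall x (f : S * A -> R) B, (forall z, `|f z| <= B) ->
  `|expect (walk M pi tau x) (fun y => f y.1) - state_avg M pi (action_avg pi f)|
    <= delta * B.

Definition sample_mixed (tau : nat) (delta : R) : Prop :=
  forall x (F : (S * A) * (S * A) -> R) B, (forall xi, `|F xi| <= B) ->
  `|expect (sample M u pi tau x) (fun z => F z.1) - expect ideal F| <= delta * B.

(** Sampling replaces the pending action, so the tuple depends on the past through the reached state
    only; the test function is averaged into a function [H] of that state. *)
Lemma cost_mixed_sample tau delta : cost_mixed tau delta -> sample_mixed tau delta.
Proof.
move=> h x F B FB.
pose H s := \sum_a perturbed u pi s a * pair_op M pi (fun y => F ((s, a), y)) (s, a).
have HB s : `|H s| <= B.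
  apply: simplex_wsum_le => // a; apply: simplex_wsum_le; first exact: hM.
  by move=> s'; apply: simplex_wsum_le.
have := h x (fun z => H z.1) B (fun z => HB z.1).
have -> : state_avg M pi (action_avg pi (fun z => H z.1)) = expect ideal F.
  rewrite expect_ideal sum_pair; apply: eq_bigr => s _.
  rewrite /action_avg /= -mulr_suml (proj2 (hpi s)) mul1r /H mulr_sumr.
  by apply: eq_bigr => a _; rewrite /perturbed_weight mulrA.
suff -> : expect (sample M u pi tau x) (fun z => F z.1) =
    expect (walk M pi tau x) (fun y => H y.1.1) by [].
rewrite expect_bind; apply: eq_expect => y.
rewrite expect_bind expect_draw; apply: eq_bigr => a _; congr (_ * _).
rewrite expect_bind (eq_expect _ (g := fun z => F ((y.1.1, a), z.1))).
  by rewrite expect_step.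
by move=> z; rewrite expect_ret.
Qed.

Lemma walk_mixed t0 tau : (forall q : S -> R, simplex q ->
    l1norm ((state_mx M pi ^+ t0)^T *m vec_of q - vec_of (stationary M pi)) <= 2^-1) ->
  cost_mixed tau.+1 (2 * 2^-1 ^+ (tau %/ t0)).
Proof.
move=> mix x f B fB; rewrite expect_walk mulrAC.
exact: pair_mixing.
Qed.

End Trajectory.

(** * Moments of the temporal-difference operator under the ideal law *)

Section PolicyEvaluation.
Variables (R : realType) (S A : finType) (M : amdp R S A) (d : nat)
  (Psi : 'M[R]_(#|{: S * A}|, d)) (u Gamma mubar kappa cbar : R) (x0 : S * A).
Hypothesis hS : setting M Psi u Gamma mubar kappa cbar.
Variable pi : S -> A -> R.
Hypothesis hpi : is_policy pi.
Implicit Types (v w e : 'cV[R]_d) (xi : (S * A) * (S * A)) (x : position S A).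

Let hM := set_amdp hS.
Let hE := set_ergodic hS.
Let hst := stationary_spec hE hpi.
Let hpert := perturbed_is_policy hS hpi.
Local Notation b := (tbeta_gap M Psi u pi).
Local Notation m := (mu M Psi u pi).
Local Notation wt := (perturbed_weight M pi u).
Local Notation G := (gram_norm M Psi u pi).
Local Notation th := (td_solution M Psi u pi).
Local Notation Am := (td_mx M Psi u pi).
Local Notation E F := (expect (ideal M pi u) F).

Let hI : law_on (fun=> True) (ideal M pi u) := law_on_ideal hM hpi (wt_simplex hS hpi).

Definition td_incr xi v : 'cV[R]_d :=
  dot (psi Psi xi.1 - psi Psi xi.2) v *: psi Psi xi.1.

Definition td_residual xi : 'cV[R]_d :=
  (dot (psi Psi xi.1 - psi Psi xi.2) th - rel_cost M pi xi.1) *: psi Psi xi.1.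

Definition residual_bound : R := eps_approx M Psi u + 22 * cbar * t_mix M.
Local Notation B := residual_bound.

(** A part linear in the error, a noise that is centred under the ideal law, and the error of the
    cost estimate. *)
Lemma td_opE theta r xi : td_op M Psi pi theta r xi =
  td_incr xi (theta - th) + td_residual xi + (r - rho M pi) *: psi Psi xi.1.
Proof.
rewrite /td_op /td_incr /td_residual -!scalerDl -dotE dotBr /rel_cost.
by congr (_ *: _); ring.
Qed.

Lemma td_opB theta theta' r xi :
  td_op M Psi pi theta r xi - td_op M Psi pi theta' r xi = td_incr xi (theta - theta').
Proof.
rewrite /td_op /td_incr -scalerBl -!dotE dotBr; congr (_ *: _); ring.
Qed.

Lemma l2norm_psiB z z' : l2norm (psi Psi z - psi Psi z') <= 2.
Proof.
apply: le_trans (l2normD _ _) _; rewrite l2normN.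
by have := l2norm_psi hS z; have := l2norm_psi hS z'; lra.
Qed.

Lemma scale_psi_le c z : l2norm (c *: psi Psi z) <= `|c|.
Proof. by rewrite l2normZ ler_piMr ?(l2norm_psi hS). Qed.

Lemma td_incr_le xi v : l2norm (td_incr xi v) <= 2 * l2norm v.
Proof.
apply: le_trans (scale_psi_le _ _) _; apply: le_trans (normr_dot_le _ _) _.
by rewrite ler_wpM2r ?l2norm_ge0 ?l2norm_psiB.
Qed.

Lemma td_incr_sqr_le xi v : dot (td_incr xi v) (td_incr xi v) <= 4 * dot v v.
Proof.
rewrite -!sqr_l2norm; have -> : 4 * l2norm v ^+ 2 = (2 * l2norm v) ^+ 2 by ring.
by rewrite ler_pXn2r ?nnegrE ?mulr_ge0 ?l2norm_ge0 ?td_incr_le.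
Qed.

Lemma val_psiB z z' v : dot (psi Psi z - psi Psi z') v =
  coord (Psi *m v) z - coord (Psi *m v) z'.
Proof. by rewrite dotBl !coord_psi. Qed.

Lemma pair_op_affine c c' f z :
  pair_op M pi (fun y => c * (c' - f y)) z = c * (c' - pair_op M pi f z).
Proof.
have -> : c * (c' - pair_op M pi f z) = \sum_s trans M z.1 z.2 s *
    (c * (c' - \sum_a pi s a * f (s, a))).
  rewrite [RHS](eq_bigr (fun s => trans M z.1 z.2 s * (c * c')
     - c * (trans M z.1 z.2 s * \sum_a pi s a * f (s, a)))); last by move=> s _; ring.
  by rewrite sumrB -mulr_suml (proj2 (hM _ _)) -mulr_sumr /pair_op; ring.
apply: eq_bigr => s _; congr (_ * _).
rewrite (eq_bigr (fun a => pi s a * (c * c') - c * (pi s a * f (s, a)))).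
  by rewrite sumrB -mulr_suml (proj2 (hpi s)) -mulr_sumr; ring.
by move=> a _; ring.
Qed.

Lemma expect_td_incr v w : E (fun xi => dot w (td_incr xi v)) = dot w (Am *m v).
Proof.
rewrite expect_ideal dot_td_mx; apply: eq_bigr => z _; congr (_ * _).
rewrite -pair_op_affine; apply: eq_bigr => s _; congr (_ * _).
apply: eq_bigr => a _; congr (_ * _).
by rewrite /td_incr dotZr val_psiB (coord_psi Psi w) (dotC w) /= mulrC.
Qed.

Lemma expect_td_incr_sqr v : E (fun xi => dot (td_incr xi v) (td_incr xi v)) <= 6 * G v.
Proof.
rewrite expect_ideal; apply: le_trans (td_second_moment hS hpi v).
apply: ler_sum => z _; apply: ler_wpM2l; first exact: (wt_ge0 hS hpi).
apply: pair_op_le => // y; rewrite /td_incr dotZl dotZr mulrA -expr2 val_psiB /=.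
by rewrite ler_piMr ?sqr_ge0 ?(dot_psi_le hS).
Qed.

(** Jensen's inequality for a vector-valued mean, obtained by testing the mean against itself. *)
Lemma td_mx_sqr_le v : dot (Am *m v) (Am *m v) <= 6 * G v.
Proof.
have h := expect_td_incr v (Am *m v).
have : dot (Am *m v) (Am *m v) <=
    2^-1 * dot (Am *m v) (Am *m v) + 2^-1 * (6 * G v).
  rewrite -{1}h; apply: (@le_trans _ _ (E (fun xi => 2^-1 * dot (Am *m v) (Am *m v)
    + 2^-1 * dot (td_incr xi v) (td_incr xi v)))).
    apply: expect_le hI _ => xi _.
    have := dot_ge0 (Am *m v - td_incr xi v).
    by rewrite dotBl !dotBr (dotC (td_incr xi v) (Am *m v)); lra.
  rewrite expectD (expect_cst _ hI) expectZ.
  by have := expect_td_incr_sqr v; lra.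
lra.
Qed.

Lemma expect_td_residual w : E (fun xi => dot w (td_residual xi)) = 0.
Proof.
have -> : E (fun xi => dot w (td_residual xi)) =
    dot w (Am *m th) - \sum_z wt z * (coord (Psi *m w) z * rel_cost M pi z).
  rewrite -expect_td_incr !expect_ideal -sumrB; apply: eq_bigr => z _.
  rewrite -mulrBr; congr (_ * _).
  transitivity (pair_op M pi (fun y => coord (Psi *m w) z *
    (coord (Psi *m th) z - rel_cost M pi z - coord (Psi *m th) y)) z).
    apply: eq_bigr => s _; congr (_ * _); apply: eq_bigr => a _; congr (_ * _).
    by rewrite /td_residual dotZr val_psiB (coord_psi Psi w) (dotC w) /=; ring.
  rewrite pair_op_affine.
  transitivity (pair_op M pi (fun y => coord (Psi *m w) z *
    (coord (Psi *m th) z - coord (Psi *m th) y)) z - coord (Psi *m w) z * rel_cost M pi z).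
    by rewrite pair_op_affine; ring.
  congr (_ - _); apply: eq_bigr => s _; congr (_ * _); apply: eq_bigr => a _.
  by congr (_ * _); rewrite /td_incr dotZr val_psiB (coord_psi Psi w) (dotC w) /= mulrC.
by rewrite mulKVmx ?(td_mx_unit hS hpi)// dot_td_rhs subrr.
Qed.

Lemma cbar_gt0 : 0 < cbar. Proof. by case: (set_pos hS). Qed.
Lemma t_mix_ge1_of : 1 <= t_mix M. Proof. exact: (t_mix_ge1 hE hpi). Qed.

Lemma residual_bound_ge : 22 * cbar <= B.
Proof.
have := eps_approx_ge0 x0 hS; have := cbar_gt0 => c0.
have := ler_wpM2l (ltW c0) t_mix_ge1_of; rewrite /B; lra.
Qed.

Lemma residual_bound_gt0 : 0 < B.
Proof. by apply: lt_le_trans residual_bound_ge; have := cbar_gt0; lra. Qed.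

(** Differences of the solution are within [eps_approx] of those of [Qbar], which are at most
    [20 * cbar * t_mix]; the relative cost adds [2 * cbar]. Going through [td_solution_le] would
    instead cost a factor [mubar^-1]. *)
Lemma td_residual_le xi : l2norm (td_residual xi) <= B.
Proof.
apply: le_trans (scale_psi_le _ _) _; rewrite val_psiB.
set X := coord (Psi *m th); set Q := Qbar M pi; set z := xi.1; set y := xi.2.
have e := eps_approx_ge x0 hS hpi.
have h1 := le_trans (le_spnorm (fun z => X z - Q z) z y) e.
have h2 := le_trans (le_spnorm (fun z => X z - Q z) y z) e.
have q1 := Qbar_le hM hE (set_cost hS) z hpi.
have q2 := Qbar_le hM hE (set_cost hS) y hpi.
have c1 := rel_cost_le hE (set_cost hS) z hpi.
rewrite -/Q in q1 q2; have c0 := ler_wpM2l (ltW cbar_gt0) t_mix_ge1_of.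
move: q1 q2 c1; rewrite !ler_norml /B => /andP[? ?] /andP[? ?] /andP[? ?].
by apply/andP; split; lra.
Qed.

Definition mean_psi : 'cV[R]_d := \col_i E (fun xi => psi Psi xi.1 i 0).

Lemma expect_psi w : E (fun xi => dot w (psi Psi xi.1)) = dot w mean_psi.
Proof.
rewrite /mean_psi /dot.
rewrite /expect [RHS](eq_bigr (fun i => \sum_(wi <- ideal M pi u)
   wi.1 * (w i 0 * psi Psi wi.2.1 i 0))).
  by rewrite exchange_big /=; apply: eq_bigr => wi _; rewrite mulr_sumr.
by move=> i _; rewrite mxE /expect mulr_sumr; apply: eq_bigr => wi _; rewrite mulrCA.
Qed.

Lemma mean_psi_le : l2norm mean_psi <= 1.
Proof.
have h : dot mean_psi mean_psi <= l2norm mean_psi.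
  rewrite -{1}expect_psi; apply: (expect_le_cst hI) => xi _.
  apply: le_trans (ler_norm _) _; apply: le_trans (normr_dot_le _ _) _.
  by rewrite ler_piMr ?l2norm_ge0 ?(l2norm_psi hS).
move: h; rewrite -sqr_l2norm expr2; have := l2norm_ge0 mean_psi.
set t := l2norm _ => t0 h; rewrite leNgt; apply/negP => t1.
have : t < t * t by rewrite ltr_pMr//; lra.
by rewrite ltNge h.
Qed.

End PolicyEvaluation.

(** * Counts of transitions and moments of sums of dependent samples *)

Section Sampling.
Variables (R : realType) (S A : finType) (M : amdp R S A) (d : nat)
  (Psi : 'M[R]_(#|{: S * A}|, d)) (u Gamma mubar kappa cbar : R) (x0 : S * A).
Hypothesis hS : setting M Psi u Gamma mubar kappa cbar.
Variable pi : S -> A -> R.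
Hypothesis hpi : is_policy pi.
Implicit Types (v w e : 'cV[R]_d) (xi : (S * A) * (S * A)) (x : position S A).

Let hM := set_amdp hS.
Let hE := set_ergodic hS.
Let hpert := perturbed_is_policy hS hpi.
Local Notation E F := (expect (ideal M pi u) F).

Let hI : law_on (fun=> True) (ideal M pi u) := law_on_ideal hM hpi (wt_simplex hS hpi).

Lemma law_on_cost_sum tau n x :
  law_on (fun y => y.2.2 = (x.2 + n * tau.+1)%N) (cost_sum M pi tau n x).
Proof.
elim: n x => [|n IH] x; first by apply: law_on_ret; rewrite /= addn0.
apply: law_on_bind (law_on_walk hM hpi tau.+1 x) _ => y ey.
apply: law_on_bind (IH y) _ => r er; apply: law_on_ret.
by rewrite /= er ey mulSn addnA.
Qed.

Lemma law_on_td_sum tau theta r n x :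
  law_on (fun y => y.2.2 = (x.2 + n * tau.+1)%N) (td_sum M Psi u pi tau theta r n x).
Proof.
elim: n x => [|n IH] x; first by apply: law_on_ret; rewrite /= addn0.
apply: law_on_bind (law_on_sample hM hpi hpert tau x) _ => y ey.
apply: law_on_bind (IH y.2) _ => g eg; apply: law_on_ret.
by rewrite /= eg ey mulSn addnA.
Qed.

Lemma law_on_td_iterates tau eta r tth ghat n theta x :
  law_on (fun y => y.2.2 = (x.2 + n * tau.+1)%N)
    (td_iterates M Psi u pi tau eta r tth ghat n theta x).
Proof.
elim: n theta x => [|n IH] theta x; first by apply: law_on_ret; rewrite /= addn0.
apply: law_on_bind (law_on_sample hM hpi hpert tau x) _ => y ey.
apply: law_on_bind (IH _ y.2) _ => g eg; apply: law_on_ret.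
by rewrite /= eg ey mulSn addnA.
Qed.

Definition epoch_length (prm : evrtd_params R) : nat :=
  (p_N' prm * (p_tau' prm).+1 + p_N prm * (p_tau' prm).+1 + p_T prm * (p_tau prm).+1)%N.

Lemma law_on_epoch prm tth x :
  law_on (fun y => y.2.2 = (x.2 + epoch_length prm)%N) (epoch M Psi u pi prm tth x).
Proof.
apply: law_on_bind (law_on_cost_sum _ _ x) _ => y ey.
apply: law_on_bind (law_on_td_sum _ _ _ _ y.2) _ => g eg.
apply: law_on_bind (law_on_td_iterates _ _ _ _ _ _ _ g.2) _ => z ez.
by apply: law_on_ret; rewrite /= ez eg ey /epoch_length !addnA.
Qed.

Lemma law_on_epochs prm n theta x :
  law_on (fun y => y.2.2 = (x.2 + n * epoch_length prm)%N)
    (epochs M Psi u pi prm n theta x).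
Proof.
elim: n theta x => [|n IH] theta x; first by apply: law_on_ret; rewrite /= addn0.
apply: law_on_bind (law_on_epoch prm theta x) _ => y ey.
by apply: law_onW (IH y.1 y.2) => z ->; rewrite ey mulSn addnA.
Qed.

Lemma law_on_evrtd prm theta x :
  law_on (fun y => y.2.2 = (x.2 + p_epochs prm * epoch_length prm)%N)
    (evrtd M Psi u pi prm theta x).
Proof. exact: law_on_epochs. Qed.

Variables (tau : nat) (delta : R).
Hypothesis hd0 : 0 <= delta.

Section CostSum.
Hypothesis mixc : cost_mixed M pi tau.+1 delta.
Let K := 2 * cbar.

Let expect_rel_cost x :
  `|expect (walk M pi tau.+1 x) (fun y => rel_cost M pi y.1)| <= delta * K.
Proof.
have h := mixc x (fun z => rel_cost_le hE (set_cost hS) z hpi).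
by rewrite (rel_cost_avg hE hpi) subr0 in h.
Qed.

Lemma cost_sumS n x (F : R -> R) :
  expect (cost_sum M pi tau n.+1 x) (fun y => F (y.1 - n.+1%:R * rho M pi)) =
  expect (walk M pi tau.+1 x) (fun y => expect (cost_sum M pi tau n y)
    (fun r => F (rel_cost M pi y.1 + (r.1 - n%:R * rho M pi)))).
Proof.
rewrite expect_bind; apply: eq_expect => y; rewrite expect_bind; apply: eq_expect => r.
by rewrite expect_ret /= /rel_cost -natr1; congr F; ring.
Qed.

Lemma cost_sum_mean n x :
  `|expect (cost_sum M pi tau n x) (fun y => y.1 - n%:R * rho M pi)| <= n%:R * (delta * K).
Proof.
elim: n x => [|n IH] x; first by rewrite expect_ret /= !mul0r subrr normr0.
rewrite (cost_sumS n x id) /=.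
under eq_expect do rewrite expectD (expect_cst _ (law_on_cost_sum _ _ _)).
rewrite expectD -natr1 mulrDl mul1r addrC; apply: le_trans (ler_normD _ _) _.
apply: lerD; last exact: expect_rel_cost.
by apply: (ler_norm_expect_cst (law_on_walk hM hpi tau.+1 x)) => y _; exact: IH.
Qed.

(** Given the first summand, the others have a conditional mean of at most [n * delta * K]. The
    cross terms thus carry a factor [delta], and the rest grows linearly as for independent
    draws. *)
Lemma cost_sum_var n x :
  expect (cost_sum M pi tau n x) (fun y => (y.1 - n%:R * rho M pi) ^+ 2) <=
  n%:R * K ^+ 2 + n%:R ^+ 2 * (delta * K ^+ 2).
Proof.
have K0 : 0 <= K by rewrite /K; have := cbar_gt0 hS; lra.
elim: n x => [|n IH] x.
  by rewrite expect_ret /= !mul0r subrr !expr0n /= !mul0r addr0.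
rewrite (cost_sumS n x (fun t => t ^+ 2)).
apply: (@le_trans _ _ (expect (walk M pi tau.+1 x)
  (fun=> K ^+ 2 + 2 * (K * (n%:R * (delta * K))) +
     (n%:R * K ^+ 2 + n%:R ^+ 2 * (delta * K ^+ 2))))); last first.
  rewrite (expect_cst _ (law_on_walk hM hpi tau.+1 x)) -natr1.
  have : 0 <= delta * K ^+ 2 by rewrite mulr_ge0 ?sqr_ge0.
  by lra.
apply: expect_le (law_on_walk hM hpi tau.+1 x) _ => y _.
set a := rel_cost M pi y.1.
have aK : `|a| <= K := rel_cost_le hE (set_cost hS) _ hpi.
have -> : expect (cost_sum M pi tau n y) (fun r => (a + (r.1 - n%:R * rho M pi)) ^+ 2) =
    a ^+ 2 + 2 * (a * expect (cost_sum M pi tau n y) (fun r => r.1 - n%:R * rho M pi))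
     + expect (cost_sum M pi tau n y) (fun r => (r.1 - n%:R * rho M pi) ^+ 2).
  rewrite -[a ^+ 2](expect_cst _ (law_on_cost_sum tau n y)) -!expectZ -!expectD.
  by apply: eq_expect => r; ring.
apply: lerD (IH y); apply: lerD.
  by rewrite -[a ^+ 2]real_normK ?num_real// ler_pXn2r ?nnegrE.
rewrite ler_pM2l//; apply: le_trans (ler_norm _) _; rewrite normrM.
by apply: ler_pM => //; exact: cost_sum_mean.
Qed.

End CostSum.

Section TdSum.
Hypothesis mix : sample_mixed M pi u tau delta.
Variables (theta : 'cV[R]_d) (r : R) (c : 'cV[R]_d) (Bf V : R).
Let f xi := td_op M Psi pi theta r xi - c.
Hypotheses (fB : forall xi, l2norm (f xi) <= Bf)
  (f0 : forall w, E (fun xi => dot w (f xi)) = 0)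
  (fV : E (fun xi => dot (f xi) (f xi)) <= V).

Let Bf0 : 0 <= Bf.
Proof. by apply: le_trans (fB (x0, x0)); exact: l2norm_ge0. Qed.

Local Notation tdsum n x := (td_sum M Psi u pi tau theta r n x).
Local Notation smp x := (sample M u pi tau x).

Lemma td_sumS n x (F : 'cV[R]_d -> R) :
  expect (tdsum n.+1 x) (fun y => F (y.1 - n.+1%:R *: c)) =
  expect (smp x) (fun z => expect (tdsum n z.2) (fun g => F (f z.1 + (g.1 - n%:R *: c)))).
Proof.
rewrite expect_bind; apply: eq_expect => y; rewrite expect_bind; apply: eq_expect => g.
rewrite expect_ret /= /f -natr1 scalerDl scale1r; congr F.
by rewrite opprD [- _ - c]addrC addrACA.
Qed.

Lemma td_sum_mean w n x :
  `|expect (tdsum n x) (fun y => dot w (y.1 - n%:R *: c))| <= n%:R * (delta * Bf) * l2norm w.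
Proof.
elim: n x => [|n IH] x; first by rewrite expect_ret /= scale0r subr0 dot0r normr0 !mul0r.
rewrite (td_sumS n x (dot w)) /=.
under eq_expect do under eq_expect do rewrite dotDr.
under eq_expect do rewrite expectD (expect_cst _ (law_on_td_sum _ _ _ _ _)).
rewrite expectD -natr1 mulrDl mulrDl mul1r addrC; apply: le_trans (ler_normD _ _) _.
apply: lerD; last first.
  have h xi : `|dot w (f xi)| <= l2norm w * Bf.
    by apply: le_trans (normr_dot_le _ _) _; rewrite ler_wpM2l ?l2norm_ge0.
  have := mix x h; rewrite f0 subr0 => hh; apply: le_trans hh _.
  by rewrite mulrCA mulrC.
by apply: (ler_norm_expect_cst (law_on_sample hM hpi hpert tau x)) => y _; exact: IH.
Qed.

(** As for the costs, except that the second moment of one term is also compared with its ideal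
    value: the term linear in [n] then has the coefficient [V], which is small near the solution up
    to the residual, and not [Bf ^+ 2]. *)
Lemma td_sum_var n x :
  expect (tdsum n x) (fun y => dot (y.1 - n%:R *: c) (y.1 - n%:R *: c)) <=
  n%:R * V + n%:R ^+ 2 * (delta * Bf ^+ 2).
Proof.
elim: n x => [|n IH] x.
  by rewrite expect_ret /= scale0r subr0 dot0r !expr0n /= !mul0r addr0.
rewrite (td_sumS n x (fun t => dot t t)).
apply: (@le_trans _ _ (expect (smp x)
  (fun z => dot (f z.1) (f z.1) + (2 * (Bf * (n%:R * (delta * Bf))) +
     (n%:R * V + n%:R ^+ 2 * (delta * Bf ^+ 2)))))); last first.
  rewrite expectD (expect_cst _ (law_on_sample hM hpi hpert tau x)) -natr1.
  have h xi : `|dot (f xi) (f xi)| <= Bf ^+ 2.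
    by rewrite ger0_norm ?dot_ge0// -sqr_l2norm ler_pXn2r ?nnegrE ?l2norm_ge0.
  have := mix x h; rewrite ler_norml => /andP[_].
  have : 0 <= delta * Bf ^+ 2 by rewrite mulr_ge0 ?sqr_ge0.
  have := fV; lra.
apply: expect_le (law_on_sample hM hpi hpert tau x) _ => z _.
have := fB z.1; move: (f z.1) => a aB.
have -> : expect (tdsum n z.2) (fun g => dot (a + (g.1 - n%:R *: c)) (a + (g.1 - n%:R *: c))) =
    dot a a + (2 * expect (tdsum n z.2) (fun g => dot a (g.1 - n%:R *: c))
     + expect (tdsum n z.2) (fun g => dot (g.1 - n%:R *: c) (g.1 - n%:R *: c))).
  rewrite -[dot a a](expect_cst _ (law_on_td_sum tau theta r n z.2)) -!expectZ -!expectD.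
  apply: eq_expect => g /=; move: (g.1 - _) => q; rewrite dotDl !dotDr (dotC q a); ring.
rewrite lerD2l; apply: lerD (IH z.2).
rewrite ler_pM2l//; apply: le_trans (ler_norm _) _; apply: le_trans (td_sum_mean _ _ _) _.
by rewrite mulrC ler_wpM2r// !mulr_ge0.
Qed.

End TdSum.

End Sampling.

(** * Variance-reduced temporal differences *)

Section Iterates.
Variables (R : realType) (S A : finType) (M : amdp R S A) (d : nat)
  (Psi : 'M[R]_(#|{: S * A}|, d)) (u Gamma mubar kappa cbar : R) (x0 : S * A).
Hypothesis hS : setting M Psi u Gamma mubar kappa cbar.
Variable pi : S -> A -> R.
Hypothesis hpi : is_policy pi.
Implicit Types (v w e : 'cV[R]_d) (xi : (S * A) * (S * A)) (x : position S A).

Let hM := set_amdp hS.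
Let hE := set_ergodic hS.
Let hpert := perturbed_is_policy hS hpi.
Local Notation b := (tbeta_gap M Psi u pi).
Local Notation m := (mu M Psi u pi).
Local Notation G := (gram_norm M Psi u pi).
Local Notation th := (td_solution M Psi u pi).
Local Notation Am := (td_mx M Psi u pi).
Local Notation E F := (expect (ideal M pi u) F).

Lemma val_linear c v w z : coord (Psi *m (c *: v + w)) z =
  c * coord (Psi *m v) z + coord (Psi *m w) z.
Proof. by rewrite /coord mulmxDr -scalemxAr !mxE. Qed.

Lemma valD v w z : coord (Psi *m (v + w)) z = coord (Psi *m v) z + coord (Psi *m w) z.
Proof. by rewrite -{1}[v]scale1r val_linear mul1r. Qed.

Lemma gramZ c v : G (c *: v) = c ^+ 2 * G v.
Proof.
rewrite /gram_norm /sqnorm mulr_sumr; apply: eq_bigr => z _.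
by rewrite /coord -scalemxAr mxE exprMn mulrCA.
Qed.

(** [G (v + w) / (n + 1) <= G v + G w / n] cleared of denominators. Iterated, it bounds [G] of a sum
    of [n] vectors by [n] times the sum of their [G]. *)
Lemma gram_cons (n : nat) v w :
  n%:R * G (v + w) <= n.+1%:R * (n%:R * G v + G w).
Proof.
rewrite /gram_norm /sqnorm !mulr_sumr -big_split mulr_sumr; apply: ler_sum => z _ /=.
rewrite valD; move: (coord _ z) (coord _ z) => q p.
have := wt_ge0 hS hpi z; move: (perturbed_weight _ _ _ _) => k k0.
have -> : n.+1%:R * (n%:R * (k * p ^+ 2) + k * q ^+ 2) =
    n%:R * (k * (p + q) ^+ 2) + k * (n%:R * p - q) ^+ 2 by rewrite -natr1; ring.
by rewrite lerDl mulr_ge0 ?sqr_ge0.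
Qed.

Lemma gramD v w : G (v + w) <= 2 * G v + 2 * G w.
Proof. by have := gram_cons 1 v w; lra. Qed.

Lemma gramB v w : G (v - w) <= 2 * G v + 2 * G w.
Proof.
apply: le_trans (gramD _ _) _.
by rewrite -scaleN1r gramZ sqrrN expr1n mul1r.
Qed.

Variables (tau : nat) (delta eta : R).
Hypotheses (hd0 : 0 <= delta) (hd : delta <= m ^+ 2 * b ^+ 2 / 512 / 64)
  (mix : sample_mixed M pi u tau delta) (eta0 : 0 < eta) (eta_le : eta <= b / 128 / 64).

Let b0 : 0 < b := tbeta_gt0 hS hpi.
Let b1 : b <= 8^-1 := tbeta_le hS hpi.
Let m0 : 0 < m := mu_gt0 hS hpi.
Let m1 : m <= 1 := mu_le1 hS hpi.

(** Mixing errors come in the Euclidean norm and must be paid in [G]; the conversion costs [m^-1],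
    which the factor [m ^+ 2] in the bound on [delta] provides for. *)
Lemma delta_dot_le v : delta * dot v v <= b / 512 / 64 * G v.
Proof.
have mb1 : m * b <= 1.
  have := ler_wpM2l (ltW m0) b1; have := m1; lra.
have h : delta <= m * (b / 512 / 64).
  have mb0 : 0 <= m * b by rewrite mulr_ge0// ltW.
  by apply: le_trans hd _; have := ler_wpM2l mb0 mb1; lra.
have := ler_wpM2r (dot_ge0 v) h; have := ler_wpM2l (ltW b0) (mu_gram hS hpi v); lra.
Qed.

Definition drift e := e - eta *: (Am *m e).

(** Coercivity gains [eta * b * G e], and the bound on [eta] keeps the quadratic term below half of
    it. *)
Lemma drift_le e : dot (drift e) (drift e) <= dot e e - eta * b / 2 * G e.
Proof.
rewrite /drift dotBl !dotBr !dotZl !dotZr (dotC (Am *m e) e).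
have h1 := ler_wpM2l (ltW eta0) (td_coercive hS hpi e).
have h2 := ler_wpM2l (sqr_ge0 eta) (td_mx_sqr_le hS hpi e).
have g0 := gram_ge0 hS hpi e.
have h3 := ler_wpM2l (mulr_ge0 (ltW eta0) g0) eta_le.
have h4 : 0 <= eta * b * G e by rewrite !mulr_ge0// ltW.
lra.
Qed.

Variables (ttheta ghat : 'cV[R]_d) (r : R).
Local Notation e1 := (ttheta - th).
Local Notation werr := (ghat - Am *m e1).

Definition next_err e xi : 'cV[R]_d := e - eta *: (td_incr Psi xi (e - e1) + ghat).

Definition step_const : R :=
  eta * b / 64 * G e1 + 5 * eta / (b * m) * dot werr werr.

Lemma step_const_ge0 : 0 <= step_const.
Proof.
have b0' := b0; have m0' := m0.
by rewrite addr_ge0// !mulr_ge0 ?dot_ge0 ?(gram_ge0 hS hpi) ?invr_ge0 ?mulr_ge0// ltW.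
Qed.

(** Under the ideal law the direction has mean [Am *m e + werr]: the control variate at [ttheta]
    cancels. Its second moment involves only [G e] and [G e1], not the residual, up to the noise of
    [ghat]; the factor [eta ^+ 2] makes both small against the gain of coercivity. *)
Lemma step_le e x :
  expect (sample M u pi tau x) (fun z => dot (next_err e z.1) (next_err e z.1)) <=
  dot e e - eta * b / 2 * G e + step_const.
Proof.
set q := e - e1; set W := dot werr werr.
have lx := law_on_sample hM hpi hpert tau x.
pose D xi := td_incr Psi xi q.
have hgh : ghat = Am *m e1 + werr by rewrite addrC subrK.
apply: (@le_trans _ _ (expect (sample M u pi tau x) (fun z =>
  (dot e e - 2 * eta * dot e ghat + 3 * eta ^+ 2 * (dot (Am *m e1) (Am *m e1) + W))
   + (- (2 * eta) * dot e (D z.1) + 3 * eta ^+ 2 * dot (D z.1) (D z.1))))).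
  apply: expect_le lx _ => z _; rewrite /next_err -/q -/(D z.1); move: (D z.1) => D1.
  have := dotD3_le D1 (Am *m e1) werr; rewrite -addrA -hgh -/W => h.
  have := ler_wpM2l (sqr_ge0 eta) h.
  rewrite dotBl !dotBr !dotZl !dotZr (dotC (D1 + ghat) e) dotDr; lra.
rewrite expectD (expect_cst _ lx) expectD !expectZ.
have hq : l2norm e * l2norm q * 2 <= 3 * dot e e + 2 * dot e1 e1.
  have := dotD_le e (- e1); rewrite dotNl dotNr opprK -/q -!sqr_l2norm.
  have := sqr_ge0 (l2norm e - l2norm q); lra.
have c1 : `|expect (sample M u pi tau x) (fun z => dot e (D z.1)) - dot e (Am *m q)|
    <= delta * (2 * l2norm e * l2norm q).
  rewrite -(expect_td_incr hS hpi q e); apply: (mix x) => xi.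
  apply: le_trans (normr_dot_le _ _) _.
  by have := ler_wpM2l (l2norm_ge0 e) (td_incr_le hS xi q); lra.
have c2 : `|expect (sample M u pi tau x) (fun z => dot (D z.1) (D z.1)) -
    E (fun xi => dot (D xi) (D xi))| <= delta * (4 * dot q q).
  have h xi : `|dot (D xi) (D xi)| <= 4 * dot q q.
    by rewrite ger0_norm ?dot_ge0//; exact: (td_incr_sqr_le hS).
  exact: (mix x h).
have c3 := expect_td_incr_sqr hS hpi q.
have c4 := td_mx_sqr_le hS hpi e1.
have c5 := td_coercive hS hpi e.
have c6 : dot e (Am *m q) + dot e ghat = dot e (Am *m e) + dot e werr.
  by rewrite -!dotDr; congr (dot e _); rewrite /q mulmxBr {1}hgh addrA subrK.
(* This weight turns [dot e e] into at most [b / 4 * G e], half of the coercivity term, and leaves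
   the noise divided by [b * m]. *)
have bm0 : 0 < b * m / 4 by rewrite divr_gt0// mulr_gt0.
have c7 := dot_young e werr bm0.
have g0 := gram_ge0 hS hpi e; have g1 := gram_ge0 hS hpi e1.
have c8 := gramB e e1; rewrite -/q in c8.
have dq := delta_dot_le q; have de := delta_dot_le e; have de1 := delta_dot_le e1.
have gq := gram_ge0 hS hpi q.
have W0 : 0 <= W := dot_ge0 _.
have l1 : - (expect (sample M u pi tau x) (fun z => dot e (D z.1))) - dot e ghat <=
    - (b / 2 * G e) + `|dot e werr| + b / 512 / 64 * (3 * G e + 2 * G e1).
  have hd' := ler_wpM2l hd0 hq.
  move: c1; rewrite ler_norml => /andP[c1 _].
  have := ler_norm (- dot e werr); rewrite normrN; lra.
have l2 : 2 * `|dot e werr| <= b / 4 * G e + 4 * (W / (b * m)).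
  apply: le_trans c7 _; rewrite -/W invf_div; apply: lerD; last by lra.
  have := ler_wpM2l (ltW b0) (mu_gram hS hpi e); lra.
have l3 : expect (sample M u pi tau x) (fun z => dot (D z.1) (D z.1)) <=
    13 * G e + 13 * G e1.
  move: c2; rewrite ler_norml => /andP[_ c2].
  by have := ler_wpM2r gq b1; lra.
have e2 : 3 * eta ^+ 2 <= 3 * eta * (b / 128 / 64).
  by have := ler_wpM2l (ltW eta0) eta_le; lra.
have Z0 : 0 <= W / (b * m) by rewrite divr_ge0// mulr_ge0// ltW.
have WZ : W = b * m * (W / (b * m)) by rewrite mulrCA mulfV ?mulr1// mulf_neq0// gt_eqF.
have bm1 : b * m <= 1 by have := ler_wpM2l (ltW m0) b1; have := m1; lra.
have l4 : b * W <= W / (b * m).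
  have h : W <= W / (b * m) by rewrite {1}WZ ler_piMl.
  by apply: le_trans h; rewrite ler_piMl//; have := b1; lra.
have X0 : 0 <= dot (Am *m e1) (Am *m e1) + W +
    expect (sample M u pi tau x) (fun z => dot (D z.1) (D z.1)).
  by rewrite !addr_ge0 ?dot_ge0// (expect_ge0 lx)// => z _; exact: dot_ge0.
have k1 := ler_wpM2r X0 e2.
have k2 := ler_wpM2l (ltW eta0) l1.
have k3 := ler_wpM2l (ltW eta0) l2.
have eb0 : 0 <= eta * b by rewrite mulr_ge0// ltW.
have k4 := ler_wpM2l eb0 l3.
have k5 := ler_wpM2l eb0 c4.
have k6 := ler_wpM2l (ltW eta0) l4.
have k7 : 0 <= eta * b * G e by rewrite mulr_ge0.
have k8 : 0 <= eta * b * G e1 by rewrite mulr_ge0.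
have k9 : 0 <= eta * (W / (b * m)) by rewrite mulr_ge0// ltW.
rewrite /step_const -/W.
have -> : 5 * eta / (b * m) * W = 5 * (eta * (W / (b * m))) by lra.
move: k1 k2 k3 k4 k5 k6 k7 k8 k9; lra.
Qed.

Local Notation iters n theta x := (td_iterates M Psi u pi tau eta r ttheta ghat n theta x).

Lemma td_iteratesS n theta x (F : 'cV[R]_d -> R) :
  expect (iters n.+1 theta x) (fun y => F (y.1 - n.+1%:R *: th)) =
  expect (sample M u pi tau x) (fun z =>
    expect (iters n (next_err (theta - th) z.1 + th) z.2)
      (fun y => F ((theta - th) + (y.1 - n%:R *: th)))).
Proof.
rewrite expect_bind; apply: eq_expect => z; rewrite expect_bind.
have -> : theta - eta *: (td_op M Psi pi theta r z.1 - td_op M Psi pi ttheta r z.1 + ghat) =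
    next_err (theta - th) z.1 + th.
  rewrite td_opB /next_err; have -> : theta - th - e1 = theta - ttheta.
    by rewrite opprB addrA subrK.
  by rewrite addrAC subrK.
apply: eq_expect => y; rewrite expect_ret /= -natr1 scalerDl scale1r; congr F.
by rewrite opprD [- _ - th]addrC addrACA.
Qed.

(** Along the iterates [step_le] telescopes the squared norms and leaves the sum of the [G] of the
    errors; by [gram_cons] it dominates [G] of the summed error at the price of a factor [n]. *)
Lemma td_iterates_gram n theta x :
  eta * b / 2 * expect (iters n theta x) (fun y => G (y.1 - n%:R *: th)) <=
  n%:R * (dot (theta - th) (theta - th) + n%:R * step_const).
Proof.
have c0 := step_const_ge0.
have ebp : 0 <= eta * b / 2 by rewrite divr_ge0// mulr_ge0// ltW.
elim: n theta x => [|n IH] theta x.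
  rewrite expect_ret /= scale0r subr0 mul0r.
  by rewrite -(scale0r (0 : 'cV[R]_d)) gramZ expr0n /= mul0r mulr0.
rewrite td_iteratesS; set e := theta - th.
have lx := law_on_sample hM hpi hpert tau x.
have sl := step_le e x.
have [n0|n0] := posnP n.
  subst n; rewrite (eq_expect _ (g := fun=> G e)); last first.
    by move=> z; rewrite expect_ret /= scale0r subr0 addr0.
  rewrite (expect_cst _ lx) !mul1r.
  have : 0 <= expect (sample M u pi tau x) (fun z => dot (next_err e z.1) (next_err e z.1)).
    by apply: (expect_ge0 lx) => z _; exact: dot_ge0.
  lra.
have np : 0 < n%:R :> R by rewrite ltr0n.
rewrite -(ler_pM2l np).
have h : forall z, n%:R * expect (iters n (next_err e z.1 + th) z.2)
     (fun y => G (e + (y.1 - n%:R *: th))) <=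
   n.+1%:R * (n%:R * G e + expect (iters n (next_err e z.1 + th) z.2)
     (fun y => G (y.1 - n%:R *: th))).
  move=> z; have lz := law_on_td_iterates hS hpi tau eta r ttheta ghat n
      (next_err e z.1 + th) z.2.
  rewrite -(expect_cst (n%:R * G e) lz) -expectD -!expectZ.
  by apply: expect_le lz _ => y _; exact: gram_cons.
rewrite mulrCA -expectZ -expectZ.
apply: (@le_trans _ _ (expect (sample M u pi tau x) (fun z => n.+1%:R * n%:R *
   (eta * b / 2 * G e + n%:R * step_const + dot (next_err e z.1) (next_err e z.1))))).
  apply: expect_le lx _ => z _.
  apply: le_trans (ler_wpM2l ebp (h z)) _.
  have := IH (next_err e z.1 + th) z.2; rewrite addrK => h'.
  by have := ler_wpM2l (ler0n R n.+1) h'; lra.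
rewrite expectZ expectD (expect_cst _ lx).
have nn : 0 <= n.+1%:R * n%:R :> R by rewrite mulr_ge0.
have := ler_wpM2l nn sl; rewrite -natr1; lra.
Qed.

End Iterates.

(** * Mean error of the inner iterates *)

Section IteratesBias.
Variables (R : realType) (S A : finType) (M : amdp R S A) (d : nat)
  (Psi : 'M[R]_(#|{: S * A}|, d)) (u Gamma mubar kappa cbar : R) (x0 : S * A).
Hypothesis hS : setting M Psi u Gamma mubar kappa cbar.
Variable pi : S -> A -> R.
Hypothesis hpi : is_policy pi.
Implicit Types (v w e : 'cV[R]_d) (xi : (S * A) * (S * A)) (x : position S A).

Let hM := set_amdp hS.
Let hpert := perturbed_is_policy hS hpi.
Local Notation b := (tbeta_gap M Psi u pi).
Local Notation m := (mu M Psi u pi).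
Local Notation G := (gram_norm M Psi u pi).
Local Notation th := (td_solution M Psi u pi).
Local Notation Am := (td_mx M Psi u pi).
Local Notation E F := (expect (ideal M pi u) F).

Variables (tau : nat) (delta eta : R).
Hypotheses (hd0 : 0 <= delta) (hd : delta <= m ^+ 2 * b ^+ 2 / 512 / 64)
  (mix : sample_mixed M pi u tau delta) (eta0 : 0 < eta) (eta_le : eta <= b / 128 / 64).

Let b0 : 0 < b := tbeta_gt0 hS hpi.

(* For exact mean updates with constant noise [w], the sum of the errors of [n] iterates
   started at [e] is [sum_power_mx n *m e + noise_gain_mx n *m w]. *)
Fixpoint sum_power_mx (n : nat) : 'M[R]_d :=
  if n is k.+1 then 1%:M + sum_power_mx k *m (1%:M - eta *: Am) else 0.

Fixpoint noise_gain_mx (n : nat) : 'M[R]_d :=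
  if n is k.+1 then noise_gain_mx k - eta *: sum_power_mx k else 0.

Lemma sum_power_mxS n v :
  sum_power_mx n.+1 *m v = v + sum_power_mx n *m drift M Psi u pi eta v.
Proof. by rewrite /= mulmxDl mul1mx -mulmxA mulmxBl mul1mx -scalemxAl. Qed.

Lemma noise_gain_mxS n v :
  noise_gain_mx n.+1 *m v = noise_gain_mx n *m v - eta *: (sum_power_mx n *m v).
Proof. by rewrite /= mulmxBl -scalemxAl. Qed.

Lemma l2norm_drift_le v : l2norm (drift M Psi u pi eta v) <= l2norm v.
Proof.
rewrite -(@ler_pXn2r _ 2) ?nnegrE ?l2norm_ge0// !sqr_l2norm.
apply: le_trans (drift_le hS hpi eta0 eta_le v) _.
by rewrite gerBl !mulr_ge0 ?(gram_ge0 hS hpi) ?ltW.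
Qed.

Lemma sum_power_mx_le n v : l2norm (sum_power_mx n *m v) <= n%:R * l2norm v.
Proof.
elim: n v => [|n IH] v; first by rewrite mul0mx l2norm0 mul0r.
rewrite sum_power_mxS; apply: le_trans (l2normD _ _) _.
rewrite -natr1 mulrDl mul1r addrC; apply: lerD => //.
by apply: le_trans (IH _) _; rewrite ler_wpM2l ?l2norm_drift_le.
Qed.

Lemma noise_gain_mx_le n v : l2norm (noise_gain_mx n *m v) <= eta * n%:R ^+ 2 * l2norm v.
Proof.
elim: n v => [|n IH] v; first by rewrite mul0mx l2norm0 expr0n /= mulr0 mul0r.
rewrite noise_gain_mxS; apply: le_trans (l2normD _ _) _.
rewrite l2normN l2normZ gtr0_norm//.
have := IH v; have := ler_wpM2l (ltW eta0) (sum_power_mx_le n v).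
have n0 : 0 <= n%:R :> R by [].
have : 0 <= eta * l2norm v by rewrite mulr_ge0 ?l2norm_ge0// ltW.
move=> h; have := mulr_ge0 n0 h; rewrite -natr1; lra.
Qed.

Lemma l2norm_trmx_le (X : 'M[R]_d) k w : 0 <= k ->
  (forall v, l2norm (X *m v) <= k * l2norm v) -> l2norm (X^T *m w) <= k * l2norm w.
Proof.
move=> k0 h; set t := l2norm (X^T *m w).
have : t * t <= l2norm w * (k * t).
  rewrite -expr2 sqr_l2norm -dot_mulmx; apply: le_trans (ler_norm _) _.
  by apply: le_trans (normr_dot_le _ _) _; rewrite ler_wpM2l ?l2norm_ge0.
have t0 : 0 <= t := l2norm_ge0 _.
have [->|tn] := eqVneq t 0; first by rewrite mulr_ge0 ?l2norm_ge0.
have tp : 0 < t by rewrite lt_def tn.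
by move=> h'; rewrite -(ler_pM2r tp); lra.
Qed.

(** Deterministic counterpart of [td_iterates_gram], with [drift_le] instead of [step_le]. *)
Lemma sum_power_mx_gram n v :
  eta * b / 2 * G (sum_power_mx n *m v) <= n%:R * dot v v.
Proof.
have ebp : 0 <= eta * b / 2 by rewrite divr_ge0// mulr_ge0// ltW.
elim: n v => [|n IH] v.
  rewrite mul0mx mul0r -(scale0r (0 : 'cV[R]_d)) gramZ expr0n /= mul0r mulr0//.
rewrite sum_power_mxS; set v' := drift _ _ _ _ _ v.
have h1 := drift_le hS hpi eta0 eta_le v; rewrite -/v' in h1.
have [->|n0] := posnP n.
  rewrite mul0mx addr0 mul1r; have := dot_ge0 v'; lra.
have np : 0 < n%:R :> R by rewrite ltr0n.
rewrite -(ler_pM2l np).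
have h2 := ler_wpM2l ebp (gram_cons hS hpi n v (sum_power_mx n *m v')).
have n1 : 0 <= n.+1%:R * n%:R :> R by rewrite mulr_ge0.
have h3 := ler_wpM2l n1 h1; have h4 := ler_wpM2l (ler0n R n.+1) (IH v').
lra.
Qed.

Variables (ttheta ghat : 'cV[R]_d) (r : R).
Local Notation e1 := (ttheta - th).
Local Notation werr := (ghat - Am *m e1).
Local Notation cst := (step_const M Psi u pi eta ttheta ghat).
Local Notation iters n theta x := (td_iterates M Psi u pi tau eta r ttheta ghat n theta x).

(** At each step the increment is replaced by its ideal mean, at a cost [delta]. The later mean
    updates are linear, so the replacement can be tested against the vector pulled back by the
    transpose of [sum_power_mx n]. The size of the later errors is controlled by [step_le], hence
    the term [n%:R * cst]. *)
Lemma td_iterates_mean w n theta x :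
  `|expect (iters n theta x) (fun y => dot w (y.1 - n%:R *: th)) -
    dot w (sum_power_mx n *m (theta - th) + noise_gain_mx n *m werr)| <=
  l2norm w * (n%:R ^+ 2 * (2 * eta * delta) *
    (dot (theta - th) (theta - th) + (1 + dot e1 e1) + n%:R * cst)).
Proof.
have c0 := step_const_ge0 hS hpi eta0 ttheta ghat.
have w0 := l2norm_ge0 w.
elim: n theta x => [|n IH] theta x.
  rewrite expect_ret /= scale0r subr0 !mul0mx addr0 dot0r subrr normr0.
  by rewrite expr0n /= !mul0r mulr0.
rewrite (td_iteratesS _ _ _ _ _ _ _ _ _ _ _ _ (dot w)).
set e := theta - th; set q := e - e1.
have lx := law_on_sample hM hpi hpert tau x.
pose e' xi := next_err M Psi u pi eta ttheta ghat e xi.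
pose main v := dot w (sum_power_mx n *m v + noise_gain_mx n *m werr).
pose err v := l2norm w * (n%:R ^+ 2 * (2 * eta * delta) *
    (dot v v + (1 + dot e1 e1) + n%:R * cst)).
pose Y z := expect (iters n (e' z.1 + th) z.2) (fun y => dot w (y.1 - n%:R *: th)).
have hY z : `|Y z - main (e' z.1)| <= err (e' z.1).
  by have := IH (e' z.1 + th) z.2; rewrite addrK.
rewrite (eq_expect _ (g := fun z => dot w e + Y z)); last first.
  move=> z; rewrite (eq_expect _ (g := fun y => dot w e + dot w (y.1 - n%:R *: th))).
    by rewrite expectD (expect_cst _ (law_on_td_iterates hS hpi tau eta r ttheta ghat n _ z.2)).
  by move=> y; rewrite dotDr.
rewrite expectD (expect_cst _ lx).
have h1 : `|expect (sample M u pi tau x) Y -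
    expect (sample M u pi tau x) (fun z => main (e' z.1))| <=
    l2norm w * (n%:R ^+ 2 * (2 * eta * delta) *
    ((dot e e + cst) + (1 + dot e1 e1) + n%:R * cst)).
  rewrite -expectB; apply: le_trans (ler_norm_expect lx (g := fun z => err (e' z.1)) _) _.
    by move=> z _; exact: hY.
  rewrite /err !expectZ !expectD !(expect_cst _ lx).
  have := step_le hS hpi hd0 hd mix eta0 eta_le ttheta ghat e x.
  have : 0 <= eta * b / 2 * G e by rewrite !mulr_ge0 ?(gram_ge0 hS hpi) ?ltW.
  move=> g0 sl; apply: ler_wpM2l => //; apply: ler_wpM2l.
    by rewrite mulr_ge0 ?exprn_ge0// mulr_ge0// mulr_ge0// ltW.
  rewrite -/e in sl; rewrite /e'; lra.
have h2 : `|expect (sample M u pi tau x) (fun z => main (e' z.1)) -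
    (dot w (sum_power_mx n *m (drift M Psi u pi eta e - eta *: werr))
      + dot w (noise_gain_mx n *m werr))| <= eta * (delta * (n%:R * l2norm w * (2 * l2norm q))).
  pose w' := (sum_power_mx n)^T *m w.
  have hw' : l2norm w' <= n%:R * l2norm w.
    by apply: l2norm_trmx_le => // v; exact: sum_power_mx_le.
  have hmix : `|expect (sample M u pi tau x) (fun z => dot w' (td_incr Psi z.1 q))
      - dot w' (Am *m q)| <= delta * (n%:R * l2norm w * (2 * l2norm q)).
    rewrite -(expect_td_incr hS hpi q w').
    apply: (mix x (F := fun xi => dot w' (td_incr Psi xi q))) => xi.
    apply: le_trans (normr_dot_le _ _) _; apply: ler_pM; rewrite ?l2norm_ge0//.
    exact: (td_incr_le hS).
  have -> : expect (sample M u pi tau x) (fun z => main (e' z.1)) =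
      dot w' (e - eta *: ghat) + dot w (noise_gain_mx n *m werr)
      - eta * expect (sample M u pi tau x) (fun z => dot w' (td_incr Psi z.1 q)).
    set K := dot w' (e - eta *: ghat) + _.
    rewrite (eq_expect _ (g := fun z => K - eta * dot w' (td_incr Psi z.1 q))).
      by rewrite expectB expectZ (expect_cst _ lx).
    move=> z; rewrite /K /main /= [LHS]dotDr (dot_mulmx (sum_power_mx n) w) -/w' /e' /next_err -/q.
    by rewrite scalerDr !dotBr !dotDr !dotZr; ring.
  have -> : dot w (sum_power_mx n *m (drift M Psi u pi eta e - eta *: werr)) =
      dot w' (e - eta *: ghat) - eta * dot w' (Am *m q).
    rewrite dot_mulmx -/w' -dotZr -dotBr; congr (dot w' _).
    rewrite /drift /q (mulmxBr Am e); move: (Am *m e) (Am *m _) => X1 X2.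
    by apply/colP => i; rewrite !mxE; ring.
  set X1 := expect _ _ in hmix *; set X2 := dot w' (Am *m q) in hmix *.
  have -> : dot w' (e - eta *: ghat) + dot w (noise_gain_mx n *m werr) - eta * X1 -
    (dot w' (e - eta *: ghat) - eta * X2 + dot w (noise_gain_mx n *m werr)) =
    - (eta * (X1 - X2)) by ring.
  by rewrite normrN normrM gtr0_norm// ler_wpM2l// ltW.
have -> : dot w (sum_power_mx n.+1 *m e + noise_gain_mx n.+1 *m werr) =
   dot w e + (dot w (sum_power_mx n *m (drift M Psi u pi eta e - eta *: werr))
      + dot w (noise_gain_mx n *m werr)).
  rewrite sum_power_mxS noise_gain_mxS (mulmxBr _ (drift M Psi u pi eta e)) -scalemxAr -!dotDr; congr (dot w _).
  move: (sum_power_mx n *m _) (sum_power_mx n *m _) (noise_gain_mx n *m _) => X1 X2 X3.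
  by apply/colP => i; rewrite !mxE; ring.
set Z1 := expect _ Y in h1 *; set Z2 := expect _ _ in h1 h2; set Z3 := _ + dot w _ in h2 *.
have -> : dot w e + Z1 - (dot w e + Z3) = (Z1 - Z2) + (Z2 - Z3) by ring.
apply: le_trans (ler_normD _ _) _; apply: le_trans (lerD h1 h2) _.
have hq : l2norm q <= dot e e + (1 + dot e1 e1).
  have := l2normD e (- e1); rewrite l2normN -/q.
  have := sqr_ge0 (l2norm e - 1); have := sqr_ge0 (l2norm e1 - 1).
  have := dot_ge0 e; have := dot_ge0 e1; rewrite -!sqr_l2norm; lra.
have X0 : 0 <= dot e e + (1 + dot e1 e1) by apply: le_trans hq; exact: l2norm_ge0.
have k0 : 0 <= l2norm w * (2 * eta * delta).
  by rewrite mulr_ge0// mulr_ge0// mulr_ge0// ltW.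
have k1 := ler_wpM2l (mulr_ge0 (ler0n R n) k0) hq.
have k2 : 0 <= l2norm w * (2 * eta * delta) * ((dot e e + (1 + dot e1 e1)) * (n%:R + 1)).
  by rewrite mulr_ge0// mulr_ge0// addr_ge0.
have k3 : 0 <= l2norm w * (2 * eta * delta) * (cst * ((n%:R + 1) ^+ 3 - n%:R ^+ 2 * (n%:R + 1))).
  rewrite mulr_ge0// mulr_ge0//.
  have -> : (n%:R + 1) ^+ 3 - n%:R ^+ 2 * (n%:R + 1) = (n%:R + 1) * (2 * n%:R + 1) :> R by ring.
  by rewrite mulr_ge0// addr_ge0// mulr_ge0.
move: k1 k2 k3; rewrite -natr1; lra.
Qed.

End IteratesBias.

(** * First phase of an epoch: mean and variance of the noise *)

Section Epoch.
Variables (R : realType) (S A : finType) (M : amdp R S A) (d : nat)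
  (Psi : 'M[R]_(#|{: S * A}|, d)) (u Gamma mubar kappa cbar : R) (x0 : S * A).
Hypothesis hS : setting M Psi u Gamma mubar kappa cbar.
Variable pi : S -> A -> R.
Hypothesis hpi : is_policy pi.
Implicit Types (v w e : 'cV[R]_d) (xi : (S * A) * (S * A)) (x : position S A).

Let hM := set_amdp hS.
Let hE := set_ergodic hS.
Let hpert := perturbed_is_policy hS hpi.
Local Notation b := (tbeta_gap M Psi u pi).
Local Notation m := (mu M Psi u pi).
Local Notation G := (gram_norm M Psi u pi).
Local Notation th := (td_solution M Psi u pi).
Local Notation Am := (td_mx M Psi u pi).
Local Notation E F := (expect (ideal M pi u) F).
Local Notation B := (residual_bound M Psi u cbar).
Local Notation pbar := (mean_psi M Psi u pi).

Let b0 : 0 < b := tbeta_gt0 hS hpi.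
Let b1 : b <= 8^-1 := tbeta_le hS hpi.
Let m0 : 0 < m := mu_gt0 hS hpi.
Let m1 : m <= 1 := mu_le1 hS hpi.
Let K := 2 * cbar.
Let hI : law_on (fun=> True) (ideal M pi u) := law_on_ideal hM hpi (wt_simplex hS hpi).

Lemma td_mx_norm_le v : l2norm (Am *m v) <= 2 * l2norm v.
Proof.
have : dot (Am *m v) (Am *m v) <= l2norm (Am *m v) * (2 * l2norm v).
  rewrite -{1}(expect_td_incr hS hpi v (Am *m v)); apply: (expect_le_cst hI) => xi _.
  apply: le_trans (ler_norm _) _; apply: le_trans (normr_dot_le _ _) _.
  by rewrite ler_wpM2l ?l2norm_ge0 ?(td_incr_le hS).
rewrite -sqr_l2norm; set t := l2norm (Am *m v) => h.
have [->|tn] := eqVneq t 0; first by rewrite mulr_ge0 ?l2norm_ge0.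
have tp : 0 < t by rewrite lt_def tn l2norm_ge0.
by rewrite -(ler_pM2l tp) -expr2.
Qed.

Lemma cost_sum_bounded tau n x :
  law_on (fun y => `|y.1 - n%:R * rho M pi| <= n%:R * K) (cost_sum M pi tau n x).
Proof.
elim: n x => [|n IH] x; first by apply: law_on_ret; rewrite /= !mul0r subrr normr0.
apply: law_on_bind (law_on_walk hM hpi tau.+1 x) _ => y _.
apply: law_on_bind (IH y) _ => r hr; apply: law_on_ret => /=.
have := rel_cost_le hE (set_cost hS) y.1 hpi; rewrite -/K => hc.
have -> : stage_cost M pi y.1 + r.1 - n.+1%:R * rho M pi =
    rel_cost M pi y.1 + (r.1 - n%:R * rho M pi) by rewrite /rel_cost -natr1; ring.
apply: le_trans (ler_normD _ _) _; rewrite -natr1; lra.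
Qed.

Variables (prm : evrtd_params R) (delta : R).
Local Notation eta := (p_eta prm).
Local Notation T := (p_T prm).
Local Notation N := (p_N prm).
Local Notation N' := (p_N' prm).
Hypotheses (hd0 : 0 <= delta) (hd : delta <= m ^+ 2 * b ^+ 2 / 512 / 64)
  (mix : sample_mixed M pi u (p_tau prm) delta)
  (mix' : sample_mixed M pi u (p_tau' prm) delta)
  (mixc : cost_mixed M pi (p_tau' prm).+1 delta)
  (eta0 : 0 < eta) (eta_le : eta <= b / 128 / 64)
  (hT : 64 <= T%:R * (m * b * eta)) (hN : 512 * 64 <= N%:R * (m * b ^+ 2))
  (hN' : 64 <= N'%:R * (m * b ^+ 2)).

Let D := m * b ^+ 2.
Let D0 : 0 < D. Proof. by rewrite mulr_gt0// exprn_gt0. Qed.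

Let nat_gt0 (n : nat) (k c : R) : 0 < c -> c <= n%:R * k -> 0 < n%:R :> R.
Proof.
by move=> c0 h; rewrite ltr0n lt0n; apply: contraTneq h => ->; rewrite mul0r -ltNge.
Qed.

Let T0 : 0 < T%:R :> R. Proof. by apply: nat_gt0 hT. Qed.
Let N0 : 0 < N%:R :> R. Proof.
have c : 0 < 512 * 64 :> R by rewrite mulr_gt0 ?ltr0n.
exact: nat_gt0 c hN.
Qed.
Let N'0 : 0 < N'%:R :> R. Proof. by apply: nat_gt0 hN'. Qed.

Variable (ttheta : 'cV[R]_d).
Local Notation e1 := (ttheta - th).

(** Splitting off this phase allows the iterates to be analysed with the cost estimate and [ghat]
    frozen. *)
Definition prep x : law R (R * ('cV[R]_d * position S A)) :=
  y <~ cost_sum M pi (p_tau' prm) N' x ;;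
  g <~ td_sum M Psi u pi (p_tau' prm) ttheta (y.1 / N'%:R) N y.2 ;;
  ret R (y.1 / N'%:R, (N%:R^-1 *: g.1, g.2)).

Lemma law_on_prep x : law_on (fun=> True) (prep x).
Proof.
apply: law_on_bind (law_on_cost_sum hS hpi _ _ x) _ => y _.
apply: law_on_bind (law_on_td_sum hS hpi _ _ _ _ y.2) _ => g _.
exact: law_on_ret.
Qed.

Lemma expect_epoch x F : expect (epoch M Psi u pi prm ttheta x) F =
  expect (prep x) (fun p => expect (td_iterates M Psi u pi (p_tau prm) eta p.1 ttheta p.2.1
    T ttheta p.2.2) (fun z => F (T%:R^-1 *: z.1, z.2))).
Proof.
rewrite !expect_bind; apply: eq_expect => y; rewrite !expect_bind; apply: eq_expect => g.
rewrite expect_ret expect_bind; apply: eq_expect => z; exact: expect_ret.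
Qed.

Local Notation noise p := (p.2.1 - Am *m e1).

Section GivenCost.
Variable (r : R).
Let rr := r - rho M pi.
Hypothesis rrK : `|rr| <= K.
(** The ideal mean of [td_op] for a frozen cost estimate. In [V], [72 = 6 * 6 + 6 * 6] and
    [15 = 3 + 3 * 2 ^+ 2], where the last term is the feature deviation weighted by the cost
    error. *)
Let c0 := Am *m e1 + rr *: pbar.
Let Bf := 4 * l2norm e1 + 3 * B.
Let V := 72 * G e1 + 15 * B ^+ 2.

Let KB : K <= B.
Proof. by have := residual_bound_ge x0 hS hpi; have := cbar_gt0 hS; rewrite /K; lra. Qed.

Let K0 : 0 <= K.
Proof. by have := cbar_gt0 hS; rewrite /K; lra. Qed.

Lemma td_op_centered xi : td_op M Psi pi ttheta r xi - c0 =
  (td_incr Psi xi e1 - Am *m e1) + td_residual M Psi u pi xi + rr *: (psi Psi xi.1 - pbar).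
Proof.
rewrite (td_opE M Psi u) -/rr /c0 scalerBr.
move: (rr *: pbar) (rr *: psi _ _) (Am *m e1) (td_incr _ _ _) => X Y Z W.
by apply/colP => i; rewrite !mxE; ring.
Qed.

Lemma centered_le xi : l2norm (td_op M Psi pi ttheta r xi - c0) <= Bf.
Proof.
rewrite td_op_centered; apply: le_trans (l2normD _ _) _.
apply: le_trans (lerD (l2normD _ _) (lexx _)) _.
apply: le_trans (lerD (lerD (l2normD _ _) (lexx _)) (lexx _)) _.
rewrite l2normN l2normZ.
have h1 := td_incr_le hS xi e1; have h2 := td_mx_norm_le e1.
have h3 := td_residual_le x0 hS hpi xi.
have h4 : l2norm (psi Psi xi.1 - pbar) <= 2.
  apply: le_trans (l2normD _ _) _; rewrite l2normN.
  by have := l2norm_psi hS xi.1; have := mean_psi_le hS hpi; lra.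
have h5 : `|rr| * l2norm (psi Psi xi.1 - pbar) <= K * 2.
  by apply: ler_pM; rewrite ?normr_ge0 ?l2norm_ge0.
by have := KB; rewrite /Bf; lra.
Qed.

Lemma centered_mean w : E (fun xi => dot w (td_op M Psi pi ttheta r xi - c0)) = 0.
Proof.
rewrite (eq_expect _ (g := fun xi => dot w (td_incr Psi xi e1) - dot w (Am *m e1)
   + dot w (td_residual M Psi u pi xi) + rr * (dot w (psi Psi xi.1) - dot w pbar))).
  rewrite !expectD expectZ !expectB !(expect_cst _ hI).
  rewrite (expect_td_incr hS hpi) (expect_td_residual hS hpi).
  by rewrite expect_psi// !subrr mulr0 !addr0.
by move=> xi; rewrite td_op_centered !dotDr dotZr !dotBr dotNr.
Qed.

Lemma centered_var : E (fun xi => dot (td_op M Psi pi ttheta r xi - c0)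
    (td_op M Psi pi ttheta r xi - c0)) <= V.
Proof.
apply: (@le_trans _ _ (E (fun xi => 6 * dot (td_incr Psi xi e1) (td_incr Psi xi e1)
    + (6 * dot (Am *m e1) (Am *m e1) + 15 * B ^+ 2)))).
  apply: expect_le hI _ => xi _; rewrite td_op_centered.
  apply: le_trans (dotD3_le _ _ _) _.
  have h1 := dotD_le (td_incr Psi xi e1) (- (Am *m e1)); rewrite dotNl dotNr opprK in h1.
  have h2 : dot (td_residual M Psi u pi xi) (td_residual M Psi u pi xi) <= B ^+ 2.
    rewrite -sqr_l2norm ler_pXn2r ?nnegrE ?l2norm_ge0 ?(td_residual_le x0 hS hpi)//.
    exact: ltW (residual_bound_gt0 x0 hS hpi).
  have h3 : l2norm (rr *: (psi Psi xi.1 - pbar)) <= 2 * B.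
    rewrite l2normZ; have h4 : l2norm (psi Psi xi.1 - pbar) <= 2.
      apply: le_trans (l2normD _ _) _; rewrite l2normN.
      by have := l2norm_psi hS xi.1; have := mean_psi_le hS hpi; lra.
    have : `|rr| * l2norm (psi Psi xi.1 - pbar) <= K * 2.
      by apply: ler_pM; rewrite ?normr_ge0 ?l2norm_ge0.
    by have := KB; lra.
  have h4 : dot (rr *: (psi Psi xi.1 - pbar)) (rr *: (psi Psi xi.1 - pbar)) <= (2 * B) ^+ 2.
    rewrite -sqr_l2norm ler_pXn2r ?nnegrE ?l2norm_ge0//.
    exact: le_trans (l2norm_ge0 _) h3.
  lra.
rewrite expectD expectZ (expect_cst _ hI).
have := expect_td_incr_sqr hS hpi e1; have := td_mx_sqr_le hS hpi e1; rewrite /V; lra.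
Qed.

Let noiseE (g : 'cV[R]_d) :
  N%:R^-1 *: g - Am *m e1 = N%:R^-1 *: (g - N%:R *: c0) + rr *: pbar.
Proof.
rewrite scalerBr scalerA mulVf ?gt_eqF// scale1r /c0.
move: (rr *: pbar) (Am *m e1) (_ *: g) => X Y Z.
by apply/colP => i; rewrite !mxE; ring.
Qed.

Lemma noise_var_given x : 10 * expect (td_sum M Psi u pi (p_tau' prm) ttheta r N x)
    (fun g => dot (N%:R^-1 *: g.1 - Am *m e1) (N%:R^-1 *: g.1 - Am *m e1)) <=
  D * (G e1 / 8 + B ^+ 2 / 8) + 20 * rr ^+ 2.
Proof.
have lx := law_on_td_sum hS hpi (p_tau' prm) ttheta r N x.
have h := td_sum_var x0 hS hpi hd0 mix' centered_le centered_mean centered_var N x.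
set W := expect _ _ in h.
have h1 : expect (td_sum M Psi u pi (p_tau' prm) ttheta r N x)
    (fun g => dot (N%:R^-1 *: g.1 - Am *m e1) (N%:R^-1 *: g.1 - Am *m e1)) <=
    2 * (N%:R^-1 ^+ 2 * W) + 2 * rr ^+ 2.
  rewrite -[2 * rr ^+ 2](expect_cst _ lx) -!expectZ -expectD.
  apply: expect_le lx _ => g _; rewrite noiseE; apply: le_trans (dotD_le _ _) _.
  rewrite dotZl dotZr dotZl dotZr.
  have : dot pbar pbar <= 1.
    by rewrite -sqr_l2norm expr_le1 ?l2norm_ge0 ?(mean_psi_le hS hpi).
  move=> /(ler_wpM2l (sqr_ge0 rr)); lra.
have h2 : N%:R^-1 ^+ 2 * W <= N%:R^-1 * V + delta * Bf ^+ 2.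
  have := ler_wpM2l (sqr_ge0 N%:R^-1) h.
  have -> : N%:R^-1 ^+ 2 * (N%:R * V + N%:R ^+ 2 * (delta * Bf ^+ 2)) =
     N%:R^-1 * V + delta * Bf ^+ 2 by field; rewrite gt_eqF.
  by [].
have V0 : 0 <= V.
  have := gram_ge0 hS hpi e1; have := sqr_ge0 B; rewrite /V; lra.
have h3 : N%:R^-1 * V <= D / 512 / 64 * V.
  apply: ler_wpM2r => //; rewrite -[N%:R^-1]mul1r ler_pdivrMr//.
  by have := hN; rewrite -/D; lra.
have h4 : delta * Bf ^+ 2 <= D / 512 / 64 * (32 * G e1 + 18 * B ^+ 2).
  have k1 : Bf ^+ 2 <= 32 * dot e1 e1 + 18 * B ^+ 2.
    rewrite /Bf -sqr_l2norm; have := sqr_ge0 (4 * l2norm e1 - 3 * B); lra.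
  have k2 := ler_wpM2l hd0 k1.
  have k3 := delta_dot_le hS hpi hd e1.
  have k4 : delta <= m * (D / 512 / 64) by apply: le_trans hd _; rewrite /D; lra.
  have k5 := ler_wpM2r (dot_ge0 e1) k4.
  have k6 := ler_wpM2l (ltW D0) (mu_gram hS hpi e1).
  have k7 := ler_wpM2r (sqr_ge0 B) k4.
  have k8 : m * (D * B ^+ 2) <= D * B ^+ 2 by rewrite ler_piMl// mulr_ge0 ?sqr_ge0 ?ltW.
  lra.
have g0 := mulr_ge0 (ltW D0) (gram_ge0 hS hpi e1).
have g1 := mulr_ge0 (ltW D0) (sqr_ge0 B).
rewrite /V in h2 h3; lra.
Qed.

Lemma noise_mean_given w x : `|expect (td_sum M Psi u pi (p_tau' prm) ttheta r N x)
    (fun g => dot w (N%:R^-1 *: g.1 - Am *m e1)) - rr * dot w pbar| <=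
  delta * Bf * l2norm w.
Proof.
have lx := law_on_td_sum hS hpi (p_tau' prm) ttheta r N x.
have h := td_sum_mean hS hpi mix' centered_le centered_mean w N x.
have e (g : 'cV[R]_d * position S A) : dot w (N%:R^-1 *: g.1 - Am *m e1) =
    N%:R^-1 * dot w (g.1 - N%:R *: c0) + rr * dot w pbar.
  rewrite noiseE [LHS]dotDr; congr (_ + _); exact: dotZr.
rewrite (eq_expect _ e); move: (rr * dot w pbar) => q.
rewrite expectD expectZ (expect_cst q lx) addrK normrM gtr0_norm ?invr_gt0//.
by rewrite ler_pdivrMl// !mulrA in h *.
Qed.

End GivenCost.

Let law_rr x : law_on (fun y => `|y.1 / N'%:R - rho M pi| <= K)
  (cost_sum M pi (p_tau' prm) N' x).
Proof.
apply: law_onW (cost_sum_bounded _ _ x) => y h.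
have -> : y.1 / N'%:R - rho M pi = (y.1 - N'%:R * rho M pi) / N'%:R.
  by field; rewrite gt_eqF.
by rewrite normrM normfV (ger0_norm (ltW N'0)) ler_pdivrMr// (mulrC K).
Qed.

(** The factor 10 is the one with which [epoch_gram] weighs this noise, divided there by [D]. *)
Lemma noise_var x :
  10 * expect (prep x) (fun p => dot (noise p) (noise p)) <= D * (G e1 / 8 + B ^+ 2).
Proof.
have lx := law_rr x.
rewrite expect_bind -expectZ.
apply: (@le_trans _ _ (expect (cost_sum M pi (p_tau' prm) N' x)
  (fun y => D * (G e1 / 8 + B ^+ 2 / 8) + 20 * (N'%:R^-1 ^+ 2 *
      (y.1 - N'%:R * rho M pi) ^+ 2)))).
  apply: expect_le lx _ => y hy; rewrite expect_bind.
  under eq_expect do rewrite expect_ret /=.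
  apply: le_trans (noise_var_given hy y.2) _.
  rewrite lerD2l ler_wpM2l//.
  by rewrite -exprMn le_eqVlt; apply/orP; left; apply/eqP; congr (_ ^+ 2); field; rewrite gt_eqF.
rewrite expectD (expect_cst _ lx) !expectZ.
have h := cost_sum_var hS hpi hd0 mixc N' x; rewrite -/K in h.
set W := expect _ _ in h *.
have h2 : N'%:R^-1 ^+ 2 * W <= N'%:R^-1 * K ^+ 2 + delta * K ^+ 2.
  have := ler_wpM2l (sqr_ge0 N'%:R^-1) h.
  have -> : N'%:R^-1 ^+ 2 * (N'%:R * K ^+ 2 + N'%:R ^+ 2 * (delta * K ^+ 2)) =
     N'%:R^-1 * K ^+ 2 + delta * K ^+ 2 by field; rewrite gt_eqF.
  by [].
have h3 : N'%:R^-1 * K ^+ 2 <= D / 64 * K ^+ 2.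
  apply: ler_wpM2r; first exact: sqr_ge0.
  by rewrite -[N'%:R^-1]mul1r ler_pdivrMr//; have := hN'; rewrite -/D; lra.
have h4 : delta * K ^+ 2 <= D / 64 * K ^+ 2.
  apply: ler_wpM2r; first exact: sqr_ge0.
  apply: le_trans hd _; have : m * D <= D by rewrite ler_piMl// ltW.
  by rewrite /D; have := D0; rewrite /D; lra.
have KB : K ^+ 2 <= B ^+ 2 / 121.
  have h5 : 11 * K <= B by have := residual_bound_ge x0 hS hpi; rewrite /K; lra.
  have K0 : 0 <= K by have := cbar_gt0 hS; rewrite /K; lra.
  have : (11 * K) ^+ 2 <= B ^+ 2.
    have B0 : 0 <= B := ltW (residual_bound_gt0 x0 hS hpi).
    have K11 : 0 <= 11 * K by move: K0; lra.
    by rewrite ler_pXn2r ?nnegrE.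
  lra.
have := ler_wpM2l (ltW D0) KB; have := mulr_ge0 (ltW D0) (sqr_ge0 B); lra.
Qed.

(** Given the cost estimate, the mean noise still contains [rr * dot w pbar]; it becomes small only
    after averaging over the cost phase. What remains has a factor [delta]. *)
Lemma noise_mean w x :
  `|expect (prep x) (fun p => dot w (noise p))| <= delta * (4 * l2norm e1 + 4 * B) * l2norm w.
Proof.
have lx := law_rr x.
pose Y (y : R * position S A) := expect (td_sum M Psi u pi (p_tau' prm) ttheta (y.1 / N'%:R) N y.2)
   (fun g => dot w (N%:R^-1 *: g.1 - Am *m e1)).
have -> : expect (prep x) (fun p => dot w (noise p)) =
    expect (cost_sum M pi (p_tau' prm) N' x)
     (fun y => (Y y - (y.1 / N'%:R - rho M pi) * dot w pbar)) +
     N'%:R^-1 * dot w pbar *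
     expect (cost_sum M pi (p_tau' prm) N' x) (fun y => y.1 - N'%:R * rho M pi).
  rewrite expect_bind -expectZ -expectD; apply: eq_expect => y.
  rewrite expect_bind; under eq_expect do rewrite expect_ret /=.
  by rewrite -/(Y y); field; rewrite gt_eqF.
apply: le_trans (ler_normD _ _) _.
have h1 : `|expect (cost_sum M pi (p_tau' prm) N' x)
     (fun y => (Y y - (y.1 / N'%:R - rho M pi) * dot w pbar))| <=
     delta * (4 * l2norm e1 + 3 * B) * l2norm w.
  by apply: (ler_norm_expect_cst lx) => y hy; exact: noise_mean_given.
have h2 := cost_sum_mean hS hpi mixc N' x; rewrite -/K in h2.
set W := expect _ _ in h2 *.
have h3 : `|N'%:R^-1 * dot w pbar * W| <= l2norm w * (delta * K).
  rewrite !normrM (gtr0_norm (x := N'%:R^-1)) ?invr_gt0//.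
  rewrite -mulrA ler_pdivrMl//; apply: le_trans (ler_pM _ _ (_ : _ <= l2norm w) h2) _ => //.
    apply: le_trans (normr_dot_le _ _) _; rewrite ler_piMr ?l2norm_ge0//.
    exact: (mean_psi_le hS hpi).
  by rewrite mulrCA.
apply: le_trans (lerD h1 h3) _.
have KB : K <= B.
  by have := residual_bound_ge x0 hS hpi; have := cbar_gt0 hS; rewrite /K; lra.
have := ler_wpM2l (mulr_ge0 (l2norm_ge0 w) hd0) KB; lra.
Qed.

End Epoch.

(** * Contraction over the epochs, in mean square and in mean *)

Section Epochs.
Variables (R : realType) (S A : finType) (M : amdp R S A) (d : nat)
  (Psi : 'M[R]_(#|{: S * A}|, d)) (u Gamma mubar kappa cbar : R) (x0 : S * A).
Hypothesis hS : setting M Psi u Gamma mubar kappa cbar.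
Variable pi : S -> A -> R.
Hypothesis hpi : is_policy pi.
Implicit Types (v w e : 'cV[R]_d) (xi : (S * A) * (S * A)) (x : position S A).

Local Notation b := (tbeta_gap M Psi u pi).
Local Notation m := (mu M Psi u pi).
Local Notation G := (gram_norm M Psi u pi).
Local Notation th := (td_solution M Psi u pi).
Local Notation Am := (td_mx M Psi u pi).
Local Notation B := (residual_bound M Psi u cbar).

Let b0 : 0 < b := tbeta_gt0 hS hpi.
Let b1 : b <= 8^-1 := tbeta_le hS hpi.
Let m0 : 0 < m := mu_gt0 hS hpi.
Let m1 : m <= 1 := mu_le1 hS hpi.

Variables (prm : evrtd_params R) (delta : R).
Local Notation eta := (p_eta prm).
Local Notation T := (p_T prm).
Local Notation N := (p_N prm).
Local Notation N' := (p_N' prm).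
Hypotheses (hd0 : 0 <= delta) (hd : delta <= m ^+ 2 * b ^+ 2 / 512 / 64)
  (mix : sample_mixed M pi u (p_tau prm) delta)
  (mix' : sample_mixed M pi u (p_tau' prm) delta)
  (mixc : cost_mixed M pi (p_tau' prm).+1 delta)
  (eta0 : 0 < eta) (eta_le : eta <= b / 128 / 64)
  (hT : 64 <= T%:R * (m * b * eta)) (hN : 512 * 64 <= N%:R * (m * b ^+ 2))
  (hN' : 64 <= N'%:R * (m * b ^+ 2)).

Let D := m * b ^+ 2.
Let D0 : 0 < D. Proof. by rewrite mulr_gt0// exprn_gt0. Qed.
Let T0 : 0 < T%:R :> R.
Proof.
by rewrite ltr0n lt0n; apply: contraTneq hT => ->; rewrite mul0r -ltNge.
Qed.
Let eb0 : 0 < eta * b. Proof. exact: mulr_gt0. Qed.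
Let B0 : 0 < B := residual_bound_gt0 x0 hS hpi.
Let Lam := T%:R * eta.
Let Lam0 : 0 < Lam. Proof. exact: mulr_gt0. Qed.

Lemma dot_le_gram v : dot v v <= G v / m.
Proof. by rewrite ler_pdivlMr// mulrC (mu_gram hS hpi). Qed.

(** An epoch is long enough for the initial squared norm, the boundary term of the telescoping, to
    be a small part of the accumulated energy. *)
Lemma horizon_dot_le v : dot v v <= T%:R * (eta * b) / 64 * G v.
Proof.
have h1 := ler_wpM2r (dot_ge0 v) hT.
have Tp : 0 <= T%:R * (eta * b) by rewrite mulr_ge0 ?ltW.
have := ler_wpM2l Tp (mu_gram hS hpi v); lra.
Qed.

Let iterE (z : 'cV[R]_d) : T%:R^-1 *: z - th = T%:R^-1 *: (z - T%:R *: th).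
Proof. by rewrite scalerBr scalerA mulVf ?gt_eqF// scale1r. Qed.

(** [td_iterates_gram] divided by [T ^+ 2]: the initial norm and [step_const] contribute [G / 32]
    each, and the noise at most [G / 8 + B ^+ 2]. *)
Lemma epoch_gram ttheta x :
  expect (epoch M Psi u pi prm ttheta x) (fun y => G (y.1 - th)) <=
  2^-1 * G (ttheta - th) + B ^+ 2.
Proof.
rewrite expect_epoch; set e1 := ttheta - th.
have lx := law_on_prep hS hpi prm ttheta x.
have g0 := gram_ge0 hS hpi e1.
apply: (@le_trans _ _ (expect (prep M Psi u pi prm ttheta x) (fun p =>
   G e1 / 16 + D^-1 * (10 * dot (p.2.1 - Am *m e1) (p.2.1 - Am *m e1))))); last first.
  rewrite expectD (expect_cst _ lx) !expectZ.
  have h := noise_var x0 hS hpi hd0 hd mix' mixc hN hN' ttheta x.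
  have D1 : 0 <= D^-1 by rewrite invr_ge0 ltW.
  have := ler_wpM2l D1 h; rewrite -/e1 mulKf ?gt_eqF//; lra.
apply: expect_le lx _ => p _.
set n2 := dot (p.2.1 - _) _.
have h := td_iterates_gram hS hpi hd0 hd mix eta0 eta_le ttheta p.2.1 p.1 T ttheta p.2.2.
rewrite -/e1 in h; set W := expect _ _ in h.
rewrite (eq_expect _ (g := fun z => T%:R^-1 ^+ 2 * G (z.1 - T%:R *: th))); last first.
  by move=> z /=; rewrite iterE gramZ.
rewrite expectZ -/W.
have h1 := horizon_dot_le e1.
pose k := T%:R * (eta * b).
have k0 : 0 < k by rewrite mulr_gt0.
rewrite -(ler_pM2l k0) -(@ler_pM2l _ (T%:R / 2)) ?divr_gt0//.
have -> : T%:R / 2 * (k * (T%:R^-1 ^+ 2 * W)) = eta * b / 2 * W.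
  by rewrite /k; field; rewrite gt_eqF.
apply: le_trans h _; rewrite -mulrA; apply: ler_wpM2l; first exact: ltW.
rewrite /step_const -/e1 -/n2 -/k in h1 *.
have -> : T%:R * (eta * b / 64 * G e1 + 5 * eta / (b * m) * n2) =
   k / 64 * G e1 + 5 * (k * (D^-1 * n2)).
  by rewrite /k /D; field; rewrite !gt_eqF.
have : 0 <= k * G e1 by rewrite mulr_ge0// ltW.
lra.
Qed.

(** The map from the initial error to the mean error of an epoch, up to mixing errors. *)
Definition epoch_mx : 'M[R]_d := T%:R^-1 *: sum_power_mx M Psi u pi eta T.

Lemma epoch_mx_le v : l2norm (epoch_mx *m v) <= l2norm v.
Proof.
rewrite -scalemxAl l2normZ gtr0_norm ?invr_gt0// ler_pdivrMl//.
exact: (sum_power_mx_le hS hpi eta0 eta_le).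
Qed.

Lemma epoch_mx_gram v : G (epoch_mx *m v) <= 4^-1 * G v.
Proof.
rewrite -scalemxAl gramZ.
have h := sum_power_mx_gram hS hpi eta0 eta_le T v.
have h1 := horizon_dot_le v.
pose k := T%:R * (eta * b).
have k0 : 0 < k by rewrite mulr_gt0.
set W := G _ in h *.
rewrite -(ler_pM2l k0) -(@ler_pM2l _ (T%:R / 2)) ?divr_gt0//.
have -> : T%:R / 2 * (k * (T%:R^-1 ^+ 2 * W)) = eta * b / 2 * W.
  by rewrite /k; field; rewrite gt_eqF.
apply: le_trans h _; rewrite -mulrA; apply: ler_wpM2l; first exact: ltW.
have : 0 <= k * G v by rewrite mulr_ge0 ?(gram_ge0 hS hpi)// ltW.
rewrite -/k in h1; lra.
Qed.

Lemma epoch_mx_pow_le n v : l2norm (epoch_mx ^+ n *m v) <= l2norm v.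
Proof.
elim: n v => [|n IH] v; first by rewrite expr0 mul1mx.
by rewrite exprS -mulmxE -mulmxA; apply: le_trans (epoch_mx_le _) (IH v).
Qed.

Lemma epoch_mx_pow_gram n v : G (epoch_mx ^+ n *m v) <= 4^-1 ^+ n * G v.
Proof.
elim: n v => [|n IH] v; first by rewrite !expr0 mul1mx mul1r.
rewrite !exprS -mulmxE -mulmxA; apply: le_trans (epoch_mx_gram _) _.
by rewrite -mulrA ler_wpM2l.
Qed.

Definition bias_factor : R :=
  Lam * (6 / m + 6 + 2 * Lam + (2 + 2 * Lam) * B ^+ 2).

Local Notation Y := bias_factor.

Lemma bias_factor_ge0 : 0 <= Y.
Proof.
have i0 : 0 <= m^-1 by rewrite invr_ge0 ltW.
have := ltW Lam0; rewrite /Y => L0; apply: mulr_ge0 => //.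
have : 0 <= (2 + 2 * Lam) * B ^+ 2 by rewrite mulr_ge0 ?sqr_ge0//; lra.
by lra.
Qed.

(* Up to the mixing error, the mean error of an epoch is a linear image of the initial
   one; the bias therefore decays geometrically, with no contribution of the variance. *)
Lemma epoch_mean w ttheta x :
  `|expect (epoch M Psi u pi prm ttheta x) (fun y => dot w (y.1 - th)) -
    dot w (epoch_mx *m (ttheta - th))| <=
  l2norm w * (delta * Y * (1 + G (ttheta - th))).
Proof.
rewrite expect_epoch; set e1 := ttheta - th.
have lx := law_on_prep hS hpi prm ttheta x.
have g0 := gram_ge0 hS hpi e1.
pose BT := sum_power_mx M Psi u pi eta T.
pose CT := noise_gain_mx M Psi u pi eta T.
pose nz (p : R * ('cV[R]_d * position S A)) := p.2.1 - Am *m e1.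
pose cst p := step_const M Psi u pi eta ttheta p.
pose X p := expect (td_iterates M Psi u pi (p_tau prm) eta p.1 ttheta p.2.1 T ttheta p.2.2)
   (fun z => dot w (z.1 - T%:R *: th)).
have w0 := l2norm_ge0 w.
pose w' := CT^T *m w.
have hw' : l2norm w' <= eta * T%:R ^+ 2 * l2norm w.
  apply: l2norm_trmx_le => [|v]; first by rewrite mulr_ge0 ?exprn_ge0// ltW.
  exact: (noise_gain_mx_le hS hpi eta0 eta_le).
have -> : expect (prep M Psi u pi prm ttheta x) (fun p => expect
    (td_iterates M Psi u pi (p_tau prm) eta p.1 ttheta p.2.1 T ttheta p.2.2)
      (fun z => dot w ((T%:R^-1 *: z.1, z.2).1 - th))) - dot w (epoch_mx *m e1) =
    T%:R^-1 * (expect (prep M Psi u pi prm ttheta x)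
        (fun p => X p - dot w (BT *m e1 + CT *m nz p)) +
      expect (prep M Psi u pi prm ttheta x) (fun p => dot w' (nz p))).
  rewrite -expectD -expectZ -[dot w (epoch_mx *m e1)](expect_cst _ lx) -expectB.
  apply: eq_expect => p; rewrite /X.
  rewrite (eq_expect _ (g := fun z => T%:R^-1 * dot w (z.1 - T%:R *: th))); last first.
    by move=> z /=; rewrite iterE dotZr.
  rewrite expectZ /epoch_mx -/BT -scalemxAl dotZr dotDr (dot_mulmx CT) -/w'; ring.
rewrite normrM gtr0_norm ?invr_gt0// ler_pdivrMl//.
apply: le_trans (ler_normD _ _) _.
have h2 := noise_mean x0 hS hpi hd0 mix' mixc hN hN' ttheta w' x.
rewrite -/e1 in h2.
have h1 : `|expect (prep M Psi u pi prm ttheta x)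
        (fun p => X p - dot w (BT *m e1 + CT *m nz p))| <=
   l2norm w * (T%:R ^+ 2 * (2 * eta * delta) *
      (dot e1 e1 + (1 + dot e1 e1) + T%:R * (eta * b / 64 * G e1 +
         eta * b / 2 * (G e1 / 8 + B ^+ 2)))).
  apply: le_trans (ler_norm_expect lx (g := fun p => l2norm w * (T%:R ^+ 2 * (2 * eta * delta) *
      (dot e1 e1 + (1 + dot e1 e1) + T%:R * (eta * b / 64 * G e1 +
         eta / (b * m) / 2 * (10 * dot (nz p) (nz p)))))) _) _.
    move=> p _.
    have := td_iterates_mean hS hpi hd0 hd mix eta0 eta_le ttheta p.2.1 p.1 w T ttheta p.2.2.
    rewrite -/e1 /step_const -/e1 -/(nz p) => h; apply: le_trans h _.
    rewrite le_eqVlt; apply/orP; left; apply/eqP.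
    by congr (_ * (_ * (_ + _ * (_ + _)))); field; rewrite !gt_eqF.
  rewrite !expectZ !expectD !(expect_cst _ lx) !expectZ.
  apply: ler_wpM2l => //; apply: ler_wpM2l.
    by rewrite mulr_ge0 ?exprn_ge0// mulr_ge0// mulr_ge0// ltW.
  rewrite lerD2l; apply: ler_wpM2l => //; rewrite !expectD !(expect_cst _ lx) !expectZ lerD2l.
  have c0 : 0 <= eta / (b * m) / 2 by rewrite !divr_ge0 ?mulr_ge0// ltW.
  have := noise_var x0 hS hpi hd0 hd mix' mixc hN hN' ttheta x; rewrite -/e1.
  move=> /(ler_wpM2l c0) h; apply: le_trans h _.
  rewrite le_eqVlt; apply/orP; left; apply/eqP.
  by field; rewrite !gt_eqF.
apply: le_trans (lerD h1 h2) _.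
have e0 := l2norm_ge0 e1.
have q0 : 0 <= delta * (4 * l2norm e1 + 4 * B).
  by rewrite mulr_ge0// addr_ge0// mulr_ge0// ltW.
apply: le_trans (lerD (lexx _) (ler_wpM2l q0 hw')) _.
have hb : b * (G e1 + B ^+ 2) <= G e1 + B ^+ 2.
  by rewrite ler_piMl ?addr_ge0 ?sqr_ge0//; have := b1; lra.
have bg0 : 0 <= b * G e1 by rewrite mulr_ge0// ltW.
have bB0 : 0 <= b * B ^+ 2 by rewrite mulr_ge0 ?sqr_ge0// ltW.
have L1 : 0 <= T%:R * eta by exact: ltW.
have k1 : T%:R * (eta * b / 64 * G e1 + eta * b / 2 * (G e1 / 8 + B ^+ 2)) <=
   Lam * (G e1 + B ^+ 2).
  by have := ler_wpM2l L1 hb; have := mulr_ge0 L1 bg0; have := mulr_ge0 L1 bB0; rewrite /Lam; lra.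
have k2 := dot_le_gram e1.
have k3 : 4 * l2norm e1 + 4 * B <= 4 + 2 * dot e1 e1 + 2 * B ^+ 2.
  rewrite -sqr_l2norm; have := sqr_ge0 (l2norm e1 - 1); have := sqr_ge0 (B - 1); lra.
have P0 : 0 <= T%:R ^+ 2 * eta * delta * l2norm w.
  by rewrite mulr_ge0// mulr_ge0// mulr_ge0 ?exprn_ge0// ltW.
apply: (@le_trans _ _ (T%:R ^+ 2 * eta * delta * l2norm w *
   (2 * (2 * dot e1 e1 + 1 + Lam * (G e1 + B ^+ 2)) + (4 + 2 * dot e1 e1 + 2 * B ^+ 2)))).
  have := ler_wpM2l P0 k1; have := ler_wpM2l P0 k3; lra.
apply: (@le_trans _ _ (T%:R ^+ 2 * eta * delta * l2norm w *
   ((6 / m + 6 + 2 * Lam + (2 + 2 * Lam) * B ^+ 2) * (1 + G e1)))); last first.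
  by rewrite /Y /Lam; lra.
apply: ler_wpM2l => //.
have r1 : 0 <= m^-1 by rewrite invr_ge0 ltW.
have r2 : 0 <= Lam * B ^+ 2 by rewrite mulr_ge0 ?sqr_ge0// ltW.
have r3 := mulr_ge0 r2 g0.
have r4 : 0 <= B ^+ 2 * G e1 by rewrite mulr_ge0 ?sqr_ge0.
have r5 := ltW Lam0.
lra.
Qed.

(** [2 * B ^+ 2] is the fixed point of the recursion in [epoch_gram]. *)
Lemma epochs_gram_sharp n theta x :
  expect (epochs M Psi u pi prm n theta x) (fun y => G (y.1 - th)) <=
  2^-1 ^+ n * G (theta - th) + 2 * B ^+ 2 * (1 - 2^-1 ^+ n).
Proof.
elim: n theta x => [|n IH] theta x.
  by rewrite expect_ret /= expr0 mul1r subrr mulr0 addr0.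
have lx := law_on_epoch hS hpi prm theta x.
rewrite expect_bind; apply: le_trans (expect_le lx (fun y _ => IH y.1 y.2)) _.
rewrite expectD (expect_cst _ lx) expectZ.
have p0 : 0 <= 2^-1 ^+ n :> R by rewrite exprn_ge0.
have := ler_wpM2l p0 (epoch_gram theta x); rewrite (exprS _ n).
move: (2^-1 ^+ n) => q; lra.
Qed.

Lemma epochs_gram n theta x :
  expect (epochs M Psi u pi prm n theta x) (fun y => G (y.1 - th)) <=
  2^-1 ^+ n * G (theta - th) + 2 * B ^+ 2.
Proof.
apply: le_trans (epochs_gram_sharp n theta x) _; rewrite lerD2l.
by apply: ler_piMr; [rewrite mulr_ge0 ?sqr_ge0|rewrite gerBl exprn_ge0].
Qed.

(** [epoch_mx] does not increase the norm, so the mixing errors of the epochs merely add up. The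
    term [n%:R * B ^+ 2] bounds the growth of the expected [G] entering them. *)
Lemma epochs_mean w n theta x :
  `|expect (epochs M Psi u pi prm n theta x) (fun y => dot w (y.1 - th)) -
    dot w (epoch_mx ^+ n *m (theta - th))| <=
  l2norm w * (n%:R * (delta * Y) * (1 + G (theta - th) + n%:R * B ^+ 2)).
Proof.
have dY0 : 0 <= delta * Y by rewrite mulr_ge0 ?bias_factor_ge0.
have w0 := l2norm_ge0 w; have BB := sqr_ge0 B.
elim: n theta x => [|n IH] theta x.
  by rewrite expect_ret /= expr0 mul1mx subrr normr0 !mul0r mulr0.
set e := theta - th; have g0 := gram_ge0 hS hpi e.
have lx := law_on_epoch hS hpi prm theta x.
pose w' := (epoch_mx ^+ n)^T *m w.
have hw' : l2norm w' <= l2norm w.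
  by rewrite -[leRHS]mul1r; apply: l2norm_trmx_le => // v; rewrite mul1r epoch_mx_pow_le.
pose Z (y : 'cV[R]_d * position S A) :=
  expect (epochs M Psi u pi prm n y.1 y.2) (fun y => dot w (y.1 - th)).
have -> : expect (epochs M Psi u pi prm n.+1 theta x) (fun y => dot w (y.1 - th)) -
    dot w (epoch_mx ^+ n.+1 *m e) =
    expect (epoch M Psi u pi prm theta x)
      (fun y => Z y - dot w (epoch_mx ^+ n *m (y.1 - th))) +
    (expect (epoch M Psi u pi prm theta x) (fun y => dot w' (y.1 - th)) -
     dot w' (epoch_mx *m e)).
  rewrite exprSr -mulmxE -mulmxA (dot_mulmx (epoch_mx ^+ n)) -/w' expectB.
  rewrite [X in _ - X + _](eq_expect _ (g := fun y => dot w' (y.1 - th))); last first.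
    by move=> y; rewrite (dot_mulmx (epoch_mx ^+ n)).
  by rewrite [in LHS]expect_bind addrA subrK.
apply: le_trans (ler_normD _ _) _.
have h2 := epoch_mean w' theta x; rewrite -/e in h2.
have h1 : `|expect (epoch M Psi u pi prm theta x)
      (fun y => Z y - dot w (epoch_mx ^+ n *m (y.1 - th)))| <=
   l2norm w * (n%:R * (delta * Y) * (1 + (G e + B ^+ 2) + n%:R * B ^+ 2)).
  apply: le_trans (ler_norm_expect lx (fun y _ => IH y.1 y.2)) _.
  rewrite !expectZ !expectD !(expect_cst _ lx).
  apply: ler_wpM2l => //; apply: ler_wpM2l; first by rewrite mulr_ge0.
  have := epoch_gram theta x; rewrite -/e; lra.
apply: le_trans (lerD h1 h2) _.
have q0 : 0 <= delta * Y * (1 + G e) by rewrite mulr_ge0// addr_ge0.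
have := ler_wpM2r q0 hw'.
have := mulr_ge0 w0 (mulr_ge0 dY0 (mulr_ge0 (ler0n R n.+1) BB)).
rewrite -natr1; lra.
Qed.

Lemma l2norm_pow_le n e : l2norm (epoch_mx ^+ n *m e) <= 2^-1 ^+ n * (1 + G e / m).
Proof.
have g0 := gram_ge0 hS hpi e; have g1 : 0 <= G e / m by rewrite divr_ge0// ltW.
have p0 : 0 <= 2^-1 ^+ n :> R by rewrite exprn_ge0.
rewrite -(@ler_pXn2r _ 2) ?nnegrE ?l2norm_ge0 ?mulr_ge0 ?addr_ge0//.
rewrite sqr_l2norm; apply: le_trans (dot_le_gram _) _.
have h : G (epoch_mx ^+ n *m e) / m <= 4^-1 ^+ n * (G e / m).
  by rewrite mulrA ler_wpM2r ?invr_ge0 ?(ltW m0)// epoch_mx_pow_gram.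
(* The square root is avoided by [y <= (1 + y) ^+ 2] with [y = G e / m]. *)
apply: le_trans h _; rewrite exprMn exprAC.
have -> : 2^-1 ^+ 2 = 4^-1 :> R by lra.
apply: ler_wpM2l; first by rewrite exprn_ge0.
by have := sqr_ge0 (G e / m); lra.
Qed.

Lemma epochs_bias w n theta x :
  `|expect (epochs M Psi u pi prm n theta x) (fun y => dot w (y.1 - th))| <=
  l2norm w * (2^-1 ^+ n * (1 + G (theta - th) / m)
    + n%:R * (delta * Y) * (1 + G (theta - th) + n%:R * B ^+ 2)).
Proof.
have h1 := epochs_mean w n theta x.
have h2 : `|dot w (epoch_mx ^+ n *m (theta - th))| <=
    l2norm w * (2^-1 ^+ n * (1 + G (theta - th) / m)).
  apply: le_trans (normr_dot_le _ _) _.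
  by apply: ler_wpM2l; [exact: l2norm_ge0|exact: l2norm_pow_le].
rewrite mulrDr; apply: le_trans (lerD h2 h1).
by rewrite -lerBlDl; apply: lerB_dist.
Qed.

End Epochs.

(** * Tuning of EVRTD *)

Section Powers.
Variables (R : realType) (Z : R).
Hypothesis Z3 : 3 <= Z.

Let Z0 : 0 < Z. Proof. by apply: lt_le_trans Z3. Qed.
Let Z1 : 1 <= Z. Proof. by apply: le_trans Z3; lra. Qed.

Lemma pow_gt0 k : 0 < Z ^+ k. Proof. exact: exprn_gt0. Qed.

(** Problem quantities are all bounded by powers of [Z], and these rules compute the exponents. A
    base of at least 3 lets a sum fit into one more power. *)
Lemma pow_mono a k l : a <= Z ^+ k -> (k <= l)%N -> a <= Z ^+ l.
Proof. by move=> h kl; apply: le_trans h _; exact: ler_weXn2l. Qed.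

Lemma pow_num a k : a <= 3 ^+ k -> a <= Z ^+ k.
Proof. by move=> h; apply: le_trans h _; rewrite lerXn2r ?nnegrE// ltW. Qed.

Lemma pow_add a c k : a <= Z ^+ k -> c <= Z ^+ k -> a + c <= Z ^+ k.+1.
Proof.
move=> ha hc; rewrite exprS; apply: le_trans (lerD ha hc) _.
by have := ler_wpM2r (ltW (pow_gt0 k)) Z3; have := pow_gt0 k; lra.
Qed.

Lemma pow_mul a c k l : 0 <= c -> a <= Z ^+ k -> c <= Z ^+ l -> a * c <= Z ^+ (k + l).
Proof.
move=> c0 ha hc; rewrite exprD; apply: le_trans (ler_wpM2r c0 ha) _.
by rewrite ler_wpM2l// ltW// pow_gt0.
Qed.

Lemma pow_inv_double k : (Z ^+ k.+1)^-1 * 2 <= (Z ^+ k)^-1.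
Proof.
rewrite exprSr invfM -mulrA; apply: ler_piMr; first by rewrite invr_ge0 ltW// pow_gt0.
by rewrite mulrC ler_pdivrMr// mul1r; have := Z3; lra.
Qed.

Lemma pow_one a : a <= Z -> a <= Z ^+ 1. Proof. by rewrite expr1. Qed.

Lemma ln2_ge : 2^-1 <= ln 2 :> R.
Proof.
have := @le_ln1Dx R (- 2^-1); have -> : 1 + - 2^-1 = 2^-1 :> R by lra.
rewrite lnV ?posrE// => /(_ _) h; have : - ln 2 <= - 2^-1 :> R by apply: h; lra.
lra.
Qed.

Lemma ln_ge_two_thirds : 2 / 3 <= ln Z.
Proof.
have : ln Z^-1 <= Z^-1 - 1.
  have := @le_ln1Dx R (Z^-1 - 1); have -> : 1 + (Z^-1 - 1) = Z^-1 by lra.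
  apply.
  by rewrite ltrBrDl subrr invr_gt0.
rewrite lnV ?posrE//; have : Z^-1 <= 3^-1 by rewrite lef_pV2 ?posrE.
lra.
Qed.

(** [ln 2 >= 1 / 2] turns the hypothesis into [2 ^+ n.+1 >= Z ^+ c]. The [+ 1] absorbs the floor in
    a number of blocks of mixing time. *)
Lemma half_pow_le (n c : nat) : 2 * c%:R * ln Z <= n%:R + 1 ->
  2 * 2^-1 ^+ n <= (Z ^+ c)^-1 * 4 :> R.
Proof.
move=> h; have l0 : 0 <= ln Z by have := ln_ge_two_thirds; lra.
have -> : 2 * 2^-1 ^+ n = 4 * (2 ^+ n.+1)^-1 :> R.
  by rewrite exprVn exprS; field; rewrite expf_neq0.
rewrite mulrC ler_wpM2r// lef_pV2 ?posrE ?exprn_gt0//.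
rewrite -ler_ln ?posrE ?exprn_gt0// !lnXn// -[leLHS]mulr_natl -[leRHS]mulr_natl -natr1.
have n0 : 0 <= n%:R + 1 :> R by rewrite addr_ge0.
have := ler_wpM2l n0 ln2_ge; lra.
Qed.

End Powers.

Lemma natceil_bounds (R : realType) (x : R) : 0 <= x ->
  x <= (natceil x)%:R /\ (natceil x)%:R <= x + 1.
Proof.
move=> x0; have /andP[h1 h2] := ceil_itv x.
have c0 : 0 <= Num.ceil x by rewrite ceil_ge0; lra.
have -> : (natceil x)%:R = (Num.ceil x)%:~R :> R.
  by rewrite /natceil natr_absz ger0_norm.
by split=> //; move: h1; rewrite intrB; lra.
Qed.

(** The first four match the conditions on [eta], [T], [N] and [N'] in the analysis of an epoch. The
    others make the mixing error of order [(Z ^+ 128)^-1] and the decay over the epochs of order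
    [(Z ^+ 32)^-1], well beyond the degrees of the polynomial factors. *)
Definition std_consts (R : realType) : evrtd_consts R :=
  EvrtdConsts (128^-1 / 64) 64 (512 * 64) 64 256 256 64.

Lemma std_consts_pos (R : realType) : consts_pos (std_consts R).
Proof.
split; split; rewrite /= ?mulr_gt0 ?invr_gt0 ?ltr0n//.
Qed.

Definition log_arg (R : realType) (S A : finType) (M : amdp R S A) (d : nat)
    (Psi : 'M[R]_(#|{: S * A}|, d)) (u kappa cbar omega Gamma mubar eps : R)
    (theta0 : 'cV[R]_d) : R :=
  3 + problem_size M Psi u kappa cbar omega Gamma mubar eps theta0.

(** * The parameters satisfy the conditions on an epoch *)

Section Tuning.
Variables (R : realType) (S A : finType) (M : amdp R S A) (d : nat)
  (Psi : 'M[R]_(#|{: S * A}|, d)) (u Gamma mubar kappa cbar : R) (x0 : S * A)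
  (omega eps : R) (theta0 : 'cV[R]_d).
Hypothesis hS : setting M Psi u Gamma mubar kappa cbar.
Hypotheses (omega0 : 0 < omega) (eps0 : 0 < eps).

Local Notation size := (problem_size M Psi u kappa cbar omega Gamma mubar eps theta0).
Local Notation Z := (log_arg M Psi u kappa cbar omega Gamma mubar eps theta0).
Local Notation L := (ln Z).

Let hM := set_amdp hS.
Let hE := set_ergodic hS.
Let mub0 : 0 < mubar := set_mubar hS.
Let kap0 : 0 < kappa. Proof. by case: (set_pos hS). Qed.
Let cb0 : 0 < cbar. Proof. by case: (set_pos hS). Qed.
Let lam0 : 0 < min_lambda_perturbed M u := min_lambda_gt0 x0 hS.
Let eps1 : 0 <= eps_approx M Psi u := eps_approx_ge0 x0 hS.
Let tm1 : 1 <= t_mix M := t_mix_ge1 hE (uniform_is_policy R x0).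

Lemma problem_size_le :
  [/\ 1 <= size, t_mix M <= Z, kappa <= Z & cbar <= Z] /\
  [/\ omega <= Z, omega^-1 <= Z, (1 - Gamma)^-1 <= Z & mubar^-1 <= Z] /\
  [/\ #|{: S * A}|%:R <= Z, eps_approx M Psi u <= Z, l2norm theta0 <= Z & eps^-1 <= Z].
Proof.
have [_ G1] := set_Gamma hS.
have i0 : 0 <= #|{: S * A}|%:R :> R by [].
have i1 : 0 <= omega^-1 by rewrite invr_ge0 ltW.
have i2 : 0 <= (1 - Gamma)^-1 by rewrite invr_ge0; lra.
have i3 : 0 <= mubar^-1 by rewrite invr_ge0 ltW.
have i4 : 0 <= (min_lambda_perturbed M u)^-1 by rewrite invr_ge0 ltW.
have i5 := l2norm_ge0 theta0.
have i6 : 0 <= eps^-1 by rewrite invr_ge0 ltW.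
have k0 := kap0; have c0 := cb0; have o0 := omega0; have e1 := eps1; have t1 := tm1.
rewrite /log_arg /problem_size; split; [split|split; split]; lra.
Qed.

Lemma log_arg_ge3 : 3 <= Z.
Proof. by have [[h _ _ _] _] := problem_size_le; rewrite /log_arg; lra. Qed.
Let Z3 := log_arg_ge3.
Let Z0 : 0 < Z. Proof. by have := Z3; lra. Qed.
Let Z1 : 1 <= Z. Proof. by have := Z3; lra. Qed.
Let L23 : 2 / 3 <= L := ln_ge_two_thirds Z3.
Let zx k : 0 < Z ^+ k := pow_gt0 Z3 k.

(* From [2 * 2^-n] with [n + 1 >= 256 ln Z] and [ln 2 >= 1/2]. *)
Definition mix_error : R := (Z ^+ 128)^-1 * 4.
Local Notation delta := mix_error.

Lemma mix_error_ge0 : 0 <= delta.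
Proof. by rewrite mulr_ge0// invr_ge0 ltW. Qed.

(** Two of the 128 powers pay for the factor 4. *)
Lemma mix_error_le k : (k <= 126)%N -> delta * Z ^+ k <= 1.
Proof.
move=> k126; have e : Z ^+ 128 = Z ^+ 126 * Z ^+ 2 by rewrite -exprD.
have h : Z ^+ k <= Z ^+ 126 by apply: ler_weXn2l.
have d4 : delta = 4 / Z ^+ 2 / Z ^+ 126.
  by rewrite /mix_error e invfM; move: (_ ^-1) (_ ^-1) => p q; ring.
have z9 : 4 / Z ^+ 2 <= 1.
  rewrite ler_pdivrMr// mul1r; apply: le_trans (pow_num Z3 (_ : 4 <= 3 ^+ 2)) _ => //; lra.
rewrite d4 mulrAC ler_pdivrMr// mul1r.
by apply: le_trans h; rewrite ler_piMl// ltW.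
Qed.

Section OnePolicy.
Variable pi : S -> A -> R.
Hypothesis hpi : is_policy pi.
Implicit Types (v w : 'cV[R]_d) (x : position S A).

Local Notation b := (tbeta_gap M Psi u pi).
Local Notation m := (mu M Psi u pi).
Local Notation G := (gram_norm M Psi u pi).
Local Notation th := (td_solution M Psi u pi).
Local Notation B := (residual_bound M Psi u cbar).
Local Notation par := (evrtd_choice M Psi u (std_consts R) L pi).

Let hst := stationary_spec hE hpi.
Let hpert := perturbed_is_policy hS hpi.
Let b0 : 0 < b := tbeta_gt0 hS hpi.
Let b1 : b <= 8^-1 := tbeta_le hS hpi.
Let m0 : 0 < m := mu_gt0 hS hpi.
Let m1 : m <= 1 := mu_le1 hS hpi.
Let D0 : 0 < m * b ^+ 2. Proof. by rewrite mulr_gt0// exprn_gt0. Qed.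

Lemma mu_inv_le : m^-1 <= mubar^-1.
Proof. by rewrite lef_pV2 ?posrE// (set_mu hS). Qed.

Lemma long_walk_mixed k : 256 * (t_mix M * L) <= k.+1%:R -> cost_mixed M pi k.+1 delta.
Proof.
move=> hk; have [t0 [t01 t0m mixt]] := mixing_step hE hpi.
have h : cost_mixed M pi k.+1 (2 * 2^-1 ^+ (k %/ t0)) by apply: walk_mixed.
move=> x f Bf fB; apply: le_trans (h x f Bf fB) _.
apply: ler_wpM2r; first by apply: le_trans (fB x.1).
apply: half_pow_le => //.
have h1 : k.+1%:R <= t0%:R * ((k %/ t0)%:R + 1) :> R.
  by rewrite natr1 -natrM ler_nat mulnC ltn_ceil.
have t0p : 0 < t0%:R :> R by rewrite ltr0n.
rewrite -(ler_pM2l t0p); apply: le_trans h1; apply: le_trans hk.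
have L0 : 0 <= L by have := L23; lra.
have := ler_wpM2r L0 t0m; lra.
Qed.

Let tau_ge : 256 * (t_mix M * L) <= (natceil (256 * (t_mix M * L)))%:R :> R.
Proof.
apply: (natceil_bounds _).1; apply: mulr_ge0; first exact: ler0n.
by apply: mulr_ge0; [have := tm1|have := L23]; lra.
Qed.

Lemma tuned_mix : sample_mixed M pi u (natceil (256 * (t_mix M * L))) delta.
Proof.
have := tau_ge; case: (natceil _) => [|k] hk.
  (* A mixing bound needs at least one transition; the prescribed length is positive. *)
  have : 0 < 256 * (t_mix M * L) by apply: mulr_gt0; [rewrite ltr0n|apply: mulr_gt0; [have := tm1|have := L23]; lra].
  by rewrite ltNge hk.
exact: cost_mixed_sample (long_walk_mixed hk).
Qed.

Lemma tuned_cost_mix : cost_mixed M pi (natceil (256 * (t_mix M * L))).+1 delta.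
Proof. by apply: long_walk_mixed; apply: le_trans tau_ge _; rewrite ler_nat. Qed.

Lemma tuned_eta_gt0 : 0 < p_eta par.
Proof. by rewrite /= mulr_gt0. Qed.

Lemma tuned_eta_le : p_eta par <= b / 128 / 64.
Proof. by rewrite /=; lra. Qed.

Lemma tuned_T : 64 <= (p_T par)%:R * (m * b * p_eta par).
Proof.
have e0 : 0 < m * b * p_eta par by rewrite !mulr_gt0// tuned_eta_gt0.
by rewrite -ler_pdivrMr//; apply: (natceil_bounds _).1; rewrite divr_ge0// ltW.
Qed.

Lemma tuned_N : 512 * 64 <= (p_N par)%:R * (m * b ^+ 2).
Proof.
rewrite -ler_pdivrMr; last exact: D0.
apply: (natceil_bounds _).1; apply: divr_ge0; last exact: ltW.
by rewrite mulr_ge0 ?ler0n.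
Qed.

Lemma tuned_N' : 64 <= (p_N' par)%:R * (m * b ^+ 2).
Proof.
by rewrite -ler_pdivrMr//; apply: (natceil_bounds _).1; rewrite divr_ge0// ltW.
Qed.

Lemma mu_inv_pow : m^-1 <= Z ^+ 1.
Proof.
by have [_ [[_ _ _ h] _]] := problem_size_le; apply: le_trans mu_inv_le _; rewrite expr1.
Qed.

Lemma tbeta_inv_pow : b^-1 <= Z ^+ 2.
Proof.
have [[_ h2 h3 _] _] := problem_size_le.
apply: le_trans (tbeta_inv_le hS hpi) _.
have t0 : 0 <= t_mix M by have := tm1; lra.
exact: (pow_mul Z3 t0 (pow_one h3) (pow_one h2)).
Qed.

Let minv := mu_inv_pow.
Let binv := tbeta_inv_pow.
Let mi0 : 0 <= m^-1. Proof. by rewrite invr_ge0 ltW. Qed.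
Let bi0 : 0 <= b^-1. Proof. by rewrite invr_ge0 ltW. Qed.

Lemma tuned_delta : delta <= m ^+ 2 * b ^+ 2 / 512 / 64.
Proof.
have h1 : 512 <= Z ^+ 6 by apply: pow_num => //; lra.
have h2 : 64 <= Z ^+ 4 by apply: pow_num => //; lra.
have mb0 : 0 <= m^-1 * b^-1 by rewrite mulr_ge0.
have h3 := pow_mul Z3 bi0 minv binv.
have h4 := pow_mul Z3 mb0 h3 h3.
have n0 : 0 <= 64 :> R by [].
have n1 : 0 <= 512 * 64 :> R by rewrite mulr_ge0 ?ler0n.
have h5 := pow_mul Z3 n1 h4 (pow_mul Z3 n0 h1 h2).
set a := m ^+ 2 * b ^+ 2 / 512 / 64.
have a0 : 0 < a by rewrite /a !mulr_gt0 ?invr_gt0 ?exprn_gt0 ?ltr0n.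
have h9 : a^-1 <= Z ^+ 16.
  have -> : a^-1 = m^-1 * b^-1 * (m^-1 * b^-1) * (512 * 64).
    by rewrite /a !invfM !invrK; ring.
  exact: h5.
have ai0 : 0 < a^-1 by rewrite invr_gt0.
rewrite -(ler_pM2r ai0) mulfV ?gt_eqF//.
apply: le_trans (mix_error_le (k := 16) isT).
by rewrite ler_wpM2l ?mix_error_ge0.
Qed.

End OnePolicy.
End Tuning.

Lemma epoch_length_le (R : realType) (prm : evrtd_params R) (c1 c2 c3 q v : R) :
  (p_N' prm)%:R <= c1 * q -> (p_N prm)%:R <= c2 * q -> (p_T prm)%:R <= c3 * q ->
  (p_tau prm).+1%:R <= v -> (p_tau' prm).+1%:R <= v ->
  (epoch_length prm)%:R <= (c1 + c2 + c3) * q * v.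
Proof.
move=> h1 h2 h3 t1 t2; rewrite /epoch_length !natrD !natrM !mulrDl.
by apply: lerD; [apply: lerD|]; apply: ler_pM.
Qed.

(** * Bias, mean-square error and cost of tuned EVRTD *)

Section TunedEvaluation.
Variables (R : realType) (S A : finType) (M : amdp R S A) (d : nat)
  (Psi : 'M[R]_(#|{: S * A}|, d)) (u Gamma mubar kappa cbar : R) (x0 : S * A)
  (omega eps : R) (theta0 : 'cV[R]_d).
Hypothesis hS : setting M Psi u Gamma mubar kappa cbar.
Hypotheses (omega0 : 0 < omega) (eps0 : 0 < eps).

Local Notation size := (problem_size M Psi u kappa cbar omega Gamma mubar eps theta0).
Local Notation Z := (log_arg M Psi u kappa cbar omega Gamma mubar eps theta0).
Local Notation L := (ln Z).

Variable pi : S -> A -> R.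
Hypothesis hpi : is_policy pi.
Implicit Types (v w : 'cV[R]_d) (x : position S A).

Local Notation b := (tbeta_gap M Psi u pi).
Local Notation m := (mu M Psi u pi).
Local Notation G := (gram_norm M Psi u pi).
Local Notation th := (td_solution M Psi u pi).
Local Notation B := (residual_bound M Psi u cbar).
Local Notation par := (evrtd_choice M Psi u (std_consts R) L pi).
Local Notation delta := (mix_error M Psi u Gamma mubar kappa cbar omega eps theta0).

Let hE := set_ergodic hS.
Let mub0 : 0 < mubar := set_mubar hS.
Let kap0 : 0 < kappa. Proof. by case: (set_pos hS). Qed.
Let cb0 : 0 < cbar. Proof. by case: (set_pos hS). Qed.
Let lam0 : 0 < min_lambda_perturbed M u := min_lambda_gt0 x0 hS.
Let eps1 : 0 <= eps_approx M Psi u := eps_approx_ge0 x0 hS.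
Let tm1 : 1 <= t_mix M := t_mix_ge1 hE hpi.
Let sizes := problem_size_le x0 theta0 hS omega0 eps0.
Let Z3 : 3 <= Z := log_arg_ge3 x0 theta0 hS omega0 eps0.
Let Z0 : 0 < Z. Proof. by have := Z3; lra. Qed.
Let Z1 : 1 <= Z. Proof. by have := Z3; lra. Qed.
Let L23 : 2 / 3 <= L := ln_ge_two_thirds Z3.
Let minv : m^-1 <= Z ^+ 1 := mu_inv_pow x0 theta0 hS omega0 eps0 hpi.
Let binv : b^-1 <= Z ^+ 2 := tbeta_inv_pow x0 theta0 hS omega0 eps0 hpi.
Let b0 : 0 < b := tbeta_gt0 hS hpi.
Let b1 : b <= 8^-1 := tbeta_le hS hpi.
Let m0 : 0 < m := mu_gt0 hS hpi.
Let m1 : m <= 1 := mu_le1 hS hpi.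
Let B0 : 0 < B := residual_bound_gt0 x0 hS hpi.

Let n2 : 2 <= 3 ^+ 1 :> R. Proof. lra. Qed.
Let n4 : 4 <= 3 ^+ 2 :> R. Proof. lra. Qed.
Let n22 : 22 <= 3 ^+ 3 :> R. Proof. lra. Qed.
Let n6 : 6 <= 3 ^+ 2 :> R. Proof. lra. Qed.
Let n32 : 32 <= 3 ^+ 4 :> R. Proof. lra. Qed.
Let n64 : 64 <= 3 ^+ 4 :> R. Proof. lra. Qed.

Let t0 : 0 <= t_mix M. Proof. by have := tm1; lra. Qed.
Let tZ : t_mix M <= Z ^+ 1. Proof. by case: sizes => -[_ h _ _] _; rewrite expr1. Qed.
Let kZ : kappa <= Z ^+ 1. Proof. by case: sizes => -[_ _ h _] _; rewrite expr1. Qed.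
Let cZ : cbar <= Z ^+ 1. Proof. by case: sizes => -[_ _ _ h] _; rewrite expr1. Qed.
Let mbZ : mubar^-1 <= Z ^+ 1. Proof. by case: sizes => _ [[_ _ _ h] _]; rewrite expr1. Qed.
Let eZ : eps_approx M Psi u <= Z ^+ 1.
Proof. by case: sizes => _ [_ [_ h _ _]]; rewrite expr1. Qed.
Let thZ : l2norm theta0 <= Z ^+ 1.
Proof. by case: sizes => _ [_ [_ _ h _]]; rewrite expr1. Qed.

Lemma residual_bound_pow : B <= Z ^+ 6.
Proof.
have k1 := pow_mul Z3 t0 (pow_mul Z3 (ltW cb0) (pow_num Z3 n22) cZ) tZ.
exact: (pow_add Z3 (pow_mono Z3 (l := 5) eZ isT) k1).
Qed.

Lemma td_solution_pow : l2norm th <= Z ^+ 6.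
Proof.
apply: le_trans (td_solution_le hS hpi) _.
have k0 : 0 <= kappa * t_mix M by rewrite mulr_ge0// ltW.
have i0 : 0 <= mubar^-1 by rewrite invr_ge0 ltW.
have k1 := pow_mul Z3 k0 (pow_mul Z3 (ltW cb0) (pow_num Z3 n4) cZ) (pow_mul Z3 t0 kZ tZ).
exact: (pow_mul Z3 i0 k1 mbZ).
Qed.

Lemma initial_gram_pow : G (theta0 - th) <= Z ^+ 14.
Proof.
apply: le_trans (gram_le hS hpi _) _; rewrite -sqr_l2norm.
have h : l2norm (theta0 - th) <= Z ^+ 7.
  apply: le_trans (l2normD _ _) _; rewrite l2normN.
  exact: (pow_add Z3 (pow_mono Z3 (l := 6) thZ isT) td_solution_pow).
exact: (pow_mul Z3 (l2norm_ge0 _) h h).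
Qed.

Let eta0 : 0 < p_eta par := tuned_eta_gt0 omega eps theta0 hS hpi.
Let heta : p_eta par <= b / 128 / 64 := tuned_eta_le _ _ _ _ _ _ _ _ _ _ _.

Lemma horizon_pow : (p_T par)%:R * p_eta par <= Z ^+ 8.
Proof.
have e0 := eta0.
have me0 : 0 < m * b * p_eta par by rewrite !mulr_gt0.
have x1 : 0 <= 64 / (m * b * p_eta par) by rewrite divr_ge0// ltW.
have := (natceil_bounds x1).2 => h.
apply: le_trans (ler_wpM2r (ltW e0) h) _.
have -> : (64 / (m * b * p_eta par) + 1) * p_eta par = 64 * m^-1 * b^-1 + p_eta par.
  by move: me0 => _; field; rewrite !gt_eqF.
have mi0 : 0 <= m^-1 by rewrite invr_ge0 ltW.
have bi0 : 0 <= b^-1 by rewrite invr_ge0 ltW.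
apply: (pow_add Z3); first exact: (pow_mul Z3 bi0 (pow_mul Z3 mi0 (pow_num Z3 n64) minv) binv).
apply: (@le_trans _ _ 1); last exact: exprn_ege1.
by have := heta; have := b1; rewrite /=; lra.
Qed.

Lemma bias_factor_pow : bias_factor M Psi u cbar pi par <= Z ^+ 31.
Proof.
set Lm := (p_T par)%:R * p_eta par.
have L0 : 0 <= Lm by rewrite mulr_ge0// ltW.
have LZ : Lm <= Z ^+ 8 := horizon_pow.
have mi0 : 0 <= m^-1 by rewrite invr_ge0 ltW.
have LL0 : 0 <= (2 + 2 * Lm) * B ^+ 2 by rewrite mulr_ge0 ?sqr_ge0//; lra.
have k1 : 6 / m <= Z ^+ 3 := pow_mul Z3 mi0 (pow_num Z3 n6) minv.
have k2 : 6 / m + 6 <= Z ^+ 4 := pow_add Z3 k1 (pow_mono Z3 (l := 3) (pow_num Z3 n6) isT).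
have k3 : 2 * Lm <= Z ^+ 9 := pow_mul Z3 L0 (pow_num Z3 n2) LZ.
have k4 : 6 / m + 6 + 2 * Lm <= Z ^+ 10 := pow_add Z3 (pow_mono Z3 (l := 9) k2 isT) k3.
have k5 : 2 + 2 * Lm <= Z ^+ 10 := pow_add Z3 (pow_mono Z3 (l := 9) (pow_num Z3 n2) isT) k3.
have k6 : B ^+ 2 <= Z ^+ 12 := pow_mul Z3 (ltW B0) residual_bound_pow residual_bound_pow.
have k7 := pow_mul Z3 (sqr_ge0 B) k5 k6.
have k8 := pow_add Z3 (pow_mono Z3 (l := 22) k4 isT) k7.
rewrite /bias_factor -/Lm.
have q0 : 0 <= 6 / m + 6 + 2 * Lm + (2 + 2 * Lm) * B ^+ 2.
  have q6 : 0 <= 6 / m by rewrite divr_ge0// ltW.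
  by lra.
exact: (pow_mul Z3 q0 LZ k8).
Qed.

Let npar := p_epochs par.

Let npar_bounds : 64 * L <= npar%:R /\ npar%:R <= 64 * L + 1.
Proof.
have l0 : 0 <= L by have := L23; lra.
exact: natceil_bounds (mulr_ge0 (ler0n R 64) l0).
Qed.

Lemma epochs_pow : npar%:R <= Z ^+ 6.
Proof.
apply: le_trans npar_bounds.2 _.
have l1 : L <= Z ^+ 1 by rewrite expr1 ltW// ln_sublinear.
have l0 : 0 <= L by have := L23; lra.
have h := pow_mul Z3 l0 (pow_num Z3 n64) l1.
apply: (pow_add Z3 h); exact: exprn_ege1.
Qed.

Lemma half_epochs : 2^-1 ^+ npar <= (Z ^+ 31)^-1.
Proof.
have e (p : R) : p * 4 <= 2 * (p * 2) by lra.
have := half_pow_le (Z := Z) Z3 (n := npar) (c := 32) => /(_ _) h.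
have h1 : 2 * 2^-1 ^+ npar <= (Z ^+ 32)^-1 * 4.
  by apply: h; have := npar_bounds.1; lra.
have h2 := pow_inv_double Z3 31.
apply: le_trans h2; rewrite -(@ler_pM2l _ 2)//; apply: le_trans h1 _.
exact: e.
Qed.

Lemma half_epochs_pow a k : (k <= 31)%N -> 0 <= a -> a <= Z ^+ k -> 2^-1 ^+ npar * a <= (Z ^+ (31 - k))^-1.
Proof.
move=> k31 a0 ak; apply: (@le_trans _ _ ((Z ^+ 31)^-1 * Z ^+ k)).
  by apply: ler_pM => //; exact: half_epochs.
have e : Z ^+ 31 = Z ^+ (31 - k) * Z ^+ k by rewrite -exprD subnK.
have zn : Z ^+ k != 0 by rewrite gt_eqF// (pow_gt0 Z3).
by rewrite e invfM -mulrA mulVf// mulr1.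
Qed.

Let hd0 : 0 <= delta := mix_error_ge0 x0 theta0 hS omega0 eps0.
Let hd := tuned_delta x0 theta0 hS omega0 eps0 hpi.
Let hmix : sample_mixed M pi u (p_tau par) delta :=
  tuned_mix x0 theta0 hS omega0 eps0 hpi.
Let hmix' : sample_mixed M pi u (p_tau' par) delta :=
  tuned_mix x0 theta0 hS omega0 eps0 hpi.
Let hmixc : cost_mixed M pi (p_tau' par).+1 delta :=
  tuned_cost_mix x0 theta0 hS omega0 eps0 hpi.
Let hT : 64 <= (p_T par)%:R * (m * b * p_eta par) := tuned_T omega eps theta0 hS hpi.
Let hN : 512 * 64 <= (p_N par)%:R * (m * b ^+ 2) := tuned_N omega eps theta0 hS hpi.
Let hN' : 64 <= (p_N' par)%:R * (m * b ^+ 2) := tuned_N' omega eps theta0 hS hpi.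

Lemma evrtd_gram x :
  expect (evrtd M Psi u pi par theta0 x) (fun y => G (y.1 - th)) <= 1 + 2 * B ^+ 2.
Proof.
have h := epochs_gram x0 hS hpi hd0 hd hmix hmix' hmixc eta0 heta hT hN hN' npar theta0 x.
apply: le_trans h _.
have h := half_epochs_pow (isT : (14 <= 31)%N) (gram_ge0 hS hpi _) initial_gram_pow.
rewrite lerD2r; apply: le_trans h _.
by rewrite invf_le1 ?exprn_gt0// exprn_ege1.
Qed.

Lemma evrtd_bias w x :
  `|expect (evrtd M Psi u pi par theta0 x) (fun y => dot w (y.1 - th))| <=
  l2norm w * (omega * eps / 32).
Proof.
have h := epochs_bias x0 hS hpi hd0 hd hmix hmix' hmixc eta0 heta hT hN hN' w npar theta0 x.
apply: le_trans h _.
apply: ler_wpM2l; first exact: l2norm_ge0.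
set g := G _; have g0 : 0 <= g by exact: (gram_ge0 hS hpi).
have gZ : g <= Z ^+ 14 := initial_gram_pow.
have mi0 : 0 <= m^-1 by rewrite invr_ge0 ltW.
have one k : 1 <= Z ^+ k by exact: exprn_ege1.
have h1 : 1 + g / m <= Z ^+ 16 := pow_add Z3 (one 15) (pow_mul Z3 mi0 gZ minv).
have h2 : 2^-1 ^+ npar * (1 + g / m) <= (Z ^+ 15)^-1.
  by apply: (half_epochs_pow (k := 16)) h1 => //; rewrite addr_ge0// mulr_ge0.
set Y := bias_factor _ _ _ _ _ _.
have Y0 : 0 <= Y by exact: (bias_factor_ge0 hS hpi eta0 hT).
have h3 : 1 + g + npar%:R * B ^+ 2 <= Z ^+ 19.
  apply: (pow_add Z3); first exact: (pow_mono Z3 (l := 18) (pow_add Z3 (one 14) gZ) isT).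
  exact: (pow_mul Z3 (sqr_ge0 B) epochs_pow
    (pow_mul Z3 (ltW B0) residual_bound_pow residual_bound_pow)).
have q0 : 0 <= 1 + g + npar%:R * B ^+ 2 by rewrite !addr_ge0// mulr_ge0 ?sqr_ge0.
have h4 := pow_mul Z3 q0 (pow_mul Z3 Y0 epochs_pow bias_factor_pow) h3.
rewrite [(_ + _)%N]/= in h4.
have h5 : npar%:R * (delta * Y) * (1 + g + npar%:R * B ^+ 2) <= (Z ^+ 7)^-1.
  have -> : npar%:R * (delta * Y) * (1 + g + npar%:R * B ^+ 2) =
    delta * (npar%:R * Y * (1 + g + npar%:R * B ^+ 2)) by ring.
  apply: le_trans (ler_wpM2l hd0 h4) _.
  rewrite -[leRHS]mul1r ler_pdivlMr ?exprn_gt0// -mulrA -exprD.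
  exact: (mix_error_le x0 theta0 hS omega0 eps0).
have h6 : (Z ^+ 15)^-1 <= (Z ^+ 7)^-1.
  by rewrite lef_pV2 ?posrE ?exprn_gt0//; exact: ler_weXn2l.
(* Of the 7 remaining powers one pays for adding two errors; the other 6 cover [32], [omega^-1] and
   [eps^-1], of degrees 4, 1 and 1. *)
have h7 := pow_inv_double Z3 6.
have h8 : (Z ^+ 6)^-1 <= omega * eps / 32.
  have a0 : 0 < omega * eps / 32 by rewrite !mulr_gt0// invr_gt0.
  rewrite invf_ple ?posrE ?exprn_gt0//.
  have -> : (omega * eps / 32)^-1 = 32 * omega^-1 * eps^-1.
    by rewrite !invfM invrK; ring.
  have [_ [[_ o1 _ _] [_ _ _ e1]]] := sizes.
  have i1 : 0 <= omega^-1 by rewrite invr_ge0 ltW.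
  have i2 : 0 <= eps^-1 by rewrite invr_ge0 ltW.
  exact: (pow_mul Z3 i2 (pow_mul Z3 i1 (pow_num Z3 n32) (pow_one o1)) (pow_one e1)).
apply: le_trans (lerD h2 h5) _; apply: le_trans (lerD h6 (lexx _)) _.
by apply: le_trans h8; apply: le_trans h7; rewrite mulr_natr mulr2n.
Qed.

Lemma val_sqr_gram v z :
  coord (Psi *m v) z ^+ 2 <= G v / min_lambda_perturbed M u.
Proof.
have l0 := lam0.
rewrite ler_pdivlMr// mulrC; apply: (@le_trans _ _ (perturbed_weight M pi u z * coord (Psi *m v) z ^+ 2)).
  by rewrite ler_wpM2r ?sqr_ge0 ?(min_lambda_le x0 hS).
rewrite /gram_norm /sqnorm (bigD1 z)//= lerDl sumr_ge0// => y _.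
by rewrite mulr_ge0 ?sqr_ge0 ?(wt_ge0 hS hpi).
Qed.

Lemma spnorm_sqr_gram v :
  spnorm (coord (Psi *m v)) ^+ 2 <= 4 * (G v / min_lambda_perturbed M u).
Proof.
set q := G v / _.
have q0 : 0 <= q by rewrite divr_ge0 ?(gram_ge0 hS hpi)// ltW.
have h : spnorm (coord (Psi *m v)) <= 2 * Num.sqrt q.
  apply: (spnorm_le_norm x0) => z; rewrite -sqrtr_sqr ler_sqrt//; exact: val_sqr_gram.
have -> : 4 * q = (2 * Num.sqrt q) ^+ 2 by rewrite exprMn sqr_sqrtr//; ring.
by rewrite ler_pXn2r ?nnegrE ?(spnorm_ge0 x0)// mulr_ge0.
Qed.

(** The span is at most twice the largest coordinate, which the weighted norm bounds after division
    by the smallest weight. From [8 * (1 + 2 * B ^+ 2) + 2 * ea ^+ 2] and [B ^+ 2 <= 2 * ea ^+ 2 + 2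
    * (22 * cbar * tm) ^+ 2] comes [42 = 8 + 32 + 2]. *)
Lemma evrtd_mse_le x : evrtd_mse M Psi u pi par theta0 x <=
  (42 + 8 * (44 * cbar) ^+ 2) *
    ((mubar^-1 * t_mix M ^+ 2 + (mubar^-1 + 1) * eps_approx M Psi u ^+ 2)
     / min_lambda_perturbed M u).
Proof.
set l := min_lambda_perturbed M u; set ea := eps_approx M Psi u; set tm := t_mix M.
have lx := law_on_evrtd hS hpi par theta0 x.
have l1 : l <= 1 := min_lambda_le1 x0 hS.
have li : 1 <= l^-1 by rewrite invf_ge1.
have mbi : 1 <= mubar^-1.
  by rewrite invf_ge1//; apply: le_trans m1; exact: (set_mu hS).
have h : evrtd_mse M Psi u pi par theta0 x <= 8 * ((1 + 2 * B ^+ 2) / l) + 2 * ea ^+ 2.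
  apply: (@le_trans _ _ (expect (evrtd M Psi u pi par theta0 x)
     (fun y => 8 / l * G (y.1 - th) + 2 * ea ^+ 2))); last first.
    rewrite expectD (expect_cst _ lx) expectZ.
    have l8 : 0 <= 8 / l by rewrite divr_ge0// ltW// lam0.
    by have := ler_wpM2l l8 (evrtd_gram x); lra.
  apply: expect_le lx _ => y _.
  have e1 : spnorm (fun z => coord (Psi *m y.1) z - Qbar M pi z) <=
      spnorm (coord (Psi *m (y.1 - th))) + ea.
    have -> : (fun z => coord (Psi *m y.1) z - Qbar M pi z) =
        (fun z => coord (Psi *m (y.1 - th)) z + (coord (Psi *m th) z - Qbar M pi z)).
      by apply/funext => z; rewrite addrA -valD subrK.
    apply: le_trans (spnormD x0 _ _) _; rewrite lerD2l; exact: (eps_approx_ge x0 hS hpi).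
  have s0 := spnorm_ge0 x0 (fun z => coord (Psi *m y.1) z - Qbar M pi z).
  have s1 := spnorm_ge0 x0 (coord (Psi *m (y.1 - th))).
  have s2 := spnorm_sqr_gram (y.1 - th).
  have s3 : spnorm (fun z => coord (Psi *m y.1) z - Qbar M pi z) ^+ 2 <=
      (spnorm (coord (Psi *m (y.1 - th))) + ea) ^+ 2.
    have s4 : 0 <= spnorm (coord (Psi *m (y.1 - th))) + ea by exact: addr_ge0.
    by rewrite ler_pXn2r ?nnegrE.
  apply: le_trans s3 _; rewrite -/l in s2.
  by have := sqr_ge0 (spnorm (coord (Psi *m (y.1 - th))) - ea); lra.
apply: le_trans h _.
have B2 : B ^+ 2 <= 2 * ea ^+ 2 + 2 * (22 * cbar * tm) ^+ 2.
  by rewrite /residual_bound -/ea -/tm; have := sqr_ge0 (ea - 22 * cbar * tm); lra.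
have li0 : 0 <= l^-1 by lra.
have e2 := sqr_ge0 ea; have t2 : 1 <= tm ^+ 2 by rewrite exprn_ege1.
have c2 := sqr_ge0 cbar.
have k1 : tm ^+ 2 <= mubar^-1 * tm ^+ 2 by rewrite ler_peMl// sqr_ge0.
have k2 : 0 <= mubar^-1 * ea ^+ 2 by rewrite mulr_ge0//; lra.
have k3 := ler_wpM2l c2 k1.
have k4 : ea ^+ 2 <= ea ^+ 2 * l^-1 by rewrite ler_peMr.
have k5 : 8 * (1 + 2 * B ^+ 2) + 2 * ea ^+ 2 <=
   (42 + 8 * (44 * cbar) ^+ 2) * (mubar^-1 * tm ^+ 2 + (mubar^-1 + 1) * ea ^+ 2).
  have k6 : 0 <= cbar ^+ 2 * ((mubar^-1 + 1) * ea ^+ 2) by rewrite mulr_ge0// mulr_ge0//; lra.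
  lra.
have := ler_wpM2r li0 k5; lra.
Qed.

(** [66] bounds the epochs per unit of [ln Z] and [259] the transitions per sample, both with their
    roundings; the sum counts the samples for [N'], [N] and [T], each ceiling adding 1, and
    [128 * 64] is the inverse of the constant in [eta]. *)
Definition count_const : R :=
  66 * (259 * ((64 + 1) + (512 * 64 + 1) + (64 * (128 * 64) + 1))).

Lemma evrtd_count : (p_epochs par * epoch_length par)%:R <=
  count_const * (kappa ^+ 2 * (t_mix M ^+ 3 / mubar) * L ^+ 2).
Proof.
pose Q := kappa ^+ 2 * t_mix M ^+ 2 / mubar; pose W := t_mix M * L.
have l23 := L23; have tm1' := tm1; have bb := b1; have mm := m1.
have W23 : 2 / 3 <= W by have := ler_wpM2l (ltW (_ : 0 < L)) tm1; rewrite /W; lra.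
have mi0 : 0 < m^-1 by rewrite invr_gt0.
have bi0 : 0 < b^-1 by rewrite invr_gt0.
have D1 : m * b ^+ 2 <= 1.
  rewrite -[leRHS]mulr1; apply: ler_pM => //; [exact: ltW|exact: sqr_ge0|].
  by apply: exprn_ile1; [exact: ltW|lra].
have Q1 : (m * b ^+ 2)^-1 <= Q.
  rewrite invfM -exprVn mulrC /Q -exprMn; apply: ler_pM.
  - exact: sqr_ge0.
  - exact: ltW.
  - by apply: lerXn2r; rewrite ?nnegrE ?(ltW bi0) ?mulr_ge0 ?(ltW kap0)//; exact: (tbeta_inv_le hS hpi).
  - exact: (mu_inv_le hS hpi).
have D0 : 0 < m * b ^+ 2 by rewrite mulr_gt0// exprn_gt0.
have Q2 : 1 <= (m * b ^+ 2)^-1 by rewrite invf_ge1.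
have cnt (c : R) : 0 <= c -> (natceil (c / (m * b ^+ 2)))%:R <= (c + 1) * Q.
  move=> c0; have h0 : 0 <= c / (m * b ^+ 2) by rewrite divr_ge0// ltW.
  apply: le_trans (natceil_bounds h0).2 _; rewrite mulrDl mul1r; apply: lerD.
    by apply: ler_wpM2l.
  exact: le_trans Q2 Q1.
have hN1 : (p_N par)%:R <= (512 * 64 + 1) * Q by apply: cnt; rewrite mulr_ge0 ?ler0n.
have hN2 : (p_N' par)%:R <= (64 + 1) * Q by exact: cnt.
have hT1 : (p_T par)%:R <= (64 * (128 * 64) + 1) * Q.
  have -> : p_T par = natceil (64 * (128 * 64) / (m * b ^+ 2)).
    congr natceil; rewrite /=; field.
    by rewrite !gt_eqF.
  by apply: cnt; rewrite mulr_ge0 ?mulr_ge0 ?ler0n.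
have W0 : 0 <= W by lra.
have htau : (natceil (256 * W)).+1%:R <= 259 * W.
  have h0 : 0 <= 256 * W by rewrite mulr_ge0 ?ler0n.
  by have := (natceil_bounds h0).2; rewrite -natr1; lra.
have Q0 : 0 <= Q by lra.
pose c1 : R := 64 + 1; pose c2 : R := 512 * 64 + 1; pose c3 : R := 64 * (128 * 64) + 1.
have hlen : (epoch_length par)%:R <= (c1 + c2 + c3) * Q * (259 * W).
  exact: (epoch_length_le hN2 hN1 hT1 htau htau).
have hep : (p_epochs par)%:R <= 66 * L.
  by apply: le_trans npar_bounds.2 _; lra.
rewrite natrM; apply: le_trans (ler_pM _ _ hep hlen) _ => //.
have -> : 66 * L * ((c1 + c2 + c3) * Q * (259 * W)) =
  (66 * (259 * (c1 + c2 + c3))) * (kappa ^+ 2 * (t_mix M ^+ 3 / mubar) * L ^+ 2).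
  by rewrite /Q /W; move: (c1 + c2 + c3) => c; ring.
by rewrite /count_const.
Qed.

End TunedEvaluation.

(** * The proximal step *)

Section Entropy.
Variables (R : realType) (A : finType).
Implicit Types (p q r : A -> R).

Lemma kl_term (x y : R) : 0 <= x -> 0 < y -> x - y <= x * ln (x / y).
Proof.
move=> x0 y0; have [->|xn] := eqVneq x 0; first by rewrite !mul0r sub0r oppr_le0 ltW.
have xp : 0 < x by rewrite lt_def xn.
have h : ln (y / x) <= y / x - 1.
  have := @le_ln1Dx R (y / x - 1); have -> : 1 + (y / x - 1) = y / x by ring.
  by apply; rewrite ltrBrDl subrr divr_gt0.
have -> : x / y = (y / x)^-1 by rewrite invf_div.
rewrite lnV ?posrE ?divr_gt0// mulrN.
have := ler_wpM2l (ltW xp) h; have -> : x * (y / x - 1) = y - x by field.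
lra.
Qed.

Lemma kl_ge0 p r : simplex p -> simplex r -> (forall a, 0 < r a) -> 0 <= kl p r.
Proof.
move=> [p0 p1] [_ r1] r0.
have -> : 0 = \sum_a (p a - r a) by rewrite sumrB p1 r1 subrr.
by apply: ler_sum => a _; exact: kl_term.
Qed.

Lemma kl_refl q : (forall a, 0 < q a) -> kl q q = 0.
Proof.
by move=> q0; rewrite /kl big1// => a _; rewrite divff ?gt_eqF// ln1 mulr0.
Qed.

Lemma mul_ln_div (x y z : R) : 0 <= x -> 0 < y -> 0 < z ->
  x * ln (x / z) = x * ln (x / y) + x * ln (y / z).
Proof.
move=> x0 y0 z0; have [->|xn] := eqVneq x 0; first by rewrite !mul0r addr0.
have xp : 0 < x by rewrite lt_def xn.
rewrite -mulrDr -lnM ?posrE ?divr_gt0//; congr (x * ln _).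
by field; rewrite !gt_eqF.
Qed.

Lemma kl_split p r q : (forall a, 0 <= p a) -> (forall a, 0 < r a) -> (forall a, 0 < q a) ->
  kl p q = kl p r + \sum_a p a * ln (r a / q a).
Proof.
by move=> p0 r0 q0; rewrite /kl -big_split; apply: eq_bigr => a _; exact: mul_ln_div.
Qed.

Definition mix_with (t : R) p q : A -> R := fun a => (1 - t) * p a + t * q a.

Lemma simplex_mix t p q : 0 <= t -> t <= 1 -> simplex p -> simplex q ->
  simplex (mix_with t p q).
Proof.
move=> t0 t1 [p0 p1] [q0 q1]; split=> [a|].
  by rewrite addr_ge0// mulr_ge0// subr_ge0.
by rewrite big_split /= -!mulr_sumr p1 q1; ring.
Qed.

Lemma mix_gt0 t p q a : 0 < t -> t <= 1 -> 0 <= p a -> 0 < q a -> 0 < mix_with t p q a.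
Proof.
by move=> t0 t1 p0 q0; rewrite ltr_wpDl ?mulr_gt0// mulr_ge0// subr_ge0.
Qed.

(** Both endpoints are compared with the mixture by [kl_term]; the first-order terms cancel. *)
Lemma entropy_convex (t x y q : R) : 0 < t -> t <= 1 -> 0 <= x -> 0 < y -> 0 < q ->
  ((1 - t) * x + t * y) * ln (((1 - t) * x + t * y) / q) <=
    (1 - t) * (x * ln (x / q)) + t * (y * ln (y / q)).
Proof.
move=> t0 t1 x0 y0 q0; have : exists z, z = (1 - t) * x + t * y by eexists.
case=> z zE; rewrite -zE.
have z0 : 0 < z by rewrite zE ltr_wpDl ?mulr_gt0// mulr_ge0// subr_ge0.
have h1 := kl_term x0 z0; have h2 := kl_term (ltW y0) z0.
rewrite (mul_ln_div x0 z0 q0) (mul_ln_div (ltW y0) z0 q0).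
have t1' : 0 <= 1 - t by rewrite subr_ge0.
have := ler_wpM2l t1' h1; have := ler_wpM2l (ltW t0) h2.
move: (ln (z / q)) (ln (x / z)) (ln (y / z)) => l1 l2 l3; rewrite zE; lra.
Qed.

(* Hellinger form of Pinsker's inequality, with a worse constant. *)
Lemma l1_sqr_le_kl p q : simplex p -> simplex q -> (forall a, 0 < q a) ->
  (\sum_a `|p a - q a|) ^+ 2 <= 4 * kl p q.
Proof.
move=> [p0 p1] [q0' q1] q0.
pose sp a := Num.sqrt (p a); pose sq a := Num.sqrt (q a).
pose H := \sum_a (sp a - sq a) ^+ 2.
have spE a : sp a ^+ 2 = p a by rewrite sqr_sqrtr.
have sqE a : sq a ^+ 2 = q a by rewrite sqr_sqrtr.
have sp0 a : 0 <= sp a by exact: sqrtr_ge0.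
have sq0 a : 0 < sq a by rewrite sqrtr_gt0.
have HK : H <= kl p q.
  have -> : H = \sum_a (2 * (p a - sp a * sq a) - (p a - q a)).
    by apply: eq_bigr => a _; rewrite -(spE a) -(sqE a); ring.
  rewrite sumrB [X in _ - X]sumrB p1 q1 subrr subr0.
  apply: ler_sum => a _; have [p00|pn] := eqVneq (p a) 0.
    by rewrite /sp p00 sqrtr0 !mul0r subrr mulr0.
  have pp : 0 < sp a by rewrite sqrtr_gt0 lt_def pn p0.
  have -> : p a / q a = (sp a / sq a) ^+ 2 by rewrite expr_div_n spE sqE.
  rewrite lnXn ?divr_gt0// -mulr_natl.
  have := kl_term (sp0 a) (sq0 a) => /(ler_wpM2l (ltW pp)).
  by rewrite -(spE a); lra.
have H0 : 0 <= H by apply: sumr_ge0 => a _; exact: sqr_ge0.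
have h s : 0 < s -> \sum_a `|p a - q a| <= s * 2 + H / (2 * s).
  move=> s0.
  have e : \sum_a (s * (p a + q a) + (2 * s)^-1 * (sp a - sq a) ^+ 2) = s * 2 + H / (2 * s).
    rewrite big_split /= -!mulr_sumr big_split /= p1 q1 -/H; lra.
  rewrite -e; apply: ler_sum => a _.
  have -> : p a - q a = (sp a - sq a) * (sp a + sq a) by rewrite -(spE a) -(sqE a); ring.
  rewrite normrM (ger0_norm (addr_ge0 (sp0 a) (ltW (sq0 a)))).
  have ss : 0 <= (2 * s)^-1 by rewrite invr_ge0 mulr_ge0// ltW.
  have := sqr_ge0 (s * (sp a + sq a) - `|sp a - sq a|) => k1.
  have := mulr_ge0 ss k1.
  have -> : (sp a - sq a) ^+ 2 = `|sp a - sq a| ^+ 2 by rewrite real_normK ?num_real.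
  rewrite -(spE a) -(sqE a); move: (sp a) (sq a) (`|sp a - sq a|) => x y n.
  have -> : (2 * s)^-1 * (s * (x + y) - n) ^+ 2 =
     s / 2 * (x + y) ^+ 2 - n * (x + y) + (2 * s)^-1 * n ^+ 2 by field; rewrite gt_eqF.
  have := mulr_ge0 (ltW s0) (sqr_ge0 (x - y)); lra.
have T0 : 0 <= \sum_a `|p a - q a| by apply: sumr_ge0.
apply: (@le_trans _ _ (4 * H)); last by rewrite ler_pM2l.
move: T0; set W := \sum_a _ in h * => W0.
have [->|Wn] := eqVneq W 0; first by rewrite expr0n /= mulr_ge0.
have Wp : 0 < W by rewrite lt_def Wn.
(* The free weight [s] of the arithmetic-geometric bound; this choice gives [W ^+ 2 <= 4 * H]. *)
have := h (W / 4); rewrite divr_gt0// => /(_ isT).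
have -> : H / (2 * (W / 4)) = 2 * H / W by field.
rewrite -(ler_pM2l Wp); have -> : W * (W / 4 * 2 + 2 * H / W) = W ^+ 2 / 2 + 2 * H by field.
lra.
Qed.

Lemma ln_mix_near (t x y : R) : 0 < t -> t <= 2^-1 -> 0 < x -> 0 <= y -> y <= 1 ->
  `|ln ((1 - t) * x + t * y) - ln x| <= t * (2 + x^-1).
Proof.
move=> t0 t1 x0 y0 y1; set z := (1 - t) * x + t * y.
have z2 : x / 2 <= z by have := ler_wpM2r (ltW x0) t1; have := mulr_ge0 (ltW t0) y0; rewrite /z; lra.
have z0 : 0 < z by apply: lt_le_trans z2; rewrite divr_gt0.
have lnle (r s : R) : 0 < r -> 0 < s -> ln r - ln s <= r / s - 1.
  move=> r0 s0; rewrite -ln_div ?posrE//.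
  have := @le_ln1Dx R (r / s - 1); have -> : 1 + (r / s - 1) = r / s by ring.
  by apply; rewrite ltrBrDl subrr divr_gt0.
have i0 : 0 <= x^-1 by rewrite invr_ge0 ltW.
rewrite ler_norml; apply/andP; split.
  have := lnle x z x0 z0.
  have : x / z - 1 <= 2 * t.
    rewrite lerBlDr ler_pdivrMr//.
    have := ler_wpM2l (ltW t0) z2; have := mulr_ge0 (ltW t0) y0; rewrite /z; lra.
  have := mulr_ge0 (ltW t0) i0; lra.
apply: le_trans (lnle z x z0 x0) _.
have -> : z / x - 1 = t * (y / x - 1) by rewrite /z; field; rewrite gt_eqF.
apply: ler_wpM2l; first exact: ltW.
have : y / x <= x^-1 by rewrite -[leRHS]mul1r ler_pM2r ?invr_gt0.
lra.
Qed.

End Entropy.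

(** * Existence, positivity and three-point inequality of the minimizer *)

Section Prox.
Variables (R : realType) (A : finType) (h : (A -> R) -> R) (omega hb : R).
Hypotheses (hcc : closed_convex h) (hsc : strongly_convex omega h) (omega0 : 0 < omega)
  (hbound : forall p, simplex p -> `|h p| <= hb).
Variables (f q : A -> R) (lambda : R).
Hypotheses (q1 : simplex q) (q0 : forall a, 0 < q a) (lambda0 : 0 < lambda).

Definition prox_obj (p : A -> R) : R := lambda * (\sum_a f a * p a + h p) + kl p q.

Lemma nbhs_coord (a : A) (p : {ptws A -> R}) e : 0 < e ->
  nbhs p [set p' : {ptws A -> R} | `|p a - p' a| < e].
Proof.
move=> e0; have := @proj_continuous A (fun=> R) a p.
by move/(_ _ (nbhsx_ballx (p a) e e0)).
Qed.

Lemma nbhs_linear (c : A -> R) (p : {ptws A -> R}) e : 0 < e ->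
  nbhs p [set p' : {ptws A -> R} | `|\sum_a c a * p a - \sum_a c a * p' a| < e].
Proof.
suff sc : forall (l : seq A) e', 0 < e' -> nbhs p [set p' : {ptws A -> R} |
    `|\sum_(a <- l) c a * p a - \sum_(a <- l) c a * p' a| < e'] by exact: sc.
elim=> [|a l IH] e' e0.
  by apply: (filterS _ (@filterT _ (nbhs p) _)) => p' _ /=; rewrite !big_nil subrr normr0.
have c0 : 0 < `|c a| + 1 by rewrite ltr_wpDl.
have e1 : 0 < e' / 2 by rewrite divr_gt0.
apply: (filterS _ (filterI (nbhs_coord a p (divr_gt0 e1 c0)) (IH _ e1))) => p' /= [h1 h2].
rewrite !big_cons; move: h2; set x := \sum_(j <- l) _; set y := \sum_(j <- l) _ => h2.
have -> : c a * p a + x - (c a * p' a + y) = c a * (p a - p' a) + (x - y) by ring.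
apply: le_lt_trans (ler_normD _ _) _; rewrite normrM.
move: h1; rewrite ltr_pdivlMr// => h1; have := normr_ge0 (p a - p' a); lra.
Qed.

(** The entropy is minorized by a linear, hence continuous, function: [kl p' q] is at least the sum
    of [p' a * ln (r a / q a)] for a positive [r]. With [r] a mixture of [p] and [q] this is nearly
    exact at [p], since [r >= (1 - t) p]. *)
Lemma prox_obj_lsc (p : {ptws A -> R}) e : simplex p -> 0 < e ->
  nbhs p [set p' : {ptws A -> R} | simplex p' -> prox_obj p - e <= prox_obj p'].
Proof.
move=> hp e0.
(* The minorant loses [2 * t <= e / 4] at [p]; the linear part varies by less than [e / 2] and the
   regularizer drops by at most [e / 8]. *)
pose t : R := Num.min 2^-1 (e / 8).
have t0 : 0 < t by rewrite lt_min invr_gt0 divr_gt0// ltr0n.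
have t12 : t <= 2^-1 by rewrite ge_min lexx.
have t8 : t <= e / 8 by rewrite ge_min lexx orbT.
have t1 : t <= 1 by lra.
have h1t : 0 < 1 - t by lra.
pose r := mix_with t p q.
have r0 a : 0 < r a by apply: mix_gt0 => //; case: hp.
have r1 : simplex r by apply: simplex_mix => //; exact: ltW.
pose c a := lambda * f a + ln (r a / q a).
have e1 : 0 < e / 2 by rewrite divr_gt0.
have e2 : 0 < e / 8 / lambda by rewrite !divr_gt0.
have n1 := nbhs_linear c p e1.
have [V nV hV] : exists2 V, nbhs p V & forall y : {ptws A -> R}, V y ->
    ((h p - e / 8 / lambda)%:E < (if `[< simplex y >] then (h y)%:E else +oo))%E.
  apply: (hcc.2 p); case: asboolP => // _; rewrite lte_fin; lra.
near=> p' => hp'.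
have hVp : h p - e / 8 / lambda < h p'.
  have /hV : V p' by near: p'.
  by case: asboolP => // _; rewrite lte_fin.
have hc : `|\sum_a c a * p a - \sum_a c a * p' a| < e / 2 by near: p'.
have k1 : lambda * (\sum_a f a * p' a) + \sum_a p' a * ln (r a / q a) = \sum_a c a * p' a.
  by rewrite mulr_sumr -big_split; apply: eq_bigr => a _ /=; rewrite /c; ring.
have k2 : lambda * (\sum_a f a * p a) + \sum_a p a * ln (r a / q a) = \sum_a c a * p a.
  by rewrite mulr_sumr -big_split; apply: eq_bigr => a _ /=; rewrite /c; ring.
have k3 : kl p q + ln (1 - t) <= \sum_a p a * ln (r a / q a).
  case: hp => p0 p1.
  have -> : kl p q + ln (1 - t) = \sum_a (p a * ln (p a / q a) + p a * ln (1 - t)).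
    by rewrite big_split /= -mulr_suml p1 mul1r.
  apply: ler_sum => a _; have [->|pn] := eqVneq (p a) 0; first by rewrite !mul0r addr0.
  have pp : 0 < p a by rewrite lt_def pn p0.
  have w0 : 0 < p a / q a by rewrite divr_gt0.
  have w1 : 0 < r a / q a by rewrite divr_gt0.
  rewrite -mulrDr ler_pM2l// -lnM ?posrE// ler_ln ?posrE//; last exact: mulr_gt0.
  rewrite mulrAC ler_pM2r ?invr_gt0// /r /mix_with mulrC lerDl mulr_ge0 1?ltW//.
have k4 : - (2 * t) <= ln (1 - t).
  have := @le_ln1Dx R ((1 - t)^-1 - 1); have -> : 1 + ((1 - t)^-1 - 1) = (1 - t)^-1 by ring.
  rewrite lnV ?posrE// => hh.
  have h2 : (1 - t)^-1 - 1 <= 2 * t.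
    rewrite lerBlDr -[leLHS]mul1r ler_pdivrMr//; have := ler_wpM2l (ltW t0) t12; lra.
  have : - ln (1 - t) <= (1 - t)^-1 - 1 by apply: hh; rewrite ltrBrDl subrr invr_gt0.
  lra.
have k5 : \sum_a p' a * ln (r a / q a) <= kl p' q.
  have p'0 : forall a, 0 <= p' a by case: hp'.
  by rewrite (kl_split p'0 r0 q0) lerDr kl_ge0.
have k6 : lambda * (h p - e / 8 / lambda) <= lambda * h p' by rewrite ler_wpM2l// ltW.
have k7 : lambda * (h p - e / 8 / lambda) = lambda * h p - e / 8.
  by field; rewrite gt_eqF.
move: hc; rewrite ltr_norml => /andP[_ hc].
rewrite /prox_obj !mulrDr; rewrite k7 in k6; lra.
Unshelve. all: by end_near. Qed.

Lemma prox_obj_lbound p : simplex p ->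
  - (lambda * (\sum_a `|f a| + hb)) <= prox_obj p.
Proof.
move=> hp; have k := kl_ge0 hp q1 q0.
have h1 : - \sum_a `|f a| <= \sum_a f a * p a.
  rewrite -sumrN; apply: ler_sum => a _.
  have := ler_norm (- (f a * p a)); rewrite normrN normrM (ger0_norm (proj1 hp a)).
  have := ler_wpM2l (normr_ge0 (f a)) (simplex_le1 a hp); rewrite mulr1; lra.
have h2 : - hb <= h p by have := hbound hp; rewrite ler_norml => /andP[].
have : lambda * (- (\sum_a `|f a| + hb)) <= lambda * (\sum_a f a * p a + h p).
  by rewrite ler_wpM2l//; [exact: ltW|lra].
rewrite /prox_obj; lra.
Qed.

(** A minimizing sequence has a cluster point in the cube, which is compact by Tychonoff's theorem;
    the point lies in the simplex because the total mass is continuous, and it is a minimizer by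
    lower semicontinuity. *)
Lemma prox_exists : exists p, simplex p /\ forall p', simplex p' -> prox_obj p <= prox_obj p'.
Proof.
pose E := [set prox_obj p | p in simplex (R := R) (T := A)].
have E0 : E !=set0 by exists (prox_obj q); exists q.
have El : has_lbound E.
  by exists (- (lambda * (\sum_a `|f a| + hb))) => _ [p hp <-]; exact: prox_obj_lbound.
set v := inf E.
have hE p : simplex p -> v <= prox_obj p by move=> hp; apply: ge_inf => //; exists p.
have /choice[s hs] : forall n : nat, exists p : {ptws A -> R},
    simplex p /\ prox_obj p < v + n.+1%:R^-1.
  move=> n; have n0 : 0 < n.+1%:R^-1 :> R by rewrite invr_gt0.
  by have [_ [p hp <-] h1] := inf_adherent n0 (conj E0 El); exists p.
have cK : compact [set p : {ptws A -> R} | forall a, `[0 : R, 1]%classic (p a)].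
  exact: (@tychonoff A (fun=> R) (fun=> `[0 : R, 1]%classic) (fun=> @segment_compact R 0 1)).
have [|p [pK pc]] := cK (s @ \oo) _.
  exists 0%N => // n _ a /=; rewrite in_itv /=; have [h1 _] := hs n.
  by rewrite (proj1 h1) (simplex_le1 a h1).
have hfind W N : nbhs p W -> exists2 n, (N <= n)%N & W (s n).
  move=> nW; have [|_ [[n hn <-] hW]] := pc (s @` [set n | (N <= n)%N]) W _ nW; last by exists n.
  by exists N => // n hn; exists n.
have hp : simplex p.
  split=> [a|]; first by have := pK a; rewrite /= in_itv /= => /andP[].
  apply/eqP/negP => /negP pn.
  have e0 : 0 < `|\sum_x p x - 1| by rewrite normr_gt0 subr_eq0.
  have [n _ /=] := hfind _ 0%N (nbhs_linear (fun=> 1) p e0).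
  under eq_bigr do rewrite mul1r; under [X in _ - X]eq_bigr do rewrite mul1r.
  by rewrite (proj2 (proj1 (hs n))) ltxx.
exists p; split=> // p' hp'; apply: le_trans (hE p' hp').
apply/ler_addgt0Pr => e e0; have e2 : 0 < e / 2 by rewrite divr_gt0.
have [N _ hN] := near_infty_natSinv_lt (PosNum e2).
have [n hn /= h1] := hfind _ N (prox_obj_lsc hp e2).
have [h2 h3] := hs n; have h4 : n.+1%:R^-1 < e / 2 := hN n hn.
move: (h1 h2) h3 h4; set z := prox_obj (s n); set w := n.+1%:R^-1.
lra.
Qed.

Section Minimizer.
Variable p' : A -> R.
Hypotheses (hp' : simplex p') (pmin : forall p, simplex p -> prox_obj p' <= prox_obj p).

(* The slope of the entropy at 0 is infinite. *)
Lemma prox_gt0 a : 0 < p' a.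
Proof.
rewrite lt_def (proj1 hp') andbT; apply/negP => /eqP pa0.
pose B := lambda * (\sum_a f a * (q a - p' a) + h q - h p').
have key t : 0 < t -> t <= 1 -> - (q a * ln t) <= B.
  move=> t0 t1; pose pt := mix_with t p' q.
  have hpt : simplex pt by apply: simplex_mix => //; exact: ltW.
  have hh : h pt <= (1 - t) * h p' + t * h q.
    have := hcc.1 p' q (1 - t) hp' q1; have -> : 1 - (1 - t) = t by ring.
    by apply; lra.
  have hf : \sum_a f a * pt a = \sum_a f a * p' a + t * \sum_a f a * (q a - p' a).
    by rewrite mulr_sumr -big_split; apply: eq_bigr => b _ /=; rewrite /pt /mix_with; ring.
  have hk : kl pt q <= (1 - t) * kl p' q + t * (q a * ln t).
    rewrite /kl (bigD1 a)//= [in leRHS](bigD1 a)//= pa0 mul0r add0r.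
    have -> : pt a = t * q a by rewrite /pt /mix_with pa0 mulr0 add0r.
    rewrite mulfK ?gt_eqF// mulrA addrC lerD2r mulr_sumr.
    apply: ler_sum => b _.
    have := entropy_convex t0 t1 (proj1 hp' b) (q0 b) (q0 b).
    by rewrite divff ?gt_eqF// ln1 !mulr0 addr0.
  have k0 := kl_ge0 hp' q1 q0.
  have l0 := lambda0.
  have k1 := ler_wpM2l (ltW l0) hh; have k2 := mulr_ge0 (ltW t0) k0.
  have := pmin hpt; rewrite /prox_obj hf => k3.
  rewrite -(ler_pM2l t0) /B; lra.
pose N := (`|B| + 1) / q a.
have N0 : 0 <= N by rewrite divr_ge0 ?addr_ge0// ltW.
have := key (expR (- N)); rewrite expR_gt0 expRK => /(_ isT).
have -> : - (q a * - N) = `|B| + 1 by rewrite /N; field; rewrite gt_eqF.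
have -> : expR (- N) <= 1 by rewrite expR_le1 oppr_le0.
move=> /(_ isT); have := ler_norm B; lra.
Qed.

(* The slope of [h] given at [p'] need not be the one of the optimality condition, which
   is therefore derived from the slopes along the segment from [p'] to [p]. *)
Lemma prox_three_point p : simplex p ->
  prox_obj p' + (1 + lambda * omega) * kl p p' <= prox_obj p.
Proof.
move=> hp.
pose E := \sum_a (2 + (p' a)^-1).
pose X := lambda * (\sum_a f a * (p a - p' a) + h p - h p')
   + \sum_a (p a - p' a) * ln (p' a / q a) - lambda * omega * kl p p'.
have p'0 a : 0 < p' a := prox_gt0 a.
have key t : 0 < t -> t <= 2^-1 -> 0 <= X + t * ((1 + lambda * omega) * E).
  move=> t0 t2; have t1 : t <= 1 by lra.
  pose pt := mix_with t p' p.
  have hpt : simplex pt by apply: simplex_mix => //; exact: ltW.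
  have pt0 a : 0 < pt a.
    by rewrite ltr_wpDr ?mulr_gt0 ?mulr_ge0 ?(proj1 hp)//; [exact: ltW|lra].
  (* The slope is taken at the positive mixture [pt]; it cancels between the inequalities at the two
     ends, weighted by [1 - t] and [t]. *)
  have [g hg] := hsc hpt pt0.
  have hgp := hg p hp; have hgp' := hg p' hp'.
  have e1 : (1 - t) * (\sum_a g a * (p' a - pt a)) + t * (\sum_a g a * (p a - pt a)) = 0.
    rewrite !mulr_sumr -big_split big1// => a _ /=; rewrite /pt /mix_with; ring.
  have k1 : 0 <= kl p' pt by exact: kl_ge0.
  have hh : h pt <= (1 - t) * h p' + t * h p - omega * t * kl p pt.
    have t1' : 0 <= 1 - t by lra.
    have := ler_wpM2l t1' hgp'; have := ler_wpM2l (ltW t0) hgp.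
    have := mulr_ge0 t1' (mulr_ge0 (ltW omega0) k1); lra.
  have hf : \sum_a f a * pt a = \sum_a f a * p' a + t * \sum_a f a * (p a - p' a).
    by rewrite mulr_sumr -big_split; apply: eq_bigr => b _ /=; rewrite /pt /mix_with; ring.
  have hk : kl pt q <= kl p' q + t * \sum_a (p a - p' a) * ln (pt a / q a).
    rewrite (kl_split (proj1 hp') pt0 q0).
    have -> : kl pt q = \sum_a p' a * ln (pt a / q a) + t * \sum_a (p a - p' a) * ln (pt a / q a).
      by rewrite mulr_sumr -big_split; apply: eq_bigr => b _ /=; rewrite /pt /mix_with; ring.
    lra.
  have near a : `|ln (pt a) - ln (p' a)| <= t * (2 + (p' a)^-1).
    by apply: ln_mix_near => //; [exact: (proj1 hp)|exact: simplex_le1].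
  have k2 : \sum_a (p a - p' a) * ln (pt a / q a) <=
      \sum_a (p a - p' a) * ln (p' a / q a) + t * E.
    rewrite mulr_sumr -big_split; apply: ler_sum => a _ /=.
    rewrite !ln_div ?posrE// -lerBlDl.
    have -> : (p a - p' a) * (ln (pt a) - ln (q a)) - (p a - p' a) * (ln (p' a) - ln (q a)) =
      (p a - p' a) * (ln (pt a) - ln (p' a)) by ring.
    apply: le_trans (ler_norm _) _; rewrite normrM.
    apply: le_trans (near a); rewrite ler_piMl//.
    have := simplex_le1 a hp; have := simplex_le1 a hp'.
    have := proj1 hp a; have := proj1 hp' a; rewrite ler_norml; lra.
  have k3 : kl p p' - t * E <= kl p pt.
    rewrite (kl_split (proj1 hp) p'0 pt0) -lerBlDl.
    have -> : kl p p' - t * E - kl p p' = \sum_a - (t * (2 + (p' a)^-1)).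
      by rewrite sumrN -mulr_sumr -/E; ring.
    apply: ler_sum => a _; rewrite ln_div ?posrE//.
    have := near a; have := ler_norm (p a * (ln (pt a) - ln (p' a))).
    rewrite normrM (ger0_norm (proj1 hp a)).
    have := ler_wpM2r (normr_ge0 (ln (pt a) - ln (p' a))) (simplex_le1 a hp); lra.
  have lo : 0 < lambda * omega by rewrite mulr_gt0.
  have k4 := ler_wpM2l (ltW lo) k3.
  have k5 := ler_wpM2l (ltW lambda0) hh.
  have := pmin hpt; rewrite /prox_obj hf => k6.
  rewrite -(pmulr_rge0 _ t0).
  have := ler_wpM2l (ltW t0) k2; have := ler_wpM2l (ltW t0) k4; rewrite /X; lra.
have X0 : 0 <= X.
  have E0 : 0 <= E by apply: sumr_ge0 => a _; rewrite addr_ge0// invr_ge0 ltW.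
  have lo : 0 < lambda * omega by rewrite mulr_gt0.
  set F := (1 + lambda * omega) * E in key.
  have F0 : 0 <= F by rewrite mulr_ge0// addr_ge0// ltW.
  rewrite leNgt; apply/negP => Xn.
  (* Small enough that the error linear in [t] cannot make up for a negative [X]. *)
  pose t := Num.min 2^-1 (- X / (2 * (F + 1))).
  have f1 : 0 < 2 * (F + 1) by lra.
  have t0 : 0 < t by rewrite lt_min invr_gt0 ltr0n /= divr_gt0// oppr_gt0.
  have t2 : t <= 2^-1 by rewrite ge_min lexx.
  have t3 : t <= - X / (2 * (F + 1)) by rewrite ge_min lexx orbT.
  move: t3; rewrite ler_pdivlMr// => t3.
  have := key t t0 t2; lra.
have e1 := kl_split (proj1 hp) p'0 q0.
have e2 : \sum_a (p a - p' a) * ln (p' a / q a) = \sum_a p a * ln (p' a / q a) - kl p' q.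
  by rewrite -sumrB; apply: eq_bigr => a _; ring.
have e3 : \sum_a f a * (p a - p' a) = \sum_a f a * p a - \sum_a f a * p' a.
  by rewrite -sumrB; apply: eq_bigr => a _; ring.
rewrite /prox_obj; move: X0; rewrite /X e2 e3; lra.
Qed.

End Minimizer.

End Prox.

(** * Descent of SPMD *)

Section Spmd.
Variables (R : realType) (S A : finType) (M : amdp R S A) (d : nat).
Variables (Psi : 'M[R]_(#|{: S * A}|, d)) (u Gamma mubar kappa cbar : R) (x0 : S * A).
Hypothesis hS : setting M Psi u Gamma mubar kappa cbar.
Variables (omega : R) (pistar : S -> A -> R).
Hypotheses (omega0 : 0 < omega) (hreg : is_regularizer M omega) (hopt : optimal M pistar).
Implicit Types (pi : S -> A -> R) (f : S * A -> R).

Let ratio : R := Gamma / (1 - Gamma).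

(** Two distinct states have stationary mass at least [1 - Gamma] each. *)
Lemma Gamma_ge_half : 2^-1 <= Gamma.
Proof.
have [s' hs] := exists_other_state hS x0.1.
have hu := uniform_is_policy R x0.
have [n0 n1] := stationary_simplex (set_ergodic hS) hu.
move: n1; rewrite (bigD1 x0.1)//= (bigD1 s')//= => n1.
have k1 := set_stationary hS hu x0.1; have k2 := set_stationary hS hu s'.
have : 0 <= \sum_(i | (i != x0.1) && (i != s')) stationary M (uniform_policy R (A:=A)) i.
  exact: sumr_ge0.
lra.
Qed.

Lemma ratio_ge1 : 1 <= ratio.
Proof.
have [g0 g1] := set_Gamma hS; have := Gamma_ge_half.
rewrite /ratio ler_pdivlMr; last by lra.
lra.
Qed.

(** Another state takes mass at least [1 - Gamma], so the left side is at most [Gamma], while the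
    right one has mass at least [1 - Gamma]. *)
Lemma stationary_ratio pi pi' s : is_policy pi -> is_policy pi' ->
  stationary M pi s <= ratio * stationary M pi' s.
Proof.
move=> hpi hpi'; have [g0 g1] := set_Gamma hS.
have [s' hs] := exists_other_state hS s.
have [n0 n1] := stationary_simplex (set_ergodic hS) hpi.
have k1 : stationary M pi s <= Gamma.
  move: n1; rewrite (bigD1 s)//= (bigD1 s')//= => n1.
  have k2 := set_stationary hS hpi s'.
  have : 0 <= \sum_(i | (i != s) && (i != s')) stationary M pi i by exact: sumr_ge0.
  lra.
apply: le_trans k1 _; rewrite /ratio mulrAC ler_pdivlMr; last by lra.
by rewrite ler_pM2l// (set_stationary hS hpi').
Qed.

Definition positive_policy pi : Prop := is_policy pi /\ forall s a, 0 < pi s a.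

Lemma uniform_positive : positive_policy (uniform_policy R (A:=A)).
Proof.
split; first exact: uniform_is_policy.
by move=> s a; rewrite invr_gt0 ltr0n; apply/card_gt0P; exists a.
Qed.

Lemma reg_bounded s p : simplex p -> `|reg M s p| <= cbar + `|cost M s x0.2|.
Proof.
move=> hp; have := set_cost hS s x0.2 hp.
have := ler_normB (cost M s x0.2 + reg M s p) (cost M s x0.2).
have -> : cost M s x0.2 + reg M s p - cost M s x0.2 = reg M s p by ring.
lra.
Qed.

Section Step.
Variables (pi : S -> A -> R) (f : S * A -> R) (lambda : R).
Hypotheses (hpi : positive_policy pi) (lambda0 : 0 < lambda).

Let pi' := prox M lambda pi f.
Let obj s := prox_obj (reg M s) (fun a => f (s, a)) (pi s) lambda.

Lemma prox_min s : simplex (pi' s) /\ forall p, simplex p -> obj s (pi' s) <= obj s p.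
Proof.
have [p hp] := prox_exists (hreg s).1 (reg_bounded s) (fun a => f (s, a)) (hpi.1 s) (hpi.2 s)
  lambda0.
rewrite /pi' /prox; case: xgetP => [p' _ //|hn].
by have := hn p hp.
Qed.

Lemma prox_positive : positive_policy pi'.
Proof.
split=> s; first exact: (prox_min s).1.
exact: (prox_gt0 (hreg s).1 (hpi.1 s) (hpi.2 s) lambda0 (prox_min s).1 (prox_min s).2).
Qed.

Lemma prox_three_points s p : simplex p ->
  obj s (pi' s) + (1 + lambda * omega) * kl p (pi' s) <= obj s p.
Proof.
exact: (prox_three_point (hreg s).1 (hreg s).2 omega0 (hpi.1 s) (hpi.2 s) lambda0
  (prox_min s).1 (prox_min s).2).
Qed.

Let delta z := f z - Qbar M pi z.
Let dist s := \sum_a `|pi' s a - pi s a|.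

Lemma span_pairing (g : S * A -> R) (p p' : A -> R) s : simplex p -> simplex p' ->
  `|\sum_a g (s, a) * (p a - p' a)| <= spnorm g * \sum_a `|p a - p' a|.
Proof.
move=> [_ hp] [_ hp'].
have -> : \sum_a g (s, a) * (p a - p' a) =
    \sum_a (g (s, a) - g (s, x0.2)) * (p a - p' a).
  under [RHS]eq_bigr do rewrite mulrBl.
  by rewrite sumrB -mulr_sumr [X in _ * X]sumrB hp hp' subrr mulr0 subr0.
apply: le_trans (ler_norm_sum _ _ _) _; rewrite mulr_sumr.
apply: ler_sum => a _; rewrite normrM ler_wpM2r// ler_norml.
have := le_spnorm g (s, a) (s, x0.2); have := le_spnorm g (s, x0.2) (s, a); lra.
Qed.

(** The next policy depends on the error it is paired with, so no averaging is possible. The product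
    is split as [d * y <= d ^+ 2 / 4 + y ^+ 2], and the first square is below the divergence by
    Pinsker's inequality. *)
Lemma noise_absorbed s : lambda * `|\sum_a delta (s, a) * (pi' s a - pi s a)|
  <= kl (pi' s) (pi s) + lambda ^+ 2 * spnorm delta ^+ 2.
Proof.
have h1 := span_pairing delta s (prox_min s).1 (hpi.1 s).
have h2 := l1_sqr_le_kl (prox_min s).1 (hpi.1 s) (hpi.2 s).
have := ler_wpM2l (ltW lambda0) h1; move: h2; rewrite -/pi' -/(dist s).
have := sqr_ge0 (dist s / 2 - lambda * spnorm delta).
move: (dist s) (spnorm delta) (kl _ _) (`|_|) => x y k n; lra.
Qed.

Let gain s := \sum_a Qbar M pi (s, a) * (pi' s a - pi s a) + reg M s (pi' s) - reg M s (pi s).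

Lemma sum_shift s (p : A -> R) : \sum_a f (s, a) * pi' s a - \sum_a f (s, a) * p a =
  \sum_a Qbar M pi (s, a) * (pi' s a - pi s a) - \sum_a Qbar M pi (s, a) * (p a - pi s a)
  + \sum_a delta (s, a) * (pi' s a - pi s a) - \sum_a delta (s, a) * (p a - pi s a).
Proof.
rewrite -!sumrB -big_split -!sumrB; apply: eq_bigr => a _ /=; rewrite /delta; ring.
Qed.

(** The three-point inequality at the current policy: per state, the step loses at most the absorbed
    noise. This sign information allows the state weights to be exchanged in [prox_descent]. *)
Lemma gain_le s : lambda * gain s <= lambda ^+ 2 * spnorm delta ^+ 2.
Proof.
have := prox_three_points s (hpi.1 s).
have k0 := kl_ge0 (hpi.1 s) (prox_min s).1 (prox_positive.2 s).
have k1 := mulr_ge0 (ltW (mulr_gt0 lambda0 omega0)) k0.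
rewrite /obj /prox_obj (kl_refl (hpi.2 s)).
have z (g : S * A -> R) : \sum_a g (s, a) * (pi s a - pi s a) = 0.
  by rewrite big1// => a _; rewrite subrr mulr0.
have := congr1 (fun y => lambda * y) (sum_shift s (pi s)); rewrite !z.
have := noise_absorbed s.
have := ler_norm (- \sum_a delta (s, a) * (pi' s a - pi s a)); rewrite normrN.
move=> /(ler_wpM2l (ltW lambda0)); rewrite /gain -/pi'; lra.
Qed.

(* The second term pays for the factor [ratio] lost when the weights of [pistar] are replaced
   by the stationary distribution of the new policy. *)
Definition potential lam pi1 : R :=
  divergence M pistar pi1 pistar + lam * (ratio - 1) * (rho M pi1 - rho M pistar).

Lemma prox_descent : lambda * omega * ratio <= 1 ->
  (1 + lambda * omega) * potential lambda pi' <= potential lambda pi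
    + ratio * lambda ^+ 2 * spnorm delta ^+ 2
    + lambda * \sum_s stationary M pistar s * \sum_a delta (s, a) * (pistar s a - pi s a).
Proof.
move=> lor; have R1 := ratio_ge1.
have hE := set_ergodic hS; have hst := hopt.1; have hp' := prox_positive.1.
have [ns0 ns1] := stationary_simplex hE hst.
have [np0 np1] := stationary_simplex hE hp'.
pose c := lambda ^+ 2 * spnorm delta ^+ 2.
pose nu s := stationary M pistar s.
have pd1 := performance_difference (set_amdp hS) hE (set_cost hS) hpi.1 hp'.
have pd2 := performance_difference (set_amdp hS) hE (set_cost hS) hpi.1 hst.
have h1 : ratio * (lambda * (rho M pi' - rho M pi)) - (ratio - 1) * c <=
    \sum_s nu s * (lambda * gain s).
  (* Exchange of weights: both factors are nonnegative, by [stationary_ratio] and by [gain_le]. *)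
  have : 0 <= \sum_s (ratio * stationary M pi' s - nu s) * (c - lambda * gain s).
    apply: sumr_ge0 => s _; rewrite mulr_ge0// subr_ge0; last exact: gain_le.
    exact: stationary_ratio.
  have -> : \sum_s (ratio * stationary M pi' s - nu s) * (c - lambda * gain s) =
      ratio * c * \sum_s stationary M pi' s - c * \sum_s nu s
      - ratio * (lambda * \sum_s stationary M pi' s * gain s) + \sum_s nu s * (lambda * gain s).
    rewrite !mulr_sumr -sumrB -sumrB -big_split; apply: eq_bigr => s _ /=; ring.
  rewrite np1 ns1 -pd1; lra.
have h2 : \sum_s nu s * (lambda * gain s) - lambda * (rho M pistar - rho M pi) - c
    - lambda * (\sum_s nu s * \sum_a delta (s, a) * (pistar s a - pi s a))
    + (1 + lambda * omega) * divergence M pistar pi' pistar <= divergence M pistar pi pistar.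
  have cE : \sum_s nu s * c = c by rewrite -mulr_suml ns1 mul1r.
  rewrite pd2 -[X in _ - X - _]cE /divergence !mulr_sumr -!sumrB -big_split /=.
  apply: ler_sum => s _; rewrite -/(nu s).
  have := prox_three_points s (hst s); rewrite /obj /prox_obj => h.
  have hn := noise_absorbed s.
  have hm := ler_norm (- \sum_a delta (s, a) * (pi' s a - pi s a)); rewrite normrN in hm.
  have := ler_wpM2l (ltW lambda0) hm.
  have := congr1 (fun y => lambda * y) (sum_shift s (pistar s)).
  move=> k1 k2.
  have k3 : lambda * gain s - lambda * (\sum_a Qbar M pi (s, a) * (pistar s a - pi s a) +
      reg M s (pistar s) - reg M s (pi s)) - c
      - lambda * \sum_a delta (s, a) * (pistar s a - pi s a)
      + (1 + lambda * omega) * kl (pistar s) (pi' s) <= kl (pistar s) (pi s).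
    rewrite /gain /c; lra.
  have := ler_wpM2l (ns0 s) k3; rewrite -/(nu s); lra.
(* The condition on the stepsize lets the coefficient [ratio] of the new gap dominate
   [(1 + lambda * omega) * (ratio - 1)]. *)
have h3 : 0 <= (1 - lambda * omega * (ratio - 1)) * (lambda * (rho M pi' - rho M pistar)).
  apply: mulr_ge0; last by rewrite mulr_ge0 ?subr_ge0 ?hopt.2// ltW.
  have := mulr_gt0 lambda0 omega0; lra.
rewrite /potential -/nu; rewrite /c in h1 h2; lra.
Qed.

End Step.

End Spmd.

(** * Expected descent along the run *)

Section Iterations.
Variables (R : realType) (S A : finType) (M : amdp R S A) (d : nat).
Variables (Psi : 'M[R]_(#|{: S * A}|, d)) (u Gamma mubar kappa cbar : R) (x0 : S * A).
Hypothesis hS : setting M Psi u Gamma mubar kappa cbar.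
Variables (omega : R) (pistar : S -> A -> R).
Hypotheses (omega0 : 0 < omega) (hreg : is_regularizer M omega) (hopt : optimal M pistar).
Variables (par : (S -> A -> R) -> evrtd_params R) (theta0 : 'cV[R]_d) (bias count : R).
Hypothesis hbias : forall pi, is_policy pi -> forall (w : 'cV[R]_d) (x : position S A),
  `|expect (evrtd M Psi u pi (par pi) theta0 x)
     (fun y => dot w (y.1 - td_solution M Psi u pi))| <= l2norm w * bias.
Hypothesis hcount : forall pi, is_policy pi ->
  (p_epochs (par pi) * epoch_length (par pi))%:R <= count.
Variable lambda : R.
Hypotheses (lambda0 : 0 < lambda).
Implicit Types (pi : S -> A -> R).

Let ratio : R := Gamma / (1 - Gamma).
Hypothesis hlam : lambda * omega * ratio <= 1.
Let Phi := potential M Gamma pistar lambda.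

Lemma bias_ge0 : 0 <= bias.
Proof.
have hu := uniform_is_policy R x0.
have [d0 _ _ _] := set_features hS.
have := hbias hu (const_mx 1) (x0, 0%N); move=> /(le_trans (normr_ge0 _)).
rewrite pmulr_rge0// /l2norm sqrtr_gt0.
rewrite (eq_bigr (fun=> 1)) => [|i _]; last by rewrite mxE expr1n.
by rewrite sumr_const card_ord ltr0n.
Qed.

Lemma expect_sum (X : Type) (T : finType) (m : law R X) (f : T -> X -> R) :
  expect m (fun x => \sum_i f i x) = \sum_i expect m (f i).
Proof.
rewrite /expect exchange_big /=; apply: eq_bigr => w _; exact: mulr_sumr.
Qed.

(** Writing the left side as a double average over [p] and [p'] avoids the factor 2 of an l1
    distance. *)
Lemma span_average (g : S * A -> R) (p p' : A -> R) s : simplex p -> simplex p' ->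
  \sum_a g (s, a) * (p a - p' a) <= spnorm g.
Proof.
move=> [p0 p1] [p'0 p'1].
have -> : \sum_a g (s, a) * (p a - p' a) = \sum_a p a * \sum_b p' b * (g (s, a) - g (s, b)).
  under [RHS]eq_bigr => a _.
    rewrite (eq_bigr (fun b => p' b * g (s, a) - p' b * g (s, b))) => [|b _]; last by ring.
    rewrite sumrB -mulr_suml p'1 mul1r mulrBr; over.
  rewrite sumrB -mulr_suml p1 mul1r -sumrB; apply: eq_bigr => a _; ring.
rewrite -[leRHS]mul1r -p1 mulr_suml; apply: ler_sum => a _; apply: ler_wpM2l => //.
rewrite -[leRHS]mul1r -p'1 mulr_suml; apply: ler_sum => b _; apply: ler_wpM2l => //.
exact: le_spnorm.
Qed.

(** Here [pi] is fixed and the pairing is linear in the estimator, so only its mean counts: the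
    projected solution contributes [eps_approx], and the bias is weighted by [pistar + pi], of mass
    2. *)
Lemma expected_bias pi (x : position S A) : is_policy pi ->
  expect (evrtd M Psi u pi (par pi) theta0 x)
    (fun y => \sum_s stationary M pistar s *
      \sum_a (coord (Psi *m y.1) (s, a) - Qbar M pi (s, a)) * (pistar s a - pi s a))
  <= eps_approx M Psi u + 2 * bias.
Proof.
move=> hpi; set m := evrtd _ _ _ _ _ _ _.
have hst := hopt.1; have hm := law_on_evrtd hS hpi (par pi) theta0 x; rewrite -/m in hm.
have [nu0 nu1] := stationary_simplex (set_ergodic hS) hst.
set th := td_solution M Psi u pi.
pose g z := coord (Psi *m th) z - Qbar M pi z.
have -> : expect m (fun y => \sum_s stationary M pistar s *
      \sum_a (coord (Psi *m y.1) (s, a) - Qbar M pi (s, a)) * (pistar s a - pi s a)) =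
   \sum_s stationary M pistar s * (\sum_a g (s, a) * (pistar s a - pi s a) +
     \sum_a (pistar s a - pi s a) * expect m (fun y => dot (psi Psi (s, a)) (y.1 - th))).
  rewrite expect_sum; apply: eq_bigr => s _; rewrite expectZ; congr (_ * _).
  rewrite expect_sum -big_split; apply: eq_bigr => a _ /=.
  rewrite -(expectZ m (pistar s a - pi s a)) -(expect_cst (g (s, a) * (pistar s a - pi s a)) hm) -expectD.
  apply: eq_expect_on hm _ => y _.
  by rewrite /g !coord_psi dotBr; ring.
have -> : eps_approx M Psi u + 2 * bias =
    \sum_s stationary M pistar s * (eps_approx M Psi u + 2 * bias).
  by rewrite -mulr_suml nu1 mul1r.
apply: ler_sum => s _; apply: ler_wpM2l => //; apply: lerD.
  exact: le_trans (span_average g s (hst s) (hpi s)) (eps_approx_ge x0 hS hpi).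
have -> : 2 * bias = \sum_a (pistar s a + pi s a) * bias.
  by rewrite -mulr_suml big_split /= (hst s).2 (hpi s).2.
apply: ler_sum => a _; apply: le_trans (ler_norm _) _; rewrite normrM.
apply: ler_pM => //.
  have := (hst s).1 a; have := (hpi s).1 a; rewrite ler_norml; lra.
apply: le_trans (hbias hpi _ x) _.
by rewrite ler_piMl ?bias_ge0// (l2norm_psi hS).
Qed.

Definition iterate_ok (n : nat) (z : (S -> A -> R) * position S A) : Prop :=
  positive_policy z.1 /\ z.2.2%:R <= n%:R * count.

Lemma law_on_spmd n : law_on (iterate_ok n) (spmd M Psi u lambda par theta0 x0 n).
Proof.
elim: n => [|n IH] /=.
  apply: law_on_ret; split=> /=; last by rewrite mul0r.
  exact: uniform_positive.
apply: law_on_bind IH _ => z [hz hc].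
apply: law_on_bind (law_on_evrtd hS hz.1 _ _ _) _ => y hy.
apply: law_on_ret; split=> /=; first exact: (prox_positive x0 hS hreg).
by rewrite hy natrD mulrSr mulrDl mul1r lerD// hcount//; case: hz.
Qed.

Lemma spmd_descent sigma n :
  almost_surely (spmd M Psi u lambda par theta0 x0 n)
    (fun z => evrtd_mse M Psi u z.1 (par z.1) theta0 z.2 <= sigma ^+ 2) ->
  (1 + lambda * omega) * expect (spmd M Psi u lambda par theta0 x0 n.+1) (fun z => Phi z.1)
  <= expect (spmd M Psi u lambda par theta0 x0 n) (fun z => Phi z.1)
     + ratio * lambda ^+ 2 * sigma ^+ 2 + lambda * (eps_approx M Psi u + 2 * bias).
Proof.
move=> has; rewrite /= expect_bind -expectZ.
have hl := law_on_spmd n.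
rewrite -addrA -[X in _ <= _ + X](expect_cst _ hl) -expectD.
apply: expect_le_as hl has _ => z [hz _] hmse.
have hm := law_on_evrtd hS hz.1 (par z.1) theta0 z.2.
rewrite expect_bind -expectZ.
pose del y := fun x => coord (Psi *m y) x - Qbar M z.1 x.
apply: (@le_trans _ _ (expect (evrtd M Psi u z.1 (par z.1) theta0 z.2)
  (fun y => Phi z.1 + (ratio * lambda ^+ 2 * spnorm (del y.1) ^+ 2
    + lambda * \sum_s stationary M pistar s *
       \sum_a del y.1 (s, a) * (pistar s a - z.1 s a))))).
  apply: expect_le hm _ => y _; rewrite expect_ret /= addrA.
  exact: (prox_descent x0 hS omega0 hreg hopt).
rewrite expectD (expect_cst _ hm) lerD2l expectD !expectZ.
apply: lerD; last by rewrite ler_pM2l//; exact: expected_bias hz.1.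
apply: ler_wpM2l; last exact: hmse.
by rewrite mulr_ge0 ?sqr_ge0//; have := ratio_ge1 x0 hS; rewrite -/ratio; lra.
Qed.

Lemma divergence_ge0 pi : positive_policy pi -> 0 <= divergence M pistar pi pistar.
Proof.
move=> hpi; apply: sumr_ge0 => s _; apply: mulr_ge0.
  exact: (stationary_simplex (set_ergodic hS) hopt.1).1.
exact: kl_ge0 (hopt.1 s) (hpi.1 s) (hpi.2 s).
Qed.

Lemma divergence_le_potential pi : is_policy pi -> divergence M pistar pi pistar <= Phi pi.
Proof.
move=> hpi; rewrite /Phi /potential lerDl.
by rewrite !mulr_ge0 ?subr_ge0 ?hopt.2 ?(ratio_ge1 x0 hS)// ltW.
Qed.

(** The subtracted constant is the fixed point of the recursion in [spmd_descent], so the excess of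
    the expected potential over it contracts at each iteration. The divergence replaces the
    potential only at the end. *)
Lemma spmd_divergence sigma N :
  (forall n, (n < N)%N -> almost_surely (spmd M Psi u lambda par theta0 x0 n)
    (fun z => evrtd_mse M Psi u z.1 (par z.1) theta0 z.2 <= sigma ^+ 2)) ->
  (1 + lambda * omega) ^+ N * (
    expect (spmd M Psi u lambda par theta0 x0 N) (fun z => divergence M pistar z.1 pistar)
    - (ratio * lambda * sigma ^+ 2 / omega + (eps_approx M Psi u + 2 * bias) / omega))
  <= Phi (uniform_policy R (A:=A)).
Proof.
move=> has; set B := ratio * lambda * sigma ^+ 2 / omega + _ / omega.
have B0 : 0 <= B.
  have r1 := ratio_ge1 x0 hS; have b0 := bias_ge0; have e0 := eps_approx_ge0 x0 hS.
  rewrite -/ratio in r1.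
  have r0 : 0 <= ratio by lra.
  have e1 : 0 <= eps_approx M Psi u + 2 * bias by lra.
  rewrite /B addr_ge0// divr_ge0 ?(ltW omega0)// mulr_ge0 ?sqr_ge0//.
  by rewrite mulr_ge0// ltW.
have lo := mulr_gt0 lambda0 omega0.
have lB : lambda * omega * B =
   ratio * lambda ^+ 2 * sigma ^+ 2 + lambda * (eps_approx M Psi u + 2 * bias).
  by rewrite /B; field; rewrite gt_eqF.
have key n : (n <= N)%N -> (1 + lambda * omega) ^+ n *
    (expect (spmd M Psi u lambda par theta0 x0 n) (fun z => Phi z.1) - B)
    <= Phi (uniform_policy R (A:=A)).
  elim: n => [_|n IH hn].
    by rewrite expr0 mul1r expect_ret /= gerBl.
  apply: le_trans (IH (ltnW hn)).
  rewrite exprSr -mulrA ler_wpM2l ?exprn_ge0 ?addr_ge0 ?(ltW lo)//.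
  have := spmd_descent (has n hn); lra.
apply: le_trans (key N (leqnn N)).
rewrite ler_wpM2l ?exprn_ge0 ?addr_ge0 ?(ltW lo)// lerD2r.
by apply: expect_le (law_on_spmd N) _ => z [hz _]; exact: divergence_le_potential hz.1.
Qed.

End Iterations.

(** * Number of iterations *)

Section Choice.
Variable R : realType.

(* It has to exceed [4 * 17 * 16]: the bounds [17 ln Y] on [q] and [16 ln Y] on [ln K]
   enter the requirement [4 W q ln K <= K]. *)
Definition iter_const : R := 3 ^+ 7.

Lemma iter_const_ge : 68 * 16 <= iter_const.
Proof. by rewrite /iter_const -natrX -natrM ler_nat. Qed.

(** [expR (- y) >= 1 - y] with [y = x / 2], and [(1 + x) * (1 - x / 2) >= 1] for [x] between 0 and
    1. *)
Lemma growth_ge (x : R) n : 0 <= x -> x <= 1 -> expR (x / 2 * n%:R) <= (1 + x) ^+ n.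
Proof.
move=> x0 x1; rewrite [x / 2 * _]mulrC expRM_natl lerXn2r ?nnegrE ?expR_ge0 ?addr_ge0//.
have h := expR_ge1Dx (- (x / 2)); rewrite expRN in h.
have e0 := expR_gt0 (x / 2).
have := ler_wpM2r (ltW e0) h; rewrite mulVf ?gt_eqF// => h1.
have := ler_wpM2l (addr_ge0 ler01 x0) h1.
have x1' : 0 <= 1 - x by rewrite subr_ge0.
have := mulr_ge0 (mulr_ge0 x0 (ltW e0)) x1'.
move: (expR _) => e; lra.
Qed.

(** The requirement on [K] is implicit through [ln K]. An a priori bound [K <= Y ^+ 16] makes [ln K]
    comparable to [ln Y], and the explicit choice [iter_const * ln Y ^+ 2 * W] suffices. *)
Lemma iterations_exist (Y W q : R) : 3 <= Y -> 1 <= W -> W <= Y ^+ 6 ->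
  0 <= q -> q <= 17 * ln Y ->
  exists K : nat, [/\ 8 <= K%:R :> R, 4 * W * (q * ln K%:R) <= K%:R
    & K%:R <= 2 * iter_const * ln Y ^+ 2 * W].
Proof.
move=> Y3 W1 WY q0 qY; have c1 := iter_const_ge.
have l0 := ln_ge_two_thirds Y3; set L := ln Y in l0 qY *.
have Y0 : 0 < Y by lra.
have LY : L <= Y by exact: ltW (ln_sublinear Y0).
have LL : 4 / 9 <= L ^+ 2 by have := sqr_ge0 (L - 2 / 3); lra.
have LLW : 4 / 9 <= L ^+ 2 * W by apply: le_trans LL _; rewrite ler_peMr// sqr_ge0.
set x := iter_const * L ^+ 2 * W.
have xc : iter_const * (4 / 9) <= x.
  by rewrite /x -mulrA ler_wpM2l//; lra.
have x0 : 0 <= x by lra.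
have [k1 k2] := natceil_bounds x0; set K := natceil x in k1 k2.
exists K; have K0 : 0 < K%:R :> R by lra.
have hx : x <= Y ^+ 15.
  rewrite /x (_ : 15 = 7 + 2 + 6)%N// !exprD; apply: ler_pM => //; try lra.
    by rewrite mulr_ge0 ?sqr_ge0//; lra.
  apply: ler_pM => //; first lra.
  - exact: sqr_ge0.
  - by rewrite /iter_const lerXn2r// nnegrE; lra.
  - by rewrite lerXn2r// nnegrE; lra.
have hK : ln K%:R <= 16 * L.
  have Y16 : K%:R <= Y ^+ 16.
    have y15 : 1 <= Y ^+ 15 by rewrite exprn_ege1//; lra.
    have : 3 * Y ^+ 15 <= Y ^+ 16 by rewrite [leRHS]exprS ler_wpM2r//; lra.
    lra.
  have : ln K%:R <= ln (Y ^+ 16) by rewrite ler_ln ?posrE ?exprn_gt0.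
  by rewrite lnXn// -[_ *+ 16]mulr_natl.
have lnK0 : 0 <= ln K%:R :> R by apply: ln_ge0; lra.
split.
- lra.
- have h1 : q * ln K%:R <= 17 * L * (16 * L) by apply: ler_pM.
  have h2 : 4 * W * (q * ln K%:R) <= 4 * W * (17 * L * (16 * L)).
    by rewrite ler_wpM2l// mulr_ge0//; lra.
  apply: le_trans h2 (le_trans _ k1).
  have -> : 4 * W * (17 * L * (16 * L)) = 68 * 16 * (L ^+ 2 * W) by ring.
  by rewrite /x -[leRHS]mulrA ler_wpM2r//; lra.
- rewrite -/L; have -> : 2 * iter_const * L ^+ 2 * W = 2 * x by rewrite /x; ring.
  lra.
Qed.

(** The crude [ln y <= y] is enough, as the bound is only used inside a logarithm. *)
Lemma kl_uniform_le (A : finType) (p : A -> R) : simplex p ->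
  kl p (fun=> #|A|%:R^-1) <= #|A|%:R.
Proof.
move=> hp; apply: (@le_trans _ _ (\sum_a p a * #|A|%:R)).
  2: by rewrite -mulr_suml hp.2 mul1r.
apply: ler_sum => a _.
have [->|pn] := eqVneq (p a) 0; first by rewrite !mul0r.
have p0 : 0 < p a by rewrite lt_def pn hp.1.
have A0 : 0 < #|A|%:R :> R by rewrite ltr0n; apply/card_gt0P; exists a.
rewrite ler_pM2l// invrK.
apply: le_trans (ltW (ln_sublinear (mulr_gt0 p0 A0))) _.
by rewrite ler_piMl ?(simplex_le1 a hp)// ltW.
Qed.

End Choice.

(** * Accuracy and sample count for the prescribed stepsize *)

Section Complexity.
Variables (R : realType) (S A : finType) (M : amdp R S A) (d : nat).
Variables (Psi : 'M[R]_(#|{: S * A}|, d)) (u Gamma mubar kappa cbar : R) (x0 : S * A).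
Hypothesis hS : setting M Psi u Gamma mubar kappa cbar.
Variables (omega eps sigma : R) (pistar : S -> A -> R) (theta0 : 'cV[R]_d).
Hypotheses (omega0 : 0 < omega) (eps0 : 0 < eps) (sigma0 : 0 < sigma).
Hypotheses (hreg : is_regularizer M omega) (hopt : optimal M pistar).

Let Z := log_arg M Psi u kappa cbar omega Gamma mubar eps theta0.
Let par := evrtd_choice M Psi u (std_consts R) (ln Z).
Let Y : R := Z + sigma + sigma^-1.
Let W : R := sigma ^+ 2 / (omega ^+ 2 * (1 - Gamma) * eps).
Let gap := initial_gap M omega Gamma pistar.
Let q : R := 2 * (1 + ln (gap / sigma ^+ 2)).

Hypotheses (gap_ge : sigma ^+ 2 <= gap) (eps_le : eps <= sigma ^+ 2 / omega ^+ 2).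

Lemma total_size_bounds : [/\ 3 <= Y, Z <= Y, sigma <= Y & sigma^-1 <= Y].
Proof.
have Z3 := log_arg_ge3 x0 theta0 hS omega0 eps0; rewrite -/Z in Z3.
have s0 : 0 < sigma^-1 by rewrite invr_gt0.
by have := sigma0; rewrite /Y => s1; split; lra.
Qed.

Lemma initial_divergence_le : divergence M pistar (uniform_policy R (A:=A)) pistar <= Z.
Proof.
have [_ [_ [hz _ _ _]]] := problem_size_le x0 theta0 hS omega0 eps0.
have [n0 n1] := stationary_simplex (set_ergodic hS) hopt.1.
apply: le_trans hz; apply: (@le_trans _ _ (#|A|%:R)).
  apply: (@le_trans _ _ (\sum_s stationary M pistar s * #|A|%:R)); last first.
    by rewrite -mulr_suml n1 mul1r.
  by apply: ler_sum => s _; apply: ler_wpM2l => //; exact: kl_uniform_le (hopt.1 s).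
rewrite ler_nat card_prod -[X in (X <= _)%N]mul1n leq_mul2r; apply/orP; right.
by apply/card_gt0P; exists x0.1.
Qed.

Lemma initial_gap_le : gap / sigma ^+ 2 <= Y ^+ 7.
Proof.
have [Y3 ZY sY isY] := total_size_bounds.
have [[_ _ _ cZ] [[oZ _ _ _] _]] := problem_size_le x0 theta0 hS omega0 eps0.
have [g0 g1] := set_Gamma hS; have [_ c0] := set_pos hS.
have D0 := initial_divergence_le; have hu := uniform_is_policy R x0.
have Dp : 0 <= divergence M pistar (uniform_policy R (A:=A)) pistar.
  exact: (divergence_ge0 hS hopt (uniform_positive R x0)).
have o0 := omega0; have r1 := rho_le (set_ergodic hS) (set_cost hS) hu.
have r2 := rho_le (set_ergodic hS) (set_cost hS) hopt.1.
have r0 := hopt.2 _ hu.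
move: r1 r2; rewrite !ler_norml => /andP[_ r1] /andP[r2 _].
pose D := divergence M pistar (uniform_policy R (A:=A)) pistar.
pose dr := rho M (uniform_policy R (A:=A)) - rho M pistar.
have h1 : gap = (8 * Gamma * (1 - Gamma)) * (omega ^+ 2 * D + omega * dr).
  by rewrite /gap /initial_gap -/D -/dr; ring.
have dr0 : 0 <= dr by rewrite subr_ge0.
have dr1 : dr <= 2 * Y by rewrite /dr; rewrite -/Z in cZ; lra.
have D1 : D <= Y by apply: le_trans D0 _.
have oY : omega <= Y by apply: le_trans oZ _.
have o2 : omega ^+ 2 <= Y ^+ 2 by rewrite lerXn2r// nnegrE; lra.
have h2 : omega ^+ 2 * D + omega * dr <= 3 * Y ^+ 3.
  have a1 : omega ^+ 2 * D <= Y ^+ 2 * Y by apply: ler_pM => //; exact: sqr_ge0.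
  have a2 : omega * dr <= Y * (2 * Y) by apply: ler_pM => //; exact: ltW.
  have a3 : 2 * Y ^+ 2 <= Y * Y ^+ 2 by rewrite ler_wpM2r ?sqr_ge0//; lra.
  have a4 : 0 <= Y ^+ 3 by rewrite exprn_ge0//; lra.
  lra.
have h3 : 0 <= omega ^+ 2 * D + omega * dr.
  by rewrite addr_ge0 ?mulr_ge0 ?sqr_ge0// ltW.
have h4 : 8 * Gamma * (1 - Gamma) <= 3 by have := sqr_ge0 (2 * Gamma - 1); lra.
have h5 : gap <= Y ^+ 5.
  rewrite h1; apply: (@le_trans _ _ (3 * (3 * Y ^+ 3))).
    by apply: ler_pM => //; rewrite !mulr_ge0//; lra.
  have -> : Y ^+ 5 = Y ^+ 2 * Y ^+ 3 by rewrite -exprD.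
  have -> : 3 * (3 * Y ^+ 3) = 9 * Y ^+ 3 by ring.
  rewrite ler_wpM2r ?exprn_ge0//; first lra.
  have := mulr_ge0 (_ : 0 <= Y - 3) (_ : 0 <= Y + 3); lra.
have -> : Y ^+ 7 = Y ^+ 5 * Y ^+ 2 by rewrite -exprD.
apply: ler_pM => //; first exact: le_trans (sqr_ge0 _) gap_ge.
  by rewrite invr_ge0 sqr_ge0.
by rewrite -exprVn lerXn2r// nnegrE ?invr_ge0; [exact: ltW|lra].
Qed.

(** [W] is the iteration count without logarithms. The hypothesis [eps_le] makes it at least
    [(1 - Gamma)^-1], which later controls the ratio of stationary laws. *)
Lemma W_bounds : [/\ 1 <= W, W <= Y ^+ 6 & (1 - Gamma)^-1 <= W].
Proof.
have [Y3 ZY sY isY] := total_size_bounds.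
have [_ [[_ oZ gZ _] [_ _ _ eZ]]] := problem_size_le x0 theta0 hS omega0 eps0.
have [g0 g1] := set_Gamma hS.
have g2 : 0 < 1 - Gamma by rewrite subr_gt0.
have o2 : 0 < omega ^+ 2 by rewrite exprn_gt0.
have g3 : (1 - Gamma)^-1 <= W.
  have -> : W = (1 - Gamma)^-1 * (sigma ^+ 2 / omega ^+ 2 / eps).
    by rewrite /W; field; rewrite !gt_eqF.
  by rewrite ler_peMr ?invr_ge0 ?(ltW g2)// ler_pdivlMr// mul1r.
split=> //.
  by apply: le_trans g3; rewrite -[1]invr1 lef_pV2 ?posrE//; lra.
have -> : W = (sigma * sigma) * (omega^-1 * omega^-1) * ((1 - Gamma)^-1 * eps^-1).
  by rewrite /W; field; rewrite !gt_eqF.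
have -> : Y ^+ 6 = (Y * Y) * (Y * Y) * (Y * Y) by ring.
have i1 : 0 <= omega^-1 by rewrite invr_ge0 ltW.
have i2 : 0 <= (1 - Gamma)^-1 by rewrite invr_ge0 ltW.
have i3 : 0 <= eps^-1 by rewrite invr_ge0 ltW.
have i4 := ltW sigma0.
by rewrite !ler_pM ?mulr_ge0//; apply: le_trans ZY.
Qed.

(** [17 = 14 + 3]: the exponent 7 of [initial_gap_le] doubled, and [2 <= 3 * ln Y]. *)
Lemma q_bounds : 2 <= q /\ q <= 17 * ln Y.
Proof.
have [Y3 _ _ _] := total_size_bounds; have L0 := ln_ge_two_thirds Y3.
have s2 : 0 < sigma ^+ 2 by rewrite exprn_gt0.
have G1 : 1 <= gap / sigma ^+ 2 by rewrite ler_pdivlMr// mul1r.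
have G0 : 0 < gap / sigma ^+ 2 by exact: lt_le_trans G1.
have l0 := ln_ge0 G1.
have : ln (gap / sigma ^+ 2) <= ln (Y ^+ 7).
  rewrite ler_ln ?posrE//; first exact: initial_gap_le.
  by rewrite exprn_gt0//; lra.
rewrite lnXn; last by lra.
rewrite -[_ *+ 7]mulr_natl /q => l1; split; lra.
Qed.

Variable K : nat.
Hypotheses (K8 : 8 <= K%:R :> R) (KW : 4 * W * (q * ln K%:R) <= K%:R).

Let x : R := q * ln K%:R / K%:R.

Lemma lnK_ge1 : 1 <= ln K%:R :> R.
Proof.
have := @ln2_ge R; have : ln (2 ^+ 3) <= ln (K%:R : R).
  by have k8 := K8; rewrite ler_ln ?posrE ?exprn_gt0//; lra.
rewrite lnXn// -[_ *+ 3]mulr_natl; lra.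
Qed.

Lemma rate_bounds : [/\ 0 < x, x * W <= 4^-1, x <= 1 & x * (Gamma / (1 - Gamma)) <= 4^-1].
Proof.
have [W1 _ gW] := W_bounds; have [q2 _] := q_bounds; have l1 := lnK_ge1; have k8 := K8.
have [g0 g1] := set_Gamma hS.
have K0 : 0 < K%:R :> R by lra.
have q0 : 0 < q * ln K%:R by rewrite mulr_gt0//; lra.
have x0' : 0 < x by rewrite divr_gt0.
have xW : x * W <= 4^-1.
  by rewrite /x mulrAC ler_pdivrMr//; have := KW; lra.
split=> //.
  by have := ler_wpM2l (ltW x0') W1; lra.
apply: le_trans xW; apply: ler_wpM2l; first exact: ltW.
apply: le_trans gW; rewrite -[leRHS]mul1r ler_wpM2r ?invr_ge0//; lra.
Qed.

(** [K] is large enough for the second argument of the minimum to be the smaller one, so that [x] is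
    [lambda * omega]. *)
Lemma stepsizeE : stepsize M omega Gamma sigma pistar K = x / omega.
Proof.
have [x0' _ _ xr] := rate_bounds; have [g0 g1] := set_Gamma hS.
have g2 : 0 < 1 - Gamma by rewrite subr_gt0.
have K0 : 0 < K%:R :> R by have := K8; lra.
rewrite /stepsize -/gap -/q min_r; first by rewrite /x; field; rewrite !gt_eqF.
have -> : q * ln K%:R / (omega * K%:R) = x / omega.
  by rewrite /x; field; rewrite !gt_eqF.
have -> : (1 - Gamma) / (omega * Gamma) = (1 - Gamma) / Gamma / omega.
  by field; rewrite !gt_eqF.
rewrite ler_pM2r ?invr_gt0// ler_pdivlMr//.
move: xr; rewrite mulrA ler_pdivrMr//; lra.
Qed.

(** The exponent is [(1 + l) * ln K] with [l] the logarithm in the stepsize. As [ln K >= 1], it is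
    at least [ln K + l]: this is where [q] comes from. *)
Lemma growth_factor_ge : K%:R * (gap / sigma ^+ 2) <= (1 + x) ^+ K.+1.
Proof.
have [x0' _ x1 _] := rate_bounds; have l1 := lnK_ge1; have k8 := K8.
have K0 : 0 < K%:R :> R by lra.
have s2 : 0 < sigma ^+ 2 by rewrite exprn_gt0.
have G1 : 1 <= gap / sigma ^+ 2 by rewrite ler_pdivlMr// mul1r.
have G0 : 0 < gap / sigma ^+ 2 by exact: lt_le_trans G1.
have l0 := ln_ge0 G1.
apply: (@le_trans _ _ ((1 + x) ^+ K)); last first.
  by rewrite exprS ler_peMl ?exprn_ge0//; lra.
apply: le_trans (growth_ge K (ltW x0') x1).
have -> : x / 2 * K%:R = (1 + ln (gap / sigma ^+ 2)) * ln K%:R.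
  by rewrite /x /q; field; rewrite gt_eqF.
have -> : K%:R * (gap / sigma ^+ 2) = expR (ln K%:R + ln (gap / sigma ^+ 2)).
  by rewrite expRD !lnK.
rewrite ler_expR.
have := ler_wpM2l l0 l1; lra.
Qed.

(** The right side equals [2 * Gamma * (D + dr / omega)], and [2 * Gamma >= 1]; this is the origin
    of the weights in [initial_gap]. *)
Lemma initial_potential_le :
  potential M Gamma pistar (x / omega) (uniform_policy R (A:=A)) <=
    gap / (4 * (1 - Gamma) * omega ^+ 2).
Proof.
have [x0' _ _ xr] := rate_bounds; have [g0 g1] := set_Gamma hS.
have g2 : 0 < 1 - Gamma by rewrite subr_gt0.
have gh := Gamma_ge_half x0 hS; have hu := uniform_is_policy R x0.
have r0 := hopt.2 _ hu.
have Dp : 0 <= divergence M pistar (uniform_policy R (A:=A)) pistar.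
  exact: (divergence_ge0 hS hopt (uniform_positive R x0)).
rewrite /potential /gap /initial_gap.
set D := divergence _ _ _ _ in Dp *; set dr := rho _ _ - rho _ _.
have dr0 : 0 <= dr by rewrite subr_ge0.
have o1 : 0 <= dr / omega by rewrite divr_ge0// ltW.
have -> : (8 * Gamma * (1 - Gamma) * omega ^+ 2 * D + 8 * Gamma * (1 - Gamma) * omega * dr)
    / (4 * (1 - Gamma) * omega ^+ 2) = 2 * Gamma * (D + dr / omega).
  by field; rewrite !gt_eqF.
have -> : x / omega * (Gamma / (1 - Gamma) - 1) * dr =
    x * (Gamma / (1 - Gamma)) * (dr / omega) - x * (dr / omega).
  by field; rewrite !gt_eqF.
have h1 := ler_wpM2r o1 xr.
have h2 := mulr_ge0 (ltW x0') o1.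
have h3 : 0 <= (2 * Gamma - 1) * (D + dr / omega).
  by apply: mulr_ge0; [lra|exact: addr_ge0].
lra.
Qed.

Let lambda := stepsize M omega Gamma sigma pistar K.

Lemma lambda_gt0 : 0 < lambda.
Proof. by rewrite /lambda stepsizeE divr_gt0//; case: rate_bounds. Qed.

(** The error budget is [eps / 4] for the noise, [eps / 16] for the bias of EVRTD and [eps / 16] for
    the remainder of the initial potential. *)
Lemma spmd_accuracy :
  (forall n, (n <= K)%N -> almost_surely (spmd M Psi u lambda par theta0 x0 n)
    (fun z => evrtd_mse M Psi u z.1 (par z.1) theta0 z.2 <= sigma ^+ 2)) ->
  expect (spmd M Psi u lambda par theta0 x0 K.+1) (fun z => divergence M pistar z.1 pistar)
    <= eps_approx M Psi u / (omega * Gamma) + eps.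
Proof.
move=> has; have [g0 g1] := set_Gamma hS; have k8 := K8.
have g2 : 0 < 1 - Gamma by rewrite subr_gt0.
have [x0' xW x1 xr] := rate_bounds.
have K0 : 0 < K%:R :> R by lra.
have s2 : 0 < sigma ^+ 2 by rewrite exprn_gt0.
have gap0 : 0 < gap by exact: lt_le_trans gap_ge.
have lo : lambda * omega = x by rewrite /lambda stepsizeE; field; rewrite gt_eqF.
have hlam : lambda * omega * (Gamma / (1 - Gamma)) <= 1 by rewrite lo; lra.
have hb pi := @evrtd_bias _ _ _ _ _ _ _ _ _ _ _ x0 omega eps theta0 hS omega0 eps0 pi.
have hc pi := @evrtd_count _ _ _ _ _ _ _ _ _ _ _ x0 omega eps theta0 hS omega0 eps0 pi.
have := spmd_divergence (x0 := x0) (par := par) (sigma := sigma) (N := K.+1)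
  hS omega0 hreg hopt hb hc lambda_gt0 hlam has.
have lE : lambda = x / omega by exact: stepsizeE.
rewrite lo; set ED := expect _ _; rewrite lE => h.
set B := _ + _ / omega in h.
have eB : B <= eps_approx M Psi u / (omega * Gamma) + eps / 4 + eps / 16.
  have e1 : eps_approx M Psi u / omega <= eps_approx M Psi u / (omega * Gamma).
    rewrite ler_wpM2l ?(eps_approx_ge0 x0 hS)// lef_pV2 ?posrE ?mulr_gt0//.
    by rewrite ler_piMr// ltW.
  have e2 : Gamma / (1 - Gamma) * (x / omega) * sigma ^+ 2 / omega = Gamma * (eps * (x * W)).
    by rewrite /W; field; rewrite !gt_eqF.
  have e3 : (eps_approx M Psi u + 2 * (omega * eps / 32)) / omega =
      eps_approx M Psi u / omega + eps / 16 by field; rewrite gt_eqF.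
  have e4 := ler_wpM2l (ltW eps0) xW.
  have e5 : Gamma * (eps * (x * W)) <= eps * (x * W).
    rewrite ler_piMl ?(ltW g1)// mulr_ge0 ?(ltW eps0)// mulr_ge0 ?(ltW x0')//.
    by case: W_bounds; lra.
  rewrite /B e2 e3; lra.
suff : ED - B <= eps / 16 by have := eps0; lra.
rewrite leNgt; apply/negP => hlt.
have d0 : 0 < ED - B by have := eps0; lra.
have h1 := le_trans (ler_wpM2r (ltW d0) growth_factor_ge) (le_trans h initial_potential_le).
have KWe : W <= K%:R / 8.
  have [W1 _ _] := W_bounds; have [q2 _] := q_bounds; have l1 := lnK_ge1.
  have q1 : 2 * 1 <= q * ln K%:R by apply: ler_pM.
  have := ler_wpM2l (_ : 0 <= 4 * W) q1; have := KW; lra.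
have h2 : K%:R * (gap / sigma ^+ 2) * (eps / 16) < gap / (4 * (1 - Gamma) * omega ^+ 2).
  apply: lt_le_trans h1; rewrite ltr_pM2l// mulr_gt0// divr_gt0//.
have h3 : gap / (4 * (1 - Gamma) * omega ^+ 2) = gap / sigma ^+ 2 * (W * eps / 4).
  by rewrite /W; field; rewrite !gt_eqF.
have h4 : K%:R * (gap / sigma ^+ 2) * (eps / 16) = gap / sigma ^+ 2 * (K%:R * eps / 16) by ring.
move: h2; rewrite h3 h4 ltr_pM2l ?divr_gt0//.
have := ler_wpM2r (ltW eps0) KWe; have := mulr_gt0 K0 eps0; lra.
Qed.

Lemma spmd_transitions : almost_surely (spmd M Psi u lambda par theta0 x0 K.+1)
  (fun z => z.2.2%:R <= K.+1%:R * (count_const R *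
     (kappa ^+ 2 * (t_mix M ^+ 3 / mubar) * ln Z ^+ 2))).
Proof.
have hc pi := @evrtd_count _ _ _ _ _ _ _ _ _ _ _ x0 omega eps theta0 hS omega0 eps0 pi.
apply: almost_surely_law_on; apply: law_onW (law_on_spmd x0 hS hreg theta0 hc lambda_gt0 K.+1).
by move=> z [_].
Qed.

End Complexity.

Lemma count_const_gt0 (R : realType) : 0 < count_const R.
Proof.
have n m : 0 < m.+1%:R :> R := ltr0Sn R m.
exact: (mulr_gt0 (n 65%N) (mulr_gt0 (n 258%N) (addr_gt0 (addr_gt0 (addr_gt0 (n 63%N) ltr01)
  (addr_gt0 (mulr_gt0 (n 511%N) (n 63%N)) ltr01))
  (addr_gt0 (mulr_gt0 (n 63%N) (mulr_gt0 (n 127%N) (n 63%N))) ltr01)))).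
Qed.

Theorem corollary4 (R : realType) :
  exists (k : evrtd_consts R) (deg : nat) (C0 : R), consts_pos k /\ 0 < C0 /\
  forall kappa cbar : R, 0 < kappa -> 0 < cbar ->
  exists C : R, 0 < C /\
  forall (S A : finType) (M : amdp R S A) (omega Gamma : R)
    (pistar : S -> A -> R) (d : nat) (Psi : 'M[R]_(#|{: S * A}|, d))
    (u mubar : R) (theta0 : 'cV[R]_d) (x0 : S * A) (eps : R),
  is_amdp M -> ergodic M ->
  0 < Gamma -> Gamma < 1 ->
  (forall pi, is_policy pi -> forall s, 1 - Gamma <= stationary M pi s) ->
  0 < omega -> is_regularizer M omega -> cost_bounded M cbar ->
  optimal M pistar ->
  features_ok Psi -> floor_ok M Psi u ->
  0 < mubar -> (forall pi, is_policy pi -> mubar <= mu M Psi u pi) ->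
  (forall pi, is_policy pi ->
     [/\ 0 < beta_gap M Psi pi, (beta_gap M Psi pi)^-1 <= kappa * t_mix M,
         0 < tbeta_gap M Psi u pi
       & (tbeta_gap M Psi u pi)^-1 <= kappa * t_mix M]) ->
  0 < eps ->
  let size := problem_size M Psi u kappa cbar omega Gamma mubar eps theta0 in
  let par := evrtd_choice M Psi u k (ln (3 + size)) in
  (forall sigma : R, 0 < sigma ->
   let run K := spmd M Psi u (stepsize M omega Gamma sigma pistar K) par theta0 x0 in
   (forall K n : nat, (0 < K)%N -> (n <= K)%N ->
      almost_surely (run K n)
        (fun z => evrtd_mse M Psi u z.1 (par z.1) theta0 z.2 <= sigma ^+ 2)) ->
   sigma ^+ 2 <= initial_gap M omega Gamma pistar ->
   eps <= sigma ^+ 2 / omega ^+ 2 ->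
   let polylog := ln (3 + size + sigma + sigma^-1) ^+ deg in
   exists K : nat,
     [/\ (0 < K)%N,
         K%:R <= C0 * polylog * (sigma ^+ 2 / (omega ^+ 2 * (1 - Gamma) * eps)),
         expect (run K K.+1) (fun z => divergence M pistar z.1 pistar)
           <= C0 * (eps_approx M Psi u / (omega * Gamma)) + eps
       & almost_surely (run K K.+1) (fun z => z.2.2%:R
           <= C * polylog * (sigma ^+ 2 * t_mix M ^+ 3
                / (omega ^+ 2 * (1 - Gamma) * mubar * eps)))]) /\
  (forall (pi : S -> A -> R) (x : position S A), is_policy pi ->
     evrtd_mse M Psi u pi (par pi) theta0 x
       <= C * ((mubar^-1 * t_mix M ^+ 2 + (mubar^-1 + 1) * eps_approx M Psi u ^+ 2)
               / min_lambda_perturbed M u)).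
Proof.
have c0 : 0 < iter_const R by rewrite exprn_gt0// ltr0n.
have cc0 := count_const_gt0 R.
have n4 : 0 < 4 :> R by rewrite ltr0n.
(* Degree 4: two logarithms in [K] and two in the samples per iteration, from the epochs and the
   walks. The factor 5 turns [2 * L ^+ 2] into [5 * L ^+ 4], as [L ^+ 2 >= 4 / 9]. *)
exists (std_consts R), 4%N, (5 * iter_const R).
split; [exact: std_consts_pos|split; first by rewrite mulr_gt0].
move=> kappa cbar kappa0 cbar0.
pose Ccount := 4 * iter_const R * count_const R * kappa ^+ 2.
pose Cmse : R := 42 + 8 * (44 * cbar) ^+ 2.
have Ccount0 : 0 < Ccount by exact: mulr_gt0 (mulr_gt0 (mulr_gt0 n4 c0) cc0) (exprn_gt0 2 kappa0).
have Cmse0 : 0 < Cmse.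
  by rewrite /Cmse ltr_pwDl ?ltr0n// mulr_ge0 ?sqr_ge0 ?ler0n.
exists (Ccount + Cmse); split; first exact: addr_gt0.
move=> S A M omega Gamma pistar d Psi u mubar theta0 x0 eps hM hE g0 g1 hnu omega0 hreg hc
  hopt hPsi hfloor mubar0 hmu hgap eps0 size par.
have hS : setting M Psi u Gamma mubar kappa cbar by split.
split; last first.
  move=> pi x hpi; apply: le_trans (evrtd_mse_le x0 theta0 hS omega0 eps0 hpi x) _.
  rewrite -/Cmse; apply: ler_wpM2r; last by rewrite lerDr ltW.
  rewrite divr_ge0 ?(ltW (min_lambda_gt0 x0 hS))// addr_ge0// mulr_ge0 ?sqr_ge0//.
    by rewrite invr_ge0 ltW.
  by rewrite addr_ge0 ?invr_ge0 ?ltW.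
move=> sigma sigma0 run hmse hgap0 heps polylog.
have [Y3 ZY _ _] := total_size_bounds x0 hS theta0 omega0 eps0 sigma0.
have [W1 WY _] := W_bounds x0 hS theta0 omega0 eps0 sigma0 heps.
have [q2 qY] := q_bounds x0 hS theta0 omega0 eps0 sigma0 hopt hgap0.
set Y := log_arg _ _ _ _ _ _ _ _ _ _ + sigma + sigma^-1 in Y3 ZY WY qY.
set W := _ / _ in W1 WY.
have q0 := le_trans (ler0n R 2) q2.
have [K [K8 KW KY]] := iterations_exist Y3 W1 WY q0 qY.
have L0 := ln_ge_two_thirds Y3.
have polyE : polylog = ln Y ^+ 4 by [].
set L := ln Y in L0 KY polyE.
have L2 : 4 / 9 <= L ^+ 2 by have := sqr_ge0 (L - 2 / 3); lra.
have K0 : (0 < K)%N by rewrite -(ltr0n R); lra.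
exists K; split=> //.
- rewrite -/W polyE; apply: le_trans KY _.
  have -> : L ^+ 4 = L ^+ 2 * L ^+ 2 by rewrite -exprD.
  have h : L ^+ 2 * (4 / 9) <= L ^+ 2 * L ^+ 2 by rewrite ler_wpM2l ?sqr_ge0.
  have -> : 2 * iter_const R * L ^+ 2 * W = iter_const R * (2 * L ^+ 2 * W) by ring.
  have -> : 5 * iter_const R * (L ^+ 2 * L ^+ 2) * W =
    iter_const R * (5 * (L ^+ 2 * L ^+ 2) * W) by ring.
  rewrite ler_pM2l// ler_wpM2r//; lra.
- have hacc := spmd_accuracy hS omega0 eps0 sigma0 hreg hopt hgap0 heps K8 KW
    (fun n hn => hmse K n K0 hn).
  apply: le_trans hacc _; rewrite lerD2r ler_peMl//; last first.
    by have := iter_const_ge R; lra.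
  by rewrite divr_ge0 ?(eps_approx_ge0 x0 hS)// ltW ?mulr_gt0.
have htr := spmd_transitions x0 hS theta0 omega0 eps0 sigma0 hreg hopt hgap0 heps K8 KW.
apply: List.Forall_impl htr => z hz z0; apply: le_trans (hz z0) _.
rewrite polyE; set l := ln (log_arg _ _ _ _ _ _ _ _ _ _).
set T := t_mix M ^+ 3 / mubar.
have -> : sigma ^+ 2 * t_mix M ^+ 3 / (omega ^+ 2 * (1 - Gamma) * mubar * eps) = W * T.
  by rewrite /W /T; field; rewrite !gt_eqF// subr_gt0.
have T0 : 0 <= T.
  have t1 := t_mix_ge1 hE (uniform_is_policy R x0).
  by rewrite divr_ge0 ?(ltW mubar0)// exprn_ge0//; lra.
have Z3 := log_arg_ge3 x0 theta0 hS omega0 eps0.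
have l0 : 0 <= l by have := ln_ge_two_thirds Z3; rewrite -/l; lra.
have lL : l ^+ 2 <= L ^+ 2.
  have lL1 : l <= L by rewrite ler_ln ?posrE//; lra.
  by rewrite lerXn2r// nnegrE; lra.
have L20 : 0 <= L ^+ 2 := sqr_ge0 L.
have W0 : 0 <= W by lra.
have WT0 : 0 <= W * T by exact: mulr_ge0.
have K1 : K.+1%:R <= 4 * (iter_const R * L ^+ 2 * W).
  have -> : K.+1%:R = K%:R + 1 :> R by rewrite -natr1.
  have e : 2 * iter_const R * L ^+ 2 * W = 2 * (iter_const R * L ^+ 2 * W) by ring.
  by rewrite e in KY; move: KY K8; move: (iter_const R * L ^+ 2 * W) => y; lra.
apply: (@le_trans _ _ (Ccount * L ^+ 4 * (W * T))); last first.
  apply: ler_wpM2r => //; apply: ler_wpM2r; first exact: exprn_even_ge0.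
  by rewrite lerDl ltW.
have -> : Ccount * L ^+ 4 * (W * T) =
    4 * (iter_const R * L ^+ 2 * W) * (count_const R * (kappa ^+ 2 * T * L ^+ 2)).
  have -> : L ^+ 4 = L ^+ 2 * L ^+ 2 by rewrite -exprD.
  by rewrite /Ccount; move: (L ^+ 2) (iter_const R) (count_const R) => a b c; ring.
have k20 := sqr_ge0 kappa; have kT := mulr_ge0 k20 T0.
apply: ler_pM => //; first exact: mulr_ge0 (ltW cc0) (mulr_ge0 kT (sqr_ge0 l)).
rewrite (ler_pM2l cc0); exact: ler_wpM2l.
Qed.
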